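(* Fix an integer $d\geq 2$ and $q_1,\ldots,q_d\in\mathbb{N}$. Further, let $f^{(i)}\in\ell_0^2(\mathbb{N})^{\circ q_i}$ for each $i\in\{1,\ldots,d\}$, define the random vector $\mathbf{F}:=(J_{q_1}(f^{(1)}),\ldots,J_{q_d}(f^{(d)}))$ and denote by $\mathbf{N}$ a centred Gaussian random vector with covariance matrix $\Sigma=(\sigma_{ij})_{i,j=1}^d$, such that $\sigma_{ij}=0$ if $q_i\neq q_j$. Then \begin{align*} d_4(\mathbf{F},\mathbf{N}) &\leq C_1\max_{i,j=1,\ldots,d}\Big\{\big|\sigma_{ij}-\mathbb{E}[J_{q_i}(f^{(i)})J_{q_j}(f^{(j)})]\big|,\ \max_{r=1,\ldots,\min\{q_i,q_j\}}\big\{\|f^{(i)}\star_r^r f^{(j)}\|_{\ell^2(\mathbb{N})^{\otimes (q_i+q_j-2r)}}\big\}\,\mathbf{1}_{\{q_i\neq q_j\}},\\ &\qquad\qquad \max_{r=1,\ldots,q_i-1}\big\{\|f^{(i)}\star_r^r f^{(j)}\|_{\ell^2(\mathbb{N})^{\otimes 2(q_i-r)}}\big\}\,\mathbf{1}_{\{q_i= q_j\}},\ \max_{r=1,\ldots,q_i-1}\big\{\|f^{(i)}\star_r^r f^{(i)}\|_{\ell^2(\mathbb{N})^{\otimes 2(q_i-r)}}^2\big\}\Big\}\\ &\leq C_2\max_{i,j=1,\ldots,d}\Big\{\big|\sigma_{ij}-\mathbb{E}[J_{q_i}(f^{(i)})J_{q_j}(f^{(j)})]\big|,\ \max_{r=1,\ldots,q_i-1}\Big\{\|f^{(i)}\star_r^r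 f^{(i)}\|_{\ell^2(\mathbb{N})^{\otimes 2(q_i-r)}},\\ &\qquad\qquad\|f^{(i)}\star_r^r f^{(i)}\|^2_{\ell^2(\mathbb{N})^{\otimes 2(q_i-r)}},\ \|f^{(j)}\|_{\ell^2(\mathbb{N})^{\otimes q_j}}\,\|f^{(i)}\star_r^rf^{(i)}\|_{\ell^2(\mathbb{N})^{\otimes 2(q_i-r)}}^{1/2}\Big\}\Big\} \end{align*} with universal constants $0<C_1,C_2<\infty$ only depending on $d$ and on $q_1,\ldots,q_d$.
   Context: $\mathbb{N}=\{1,2,\ldots\}$ and $(X_n)_{n\in\mathbb{N}}$ is a Rademacher sequence: i.i.d. with $P(X_n=\pm1)=\frac12$. $\Delta_n=\{(i_1,\dots,i_n)\in\mathbb{N}^n: i_k\ne i_l\text{ for }k\neq l\}$; $\ell^2(\mathbb{N})^{\otimes n}$ is the space of square-summable functions on $\mathbb{N}^n$ with its usual norm, and $\ell_0^2(\mathbb{N})^{\circ n}$ is its subset of symmetric functions vanishing outside $\Delta_n$. For $q\geq 1$ and $f\in\ell_0^2(\mathbb{N})^{\circ q}$, $J_q(f)=q!\sum_{1\le i_1<\dots<i_q<\infty}f(i_1,\dots,i_q)X_{i_1}\cdots X_{i_q}$ is the discrete multiple stochastic integral of order $q$. Contractions: for $f\in\ell_0^2(\mathbb{N})^{\circ n}$, $g\in\ell_0^2(\mathbb{N})^{\circ m}$ and $1\le r\le \min\{n,m\}$, $$f\star_r^rg(i_1,\dots,i_{n-r},k_1,\dots,k_{m-r})=\sum_{(a_1,\dots,a_r)\in\Delta_r}f(i_1,\dots,i_{n-r},a_1,\dots,a_r)\,g(k_1,\dots,k_{m-r},a_1,\dots,a_r).$$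 Distance: for $h:\mathbb{R}^d\to\mathbb{R}$ put $M_k(h)=\max_{1\le i_1,\dots,i_k\le d}\sup_{x\in\mathbb{R}^d}|\frac{\partial^k}{\partial x_{i_1}\cdots\partial x_{i_k}}h(x)|$. Then $d_4(\mathbf{Z},\mathbf{N})=\sup_g|\mathbb{E}g(\mathbf{Z})-\mathbb{E}g(\mathbf{N})|$, the supremum running over all $g:\mathbb{R}^d\to\mathbb{R}$ having continuous partial derivatives up to order $4$ and satisfying $M_i(g)\le1$ for $i\in\{1,2,3,4\}$.
   Formalization: The bound on d_4(F,N) is proved only when all q_i ≥ 2: if some q_i = 1 (empty max read as 0) it fails, e.g. F_i = X_1, other f^(j) = 0, σ_ii = 1, other σ = 0. The inequality between the two right-hand sides is proved for all q_i ≥ 1. *)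

(* Defs.v *)
(* MathComp / MathComp-Analysis. *)
From HB Require Import structures.
From mathcomp Require Import all_boot all_order all_algebra.
From mathcomp Require Import all_classical all_reals all_analysis.

Set Implicit Arguments.
Unset Strict Implicit.
Unset Printing Implicit Defensive.
Import Order.TTheory GRing.Theory Num.Theory.
Import numFieldNormedType.Exports.
Local Open Scope classical_set_scope.
Local Open Scope ring_scope.

(* The index set {1, 2, ...} is relabelled, preserving its order, as nat:
   X 0, X 1, ... is the sequence X_1, X_2, ..., and a function on its n-th
   power is a function on n.-tuple nat. *)

Section rademacher.
Context {dO : measure_display} {Omega : measurableType dO} {R : realType}.
Variable P : probability Omega R.

Definition mutually_independent (X : nat -> Omega -> R) : Prop :=
  forall (s : seq nat) (B : nat -> set R), uniq s ->
    (forall n, measurable (B n)) ->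
    P (\bigcap_(n in [set` s]) (X n @^-1` B n))
    = (\prod_(n <- s) fine (P (X n @^-1` B n)))%:E.

Definition rademacher_sequence (X : nat -> {RV P >-> R}) : Prop :=
  mutually_independent X /\
  forall n, P (X n @^-1` [set 1]) = (2^-1)%:E /\
            P (X n @^-1` [set -1]) = (2^-1)%:E.

End rademacher.

Section kernels.
Context {R : realType}.

Definition square_summable n (f : n.-tuple nat -> R) : Prop :=
  summable [set: n.-tuple nat] (fun t => ((f t) ^+ 2)%:E).

(* Meaningful for square-summable f; [fine] sends +oo to 0. *)
Definition l2norm n (f : n.-tuple nat -> R) : R :=
  Num.sqrt (fine (\esum_(t in [set: n.-tuple nat]) ((f t) ^+ 2)%:E)).

Definition symmetric_fun n (f : n.-tuple nat -> R) : Prop :=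
  forall s t : n.-tuple nat, perm_eq s t -> f s = f t.

(* [uniq t] says that t lies in Delta_n. *)
Definition ell02 n (f : n.-tuple nat -> R) : Prop :=
  [/\ square_summable f, symmetric_fun f &
      forall t : n.-tuple nat, ~~ uniq t -> f t = 0].

(* Sum of an absolutely summable real family (\esum itself is only meant for
   nonnegative families). *)
Definition real_sum (T : choiceType) (D : set T) (u : T -> R) : R :=
  fine (\esum_(t in D) (Num.max (u t) 0)%:E)
  - fine (\esum_(t in D) (Num.max (- u t) 0)%:E).

(* The sequence s read as an n-tuple; exact when size s = n. *)
Definition as_tuple n (s : seq nat) : n.-tuple nat :=
  [tuple nth 0%N s k | k < n].

(* f *_r^r g, for r <= minn n m.  The first n - r entries of the argument are
   the i's and the last m - r are the k's.  The sum converges absolutely by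
   Cauchy-Schwarz, and the contraction is again square-summable. *)
Definition contraction n m (r : nat)
    (f : n.-tuple nat -> R) (g : m.-tuple nat -> R) :
    (n - r + (m - r)).-tuple nat -> R :=
  fun t => real_sum [set a : r.-tuple nat | uniq a]
    (fun a => f (as_tuple n (take (n - r) t ++ a))
            * g (as_tuple m (drop (n - r) t ++ a))).

End kernels.

Arguments contraction {R n m} r f g _.

Section multiple_integral.
Context {dO : measure_display} {Omega : measurableType dO} {R : realType}.
Variable P : probability Omega R.

Definition multiple_integral_partial (X : nat -> Omega -> R) q
    (f : q.-tuple nat -> R) (n : nat) (w : Omega) : R :=
  q`!%:R * \sum_(t : q.-tuple 'I_n | sorted ltn (map val t))
             f (map_tuple val t) * \prod_(k < q) X (tnth t k) w.

(* F is (a version of) J_q(f).  The infinite sum converges in L^2, so that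
   J_q(f) is determined up to almost sure equality. *)
Definition is_multiple_integral (X : nat -> Omega -> R) q
    (f : q.-tuple nat -> R) (F : Omega -> R) : Prop :=
  'E_P[fun w => ((F w - multiple_integral_partial X f n w) ^+ 2)%R]%E
    @[n --> \oo] --> 0%E.

(* The library's [normal_prob m s] (s is the standard deviation) is a junk
   value at s = 0; Gaussian laws here include the degenerate ones. *)
Definition gaussian_law (m s : R) (A : set R) : \bar R :=
  if s == 0 then \d_m A else normal_prob m s A.

Definition gaussian_variable (Y : Omega -> R) : Prop :=
  exists m s : R, forall A : set R, measurable A ->
    P (Y @^-1` A) = gaussian_law m s A.

Definition gaussian_vector d (N : 'I_d -> {RV P >-> R}) : Prop :=
  forall a : 'I_d -> R, gaussian_variable (fun w => \sum_(i < d) a i * N i w).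

Definition centred_gaussian_vector d (N : 'I_d -> {RV P >-> R})
    (Sigma : 'M[R]_d) : Prop :=
  [/\ gaussian_vector N,
      forall i, 'E_P[N i]%E = 0%E &
      forall i j, covariance P (N i) (N j) = (Sigma i j)%:E].

End multiple_integral.

Section distance.
Context {R : realType} {d : nat}.

Definition basis_vector (i : 'I_d) : 'rV[R]_d := delta_mx 0 i.

(* Iterated partial derivative; the head of the list is applied last. *)
Fixpoint partial_derivative (s : seq 'I_d) (g : 'rV[R]_d -> R) :
    'rV[R]_d -> R :=
  if s is i :: s' then 'D_(basis_vector i) (partial_derivative s' g) else g.

Definition continuously_differentiable (k : nat) (g : 'rV[R]_d -> R) : Prop :=
  (forall (s : seq 'I_d) (i : 'I_d) (x : 'rV[R]_d), (size s < k)%N ->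
     derivable (partial_derivative s g) x (basis_vector i)) /\
  (forall s : seq 'I_d, (size s <= k)%N ->
     continuous (partial_derivative s g)).

Definition Mk (k : nat) (g : 'rV[R]_d -> R) : \bar R :=
  \big[maxe/0%E]_(s : k.-tuple 'I_d)
    ereal_sup [set (`|partial_derivative s g x|)%:E | x in [set: 'rV[R]_d]].

Definition d4_test_functions : set ('rV[R]_d -> R) :=
  [set g | continuously_differentiable 4 g /\
           forall k, (1 <= k <= 4)%N -> (Mk k g <= 1)%E].

Definition d4 (dO dO' : measure_display)
    (Omega : measurableType dO) (Omega' : measurableType dO')
    (P : probability Omega R) (P' : probability Omega' R)
    (Z : 'I_d -> Omega -> R) (N : 'I_d -> Omega' -> R) : \bar R :=
  ereal_sup [set (`| 'E_P[fun w => g (\row_i Z i w)]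
                     - 'E_P'[fun w => g (\row_i N i w)] |)%E
            | g in d4_test_functions].

End distance.

Section bounds.
Context {R : realType} {d : nat}.
Variables (q : 'I_d -> nat) (f : forall i, (q i).-tuple nat -> R).
(* [gap i j] stands for |sigma_ij - E[J_{q_i}(f_i) J_{q_j}(f_j)]|. *)
Variable gap : 'I_d -> 'I_d -> R.

Definition cnorm (i j : 'I_d) (r : nat) : R := l2norm (contraction r (@f i) (@f j)).

(* All quantities are nonnegative, so that 0 is a neutral start for the maxima;
   a maximum over an empty range of r is 0. *)
Definition first_bound : R :=
  \big[Num.max/0]_(i < d) \big[Num.max/0]_(j < d)
    Num.max (gap i j)
   (Num.max ((\big[Num.max/0]_(1 <= r < (minn (q i) (q j)).+1) cnorm i j r)
               * (q i != q j)%:R)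
   (Num.max ((\big[Num.max/0]_(1 <= r < q i) cnorm i j r) * (q i == q j)%:R)
            (\big[Num.max/0]_(1 <= r < q i) (cnorm i i r) ^+ 2))).

Definition second_bound : R :=
  \big[Num.max/0]_(i < d) \big[Num.max/0]_(j < d)
    Num.max (gap i j)
      (\big[Num.max/0]_(1 <= r < q i)
        Num.max (cnorm i i r)
       (Num.max ((cnorm i i r) ^+ 2)
                (l2norm (@f j) * Num.sqrt (cnorm i i r)))).

End bounds.

(* Main.v *)
(* Truncating the kernels turns the F_i into Walsh polynomials of degree q_i on
   the cube {-1, 1}^n.  For a trigonometric polynomial T in place of the test
   function, T_tau(x) := E T(x + sqrt (1 - tau^2) N) is again one, and its
   value at tau F interpolates between E T(N) and E T(F).  On the cube F_i is
   an eigenvector of the Ornstein-Uhlenbeck generator, so integration by parts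
   bounds the derivative in tau by the fourth derivatives of T against fourth
   moments of discrete gradients, plus the second derivatives of T against
   Sigma_ij - Gamma_ij, where Gamma is the carre du champ.  Expanding Gamma_ij
   in Walsh functions bounds its variance, and the fourth moments, by norms of
   contractions of the coefficients; these tend to the norms of f_i *_r^r f_j as
   n -> oo.
   A test function g is reached by averaging it over the end points of a random
   walk whose step probabilities involve sin (lam x_i): this produces a
   trigonometric polynomial in x close to g, with derivatives of orders 1 to 4
   bounded by a universal constant.
   The second inequality is Cauchy-Schwarz after exchanging the contracted and
   the free variables:
     |f_i *_r f_j|^2 <= |f_i *_(q_i-r) f_i| |f_j *_(q_j-r) f_j|. *)
Require Import Defs.
From HB Require Import structures.
From mathcomp Require Import all_boot all_order all_algebra.
From mathcomp Require Import all_classical all_reals all_analysis.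
From mathcomp Require Import measurable_realfun ring lra.

Set Implicit Arguments.
Unset Strict Implicit.
Unset Printing Implicit Defensive.
Import Order.TTheory GRing.Theory Num.Theory.
Import numFieldNormedType.Exports.
Local Open Scope ring_scope.

(** * Walsh analysis on the discrete cube *)

Section sums.
Context {R : realType}.

(** Trigonometric polynomials are chosen because Gaussian smoothing acts on them by explicit
    multipliers: the smoothed polynomial is differentiated in tau as a finite sum, and N enters only
    through the cosine transforms of its one-dimensional projections, so singular Sigma are covered.
    The obstacle is that the test functions of [d4] are unbounded and only their derivatives of
    orders 1 to 4 are controlled, so an approximation must not inflate these. The random walk
    achieves this: differentiating in x_i amounts to replacing one step by a centred difference of
    g, which the mean value theorem bounds like a derivative of g. Its error grows quadratically in
    x, which the second moments of F and N absorb. Fourth derivatives appear because the cube has no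
    chain rule: integration by parts compares a first derivative of T at two neighbouring points,
    and the trapezoidal rule between them leaves a remainder with three more derivatives. The two
    maxima compare with constant 1, so that C1 and C2 can be taken equal. *)

Lemma sum_cauchy_schwarz (I : Type) (r : seq I) (P : pred I) (u v : I -> R) :
  (\sum_(i <- r | P i) u i * v i) ^+ 2
  <= (\sum_(i <- r | P i) u i ^+ 2) * (\sum_(i <- r | P i) v i ^+ 2).
Proof.
rewrite -[leRHS](subrK ((\sum_(i <- r | P i) u i * v i) ^+ 2)) lerDr.
(* Lagrange's identity: the defect in Cauchy-Schwarz is half of a sum of squares. *)
have lag : \sum_(i <- r | P i) \sum_(j <- r | P j) (u i * v j - u j * v i) ^+ 2
  = 2 * ((\sum_(i <- r | P i) u i ^+ 2) * (\sum_(i <- r | P i) v i ^+ 2)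
         - (\sum_(i <- r | P i) u i * v i) ^+ 2).
  have -> : \sum_(i <- r | P i) \sum_(j <- r | P j) (u i * v j - u j * v i) ^+ 2
    = \sum_(i <- r | P i) \sum_(j <- r | P j)
        (u i ^+ 2 * v j ^+ 2 + v i ^+ 2 * u j ^+ 2
         - 2 * ((u i * v i) * (u j * v j))).
    by apply: eq_bigr => i _; apply: eq_bigr => j _; ring.
  under eq_bigr do rewrite big_split big_split sumrN /= -!mulr_sumr.
  rewrite big_split big_split sumrN /= -!mulr_suml -!mulr_sumr -mulr_suml.
  by ring.
have : 0 <= \sum_(i <- r | P i) \sum_(j <- r | P j) (u i * v j - u j * v i) ^+ 2.
  by apply: sumr_ge0 => i _; apply: sumr_ge0 => j _; exact: sqr_ge0.
by rewrite lag pmulr_rge0.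
Qed.

Lemma sum_sqr_le_card (I : finType) (P : pred I) (u : I -> R) :
  (\sum_(i | P i) u i) ^+ 2 <= #|P|%:R * \sum_(i | P i) u i ^+ 2.
Proof.
have := sum_cauchy_schwarz (index_enum I) P (fun=> 1) u.
under eq_bigr do rewrite mul1r.
by under [X in _ <= X * _]eq_bigr do rewrite expr1n; rewrite sumr_const.
Qed.

Lemma ler_sum_subpred (I : Type) (r : seq I) (P Q : pred I) (u : I -> R) :
  (forall i, P i -> Q i) -> (forall i, 0 <= u i) ->
  \sum_(i <- r | P i) u i <= \sum_(i <- r | Q i) u i.
Proof.
move=> PQ u0; rewrite big_mkcond [leRHS]big_mkcond; apply: ler_sum => i _.
by case: (boolP (P i)) => [/PQ ->//|_]; case: ifP.
Qed.

Lemma ler_norm_sqrt_sqr (a b : R) : a ^+ 2 <= b -> `|a| <= Num.sqrt b.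
Proof. by move=> ab; rewrite -sqrtr_sqr ler_wsqrtr. Qed.

End sums.

Section cube.
Context {R : realType} {n : nat}.
Local Notation T := 'I_n.
Implicit Types (A B S : {set T}) (k : T) (phi : {set T} -> R).

(** A subset [S] encodes the point of the cube whose coordinates are -1 exactly on [S]; subsets thus
    serve both as points and as indices of Walsh functions. *)
Definition rad k S : R := (-1) ^+ (k \in S).
Definition walsh A S : R := \prod_(k in A) rad k S.
Definition cube_mean phi : R := (2 ^+ n)^-1 * \sum_(S : {set T}) phi S.
Definition symdiff A B : {set T} := (A :\: B) :|: (B :\: A).
Definition flip k S : {set T} := symdiff [set k] S.
Definition walsh_poly (al : {set T} -> R) S : R := \sum_A al A * walsh A S.
(** Coefficients of the discrete gradient in direction [k], half the difference of the values at
    coordinate +1 and -1: [k] is deleted from every monomial that contains it. *)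
Definition walsh_deriv k (al : {set T} -> R) A : R :=
  if k \in A then 0 else al (k |: A).

Lemma card_cube : #|{set T}| = (2 ^ n)%N.
Proof. by rewrite -[RHS](congr1 (expn 2) (card_ord n)) -cardsT
  -powersetT card_powerset !cardsT. Qed.

Lemma rad_sqr k S : rad k S * rad k S = 1.
Proof. by rewrite /rad; case: (k \in S); rewrite ?expr1 ?expr0 ?mulrNN mulr1. Qed.

Lemma flipK k : involutive (flip k).
Proof.
by move=> S; apply/setP => x; rewrite !inE; case: (x == k); case: (x \in S).
Qed.

Lemma rad_flip j k S : rad j (flip k S) = (-1) ^+ (j == k) * rad j S.
Proof.
rewrite /rad !inE; case: (j == k); case: (j \in S);
  by rewrite /= ?expr1 ?expr0 ?mulrNN ?mulr1 ?mul1r.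
Qed.

Lemma walsh_mul A B S : walsh A S * walsh B S = walsh (symdiff A B) S.
Proof.
rewrite /walsh !(big_mkcond (fun k => k \in _)) -big_split /=.
apply: eq_bigr => k _; rewrite !inE.
by case: (k \in A); case: (k \in B); rewrite /= ?rad_sqr ?mulr1 ?mul1r.
Qed.

Lemma walsh_flip_in k A S : k \in A -> walsh A (flip k S) = - walsh A S.
Proof.
move=> kA; rewrite /walsh (bigD1 k) //= [in RHS](bigD1 k) //= rad_flip eqxx.
rewrite expr1 mulN1r mulNr; congr (- (_ * _)).
by apply: eq_bigr => j /andP[_ jk]; rewrite rad_flip (negPf jk) expr0 mul1r.
Qed.

Lemma walsh_flip_notin k A S : k \notin A -> walsh A (flip k S) = walsh A S.
Proof.
move=> kA; apply: eq_bigr => j jA; rewrite rad_flip.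
by case: eqP => [jk|]; rewrite ?expr0 ?mul1r//; move: kA; rewrite -jk jA.
Qed.

Lemma cube_mean_flip k phi :
  cube_mean phi = 2^-1 * cube_mean (fun S => phi S + phi (flip k S)).
Proof.
rewrite /cube_mean big_split /=.
have <- : \sum_S phi S = \sum_S phi (flip k S).
  exact: reindex_inj (inv_inj (flipK k)).
by rewrite -mulr2n -mulr_natr; field; rewrite expf_neq0.
Qed.

Lemma cube_meanZ c phi : cube_mean (fun S => c * phi S) = c * cube_mean phi.
Proof. by rewrite /cube_mean -mulr_sumr mulrCA. Qed.

Lemma cube_meanD phi psi :
  cube_mean (fun S => phi S + psi S) = cube_mean phi + cube_mean psi.
Proof. by rewrite /cube_mean big_split mulrDr. Qed.

Lemma cube_meanB phi psi :
  cube_mean (fun S => phi S - psi S) = cube_mean phi - cube_mean psi.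
Proof. by rewrite /cube_mean sumrB mulrBr. Qed.

Lemma cube_mean_sum I (r : seq I) (P : pred I) (phi : I -> {set T} -> R) :
  cube_mean (fun S => \sum_(i <- r | P i) phi i S)
  = \sum_(i <- r | P i) cube_mean (phi i).
Proof. by rewrite /cube_mean exchange_big mulr_sumr. Qed.

Lemma cube_mean_cst c : cube_mean (fun=> c) = c.
Proof.
rewrite /cube_mean sumr_const card_cube -[c *+ _]mulr_natl natrX mulKf//.
Qed.

Lemma eq_cube_mean phi psi : phi =1 psi -> cube_mean phi = cube_mean psi.
Proof. by move=> e; congr (_ * _); apply: eq_bigr. Qed.

Lemma ler_cube_mean phi psi :
  (forall S, phi S <= psi S) -> cube_mean phi <= cube_mean psi.
Proof.
move=> le; rewrite ler_pM2l ?invr_gt0 ?exprn_gt0//.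
by apply: ler_sum => S _; exact: le.
Qed.

Lemma cube_mean_ge0 phi : (forall S, 0 <= phi S) -> 0 <= cube_mean phi.
Proof. by move=> ge0; rewrite -(cube_mean_cst 0); exact: ler_cube_mean. Qed.

Lemma ler_norm_cube_mean phi :
  `|cube_mean phi| <= cube_mean (fun S => `|phi S|).
Proof.
rewrite /cube_mean normrM ger0_norm ?invr_ge0 ?exprn_ge0//.
by rewrite ler_pM2l ?invr_gt0 ?exprn_gt0// ler_norm_sum.
Qed.

Lemma cube_mean_norm_le_sqrt phi :
  cube_mean (fun S => `|phi S|) <= Num.sqrt (cube_mean (fun S => phi S ^+ 2)).
Proof.
rewrite -[leLHS]ger0_norm ?cube_mean_ge0//; apply: ler_norm_sqrt_sqr.
rewrite /cube_mean exprMn expr2 -mulrA ler_pM2l ?invr_gt0 ?exprn_gt0//.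
rewrite ler_pdivrMl ?exprn_gt0//.
have := sum_sqr_le_card predT (fun S => `|phi S|).
rewrite card_cube natrX.
by under [X in _ <= _ * X]eq_bigr do rewrite real_normK ?num_real//.
Qed.

Lemma cube_mean_walsh A : cube_mean (walsh A) = (A == finset.set0)%:R.
Proof.
have [->|/set0Pn[k kA]] := eqVneq A finset.set0.
  rewrite -[RHS](cube_mean_cst 1); apply: eq_cube_mean => S.
  by rewrite /walsh big_set0.
rewrite (cube_mean_flip k) (@eq_cube_mean _ (fun=> 0)) ?cube_mean_cst ?mulr0//.
by move=> S; rewrite walsh_flip_in// subrr.
Qed.

Lemma symdiff_eq0 A B : (symdiff A B == finset.set0) = (A == B).
Proof.
apply/eqP/eqP => [/setP e|->]; last first.
  by apply/setP => x; rewrite !inE andNb.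
by apply/setP => x; have := e x; rewrite !inE; case: (x \in A); case: (x \in B).
Qed.

Lemma cube_mean_walsh_mul al be :
  cube_mean (fun S => walsh_poly al S * walsh_poly be S) = \sum_A al A * be A.
Proof.
under eq_cube_mean => S.
  rewrite /walsh_poly mulr_suml; under eq_bigr do rewrite mulr_sumr. over.
rewrite cube_mean_sum; apply: eq_bigr => A _.
rewrite cube_mean_sum (bigD1 A) //= big1 => [|B BA].
  under eq_cube_mean do rewrite mulrACA walsh_mul.
  by rewrite cube_meanZ cube_mean_walsh symdiff_eq0 eqxx mulr1 addr0.
under eq_cube_mean do rewrite mulrACA walsh_mul.
by rewrite cube_meanZ cube_mean_walsh symdiff_eq0 eq_sym (negPf BA) mulr0.
Qed.

(* A pair (A, B) is recovered from A symdiff B, A minus B and A meet B. *)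
Lemma sum_pair_symdiff (phi : {set T} -> {set T} -> R) :
  \sum_A \sum_B phi A B
  = \sum_(S : {set T}) \sum_(S1 : {set T} | S1 \subset S) \sum_(U : {set T} | [disjoint U & S])
      phi (S1 :|: U) ((S :\: S1) :|: U).
Proof.
rewrite pair_big /=.
under [RHS]eq_bigr do rewrite pair_big_dep /=.
rewrite pair_big_dep /=.
rewrite [RHS](reindex_onto
  (fun p : {set T} * {set T} => (symdiff p.1 p.2, (p.1 :\: p.2, p.1 :&: p.2)))
  (fun p : {set T} * ({set T} * {set T}) =>
     (p.2.1 :|: p.2.2, (p.1 :\: p.2.1) :|: p.2.2)))/=; last first.
  move=> [S [S1 U]] /=/andP[/fintype.subsetP sub /pred0P dis].
  congr (_, (_, _)); apply/setP => x; have := sub x; have := dis x; rewrite /= !inE;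
    by case: (x \in S1); case: (x \in U); case: (x \in S) => //= _ /(_ isT).
have aux1 A B : (A :\: B) :|: (A :&: B) = A.
  by apply/setP => x; rewrite !inE; case: (x \in A); case: (x \in B).
have aux2 A B : (symdiff A B :\: (A :\: B)) :|: (A :&: B) = B.
  by apply/setP => x; rewrite !inE; case: (x \in A); case: (x \in B).
apply: eq_big => [[A B]|[A B] _] /=; last by rewrite aux1 aux2.
rewrite aux1 aux2 eqxx andbT; apply/esym/andP; split.
  by apply/fintype.subsetP => x; rewrite !inE => ->.
by apply/pred0P => x /=; rewrite !inE; case: (x \in A); case: (x \in B).
Qed.

Lemma symdiff_split S S1 (U : {set T}) : S1 \subset S -> [disjoint U & S] ->
  symdiff (S1 :|: U) ((S :\: S1) :|: U) = S.
Proof.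
move=> /fintype.subsetP sub /pred0P dis; apply/setP => x; have := sub x; have := dis x.
by rewrite /= !inE; case: (x \in S1); case: (x \in U); case: (x \in S) => //= _ /(_ isT).
Qed.

Lemma sum_pair_walsh (phi : {set T} -> {set T} -> R) S0 :
  \sum_A \sum_B phi A B * walsh (symdiff A B) S0
  = walsh_poly (fun S => \sum_(S1 : {set T} | S1 \subset S)
      \sum_(U : {set T} | [disjoint U & S])
      phi (S1 :|: U) ((S :\: S1) :|: U)) S0.
Proof.
rewrite (sum_pair_symdiff (fun A B => phi A B * _)); apply: eq_bigr => S _.
rewrite mulr_suml; apply: eq_bigr => S1 sub; rewrite mulr_suml.
by apply: eq_bigr => U dis; rewrite symdiff_split.
Qed.

Lemma sum_sqr_subset (kap : {set T} -> {set T} -> R) (N : nat) S :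
  (#|S| <= N)%N ->
  (\sum_(S1 : {set T} | S1 \subset S) kap S1 (S :\: S1)) ^+ 2
  <= 2 ^+ N * \sum_(S1 : {set T} | S1 \subset S) kap S1 (S :\: S1) ^+ 2.
Proof.
move=> SN; apply: (le_trans (sum_sqr_le_card _ _)).
apply: ler_wpM2r; first by apply: sumr_ge0 => ? _; exact: sqr_ge0.
have -> : #|(fun S1 => S1 \subset S)| = #|powerset S|.
  by apply: eq_card => S1; rewrite !inE.
by rewrite card_powerset natrX ler_eXn2l// ltr1n.
Qed.

(** The map taking (S, S1) to (S1, S minus S1) is a bijection onto the disjoint pairs whose union
    satisfies [Q], so the two sides are in fact equal. *)
Lemma sum_subset_disjoint_le (b : {set T} -> {set T} -> R) (Q : pred {set T}) :
  (forall S1 S2, 0 <= b S1 S2) ->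
  \sum_(S | Q S) \sum_(S1 : {set T} | S1 \subset S) b S1 (S :\: S1)
  <= \sum_S1 \sum_S2 (if Q (S1 :|: S2) && [disjoint S1 & S2] then b S1 S2 else 0).
Proof.
move=> b0; rewrite pair_big_dep [leRHS]pair_big /=.
rewrite [leRHS](bigID (fun p => Q (p.1 :|: p.2) && [disjoint p.1 & p.2])) /=.
rewrite [X in _ <= _ + X]big1 ?addr0 => [|p /negbTE ->//].
rewrite [leRHS](reindex_onto (fun p => (p.2, p.1 :\: p.2))
   (fun p => (p.1 :|: p.2, p.1)))/=; last first.
  move=> [S1 S2] /andP[_ /pred0P dis] /=; congr (_, _).
  apply/setP => x; have := dis x.
  by rewrite /= !inE; case: (x \in S1); case: (x \in S2).
have tmp S S1 : S1 \subset S -> S1 :|: (S :\: S1) = S /\ [disjoint S1 & S :\: S1].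
  move=> /fintype.subsetP sub; split.
    apply/setP => x; have := sub x.
    by rewrite !inE; case: (x \in S1); case: (x \in S) => // /(_ isT).
  by apply/pred0P => x; rewrite /= !inE; case: (x \in S1).
rewrite le_eqVlt; apply/orP; left; apply/eqP; apply: eq_big => [[S S1]|[S S1]] /=.
  apply/andP/andP => [[QS sub]|[/andP[QS dis] /eqP[<-]]].
    by have [-> ->] := tmp _ _ sub; rewrite QS eqxx.
  by rewrite QS finset.subsetUl.
by move=> /andP[QS sub]; have [-> ->] := tmp _ _ sub; rewrite QS.
Qed.

End cube.

(** * Homogeneous Walsh polynomials: carre du champ, contractions, fourth moments *)

Section chaos.
Context {R : realType} {n : nat}.
Local Notation T := 'I_n.
Implicit Types (A B S U : {set T}) (k : T) (al be : {set T} -> R).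

Definition homogeneous (q : nat) al : Prop := forall A, #|A| != q -> al A = 0.

(** The contraction summed over sets instead of tuples. [S1] and [S2] may meet: the diagonal entries
    S1 = S2 are what controls the fourth moments in [sum_deriv_moment4_le]. *)
Definition set_contraction (r : nat) al be (S1 S2 : {set T}) : R :=
  \sum_(U : {set T} | (#|U| == r) && [disjoint U & S1 :|: S2])
    al (S1 :|: U) * be (S2 :|: U).

Definition set_contraction_norm2 (p q r : nat) al be : R :=
  \sum_(S1 : {set T} | #|S1| == (p - r)%N)
    \sum_(S2 : {set T} | #|S2| == (q - r)%N)
      set_contraction r al be S1 S2 ^+ 2.

(** The factor 1/p inverts the Ornstein-Uhlenbeck generator, up to sign, on the chaos of order [p];
    for p > 0 and [al] homogeneous of order [p] the mean is then that of the product of the two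
    polynomials. Only the order of the first argument enters, so the expression is not symmetric
    when the orders differ. *)
Definition carre_du_champ (p : nat) al be S : R :=
  p%:R^-1 * \sum_k walsh_poly (walsh_deriv k al) S * walsh_poly (walsh_deriv k be) S.

Lemma cards_setD_split S S1 :
  S1 \subset S -> (#|S1| + #|S :\: S1|)%N = #|S|.
Proof. by move=> sub; rewrite -(cardsID S1 S) (finset.setIidPr sub). Qed.

Lemma walsh_deriv_polyE k al S :
  walsh_poly (walsh_deriv k al) S = \sum_(A : {set T} | k \in A) al A * walsh (A :\ k) S.
Proof.
rewrite /walsh_poly (bigID (fun A => k \in A)) /= big1 ?add0r; last first.
  by move=> A kA; rewrite /walsh_deriv kA mul0r.
rewrite [RHS](reindex_onto (fun A => k |: A) (fun A => A :\ k))/=; last first.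
  by move=> A kA; rewrite finset.setD1K.
apply: eq_big => [A|A kA].
  rewrite finset.setU11 /=; apply/idP/eqP => [|<-]; first exact: finset.setU1K.
  by rewrite finset.setD11.
by rewrite /walsh_deriv (negbTE kA) finset.setU1K.
Qed.

Lemma rad_walshD1 k A S : k \in A -> rad k S * walsh (A :\ k) S = walsh A S :> R.
Proof.
move=> kA; rewrite [RHS]/walsh (bigD1 k) //=; congr (_ * _).
by apply: eq_bigl => j; rewrite !inE andbC.
Qed.

Lemma walsh_deriv_flip k al S :
  walsh_poly (walsh_deriv k al) (flip k S) = walsh_poly (walsh_deriv k al) S.
Proof.
apply: eq_bigr => A _; rewrite /walsh_deriv; have [kA|kA] := boolP (k \in A).
  by rewrite !mul0r.
by rewrite walsh_flip_notin.
Qed.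

Lemma walsh_poly_flip k al S :
  walsh_poly al (flip k S)
  = walsh_poly al S - 2 * rad k S * walsh_poly (walsh_deriv k al) S.
Proof.
rewrite walsh_deriv_polyE /walsh_poly.
rewrite [\sum_A al A * walsh A (flip k S)](bigID (fun A => k \in A)) /=.
rewrite [\sum_A al A * walsh A S](bigID (fun A => k \in A)) /=.
rewrite [X in X + _ = _](eq_bigr (fun A => - (al A * walsh A S))); last first.
  by move=> A kA; rewrite walsh_flip_in// mulrN.
rewrite [X in _ + X = _](eq_bigr (fun A => al A * walsh A S)); last first.
  by move=> A kA; rewrite walsh_flip_notin.
rewrite sumrN; have -> : \sum_(A : {set T} | k \in A) al A * walsh A S
    = rad k S * \sum_(A : {set T} | k \in A) al A * walsh (A :\ k) S.
  rewrite mulr_sumr; apply: eq_bigr => A kA.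
  by rewrite mulrCA rad_walshD1.
by ring.
Qed.

(** Euler's identity: multiplying by [rad k S] puts [k] back, so each monomial is recovered once for
    each of its q elements. *)
Lemma sum_rad_walsh_deriv q al S : homogeneous q al ->
  \sum_k rad k S * walsh_poly (walsh_deriv k al) S = q%:R * walsh_poly al S.
Proof.
move=> hal; under eq_bigr do rewrite walsh_deriv_polyE mulr_sumr.
rewrite (exchange_big_dep predT) //= mulr_sumr; apply: eq_bigr => A _.
rewrite (eq_bigr (fun=> al A * walsh A S)); last first.
  by move=> k kA; rewrite mulrCA rad_walshD1.
rewrite sumr_const -[LHS]mulr_natl; have [->//|/hal ->] := eqVneq #|A| q.
by rewrite mul0r !mulr0.
Qed.

Lemma walsh_poly_mul al be S0 :
  walsh_poly al S0 * walsh_poly be S0 =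
  walsh_poly (fun S => \sum_(S1 : {set T} | S1 \subset S)
    \sum_(U : {set T} | [disjoint U & S])
      al (S1 :|: U) * be ((S :\: S1) :|: U)) S0.
Proof.
rewrite -(sum_pair_walsh (fun A B => al A * be B)) /walsh_poly mulr_suml.
apply: eq_bigr => A _; rewrite mulr_sumr; apply: eq_bigr => B _.
by rewrite mulrACA walsh_mul.
Qed.

(** The coefficients of the product formula [walsh_poly_mul] with the additional weight #|U|: in the
    sum over k of products of gradients, the pair (A, B) contributes once for each k in A meet B,
    and this meet is U. *)
Definition gamma_coef al be S : R :=
  \sum_(S1 : {set T} | S1 \subset S) \sum_(U : {set T} | [disjoint U & S])
    #|U|%:R * (al (S1 :|: U) * be ((S :\: S1) :|: U)).

Lemma carre_du_champE p al be S :
  carre_du_champ p al be S = p%:R^-1 * walsh_poly (gamma_coef al be) S.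
Proof.
rewrite /carre_du_champ; congr (_ * _).
under eq_bigr do rewrite !walsh_deriv_polyE mulr_suml.
rewrite (exchange_big_dep predT) //=.
transitivity (\sum_A \sum_B (#|A :&: B|%:R * (al A * be B)) * walsh (symdiff A B) S).
  apply: eq_bigr => A _; under eq_bigr do rewrite mulr_sumr.
  rewrite (exchange_big_dep predT) //=; apply: eq_bigr => B _.
  rewrite -mulrA mulr_natl -sumr_const; apply: eq_big => [k|k /andP[kA kB]].
    by rewrite inE.
  rewrite mulrACA walsh_mul; congr (_ * walsh _ _).
  apply/setP => x; rewrite !inE; case: (eqVneq x k) => [->|//].
  by rewrite kA kB.
rewrite (sum_pair_walsh (fun A B => #|A :&: B|%:R * (al A * be B))).
apply: eq_bigr => S' _; congr (_ * _).
apply: eq_bigr => S1 /fintype.subsetP sub; apply: eq_bigr => U /pred0P dis.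
congr (_%:R * _); congr #|pred_of_set _|.
apply/setP => x; have := sub x; have := dis x.
by rewrite /= !inE; case: (x \in S1); case: (x \in U); case: (x \in S') => //= _ /(_ isT).
Qed.

Lemma gamma_coef0 p al be : homogeneous p al ->
  gamma_coef al be finset.set0 = p%:R * \sum_A al A * be A.
Proof.
move=> hal; rewrite /gamma_coef (big_pred1 finset.set0); last first.
  by move=> S; rewrite finset.subset0.
rewrite mulr_sumr; apply: eq_big => [U|U _].
  by rewrite disjoint_sym finset.disjoints_subset finset.sub0set.
rewrite finset.setD0 !finset.set0U.
by have [->//|/hal ->] := eqVneq #|U| p; rewrite mul0r !mulr0.
Qed.

Lemma cube_mean_walsh_poly_sqr al :
  cube_mean (fun S => walsh_poly al S ^+ 2) = \sum_A al A ^+ 2.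
Proof. exact: cube_mean_walsh_mul. Qed.

(* Given #|S1 :|: U| = p and #|S2 :|: U| = q, the size r of U is determined by
   S1, so that only one value of r contributes. *)
Lemma gamma_inner_le p q al be S1 S2 (S := S1 :|: S2) :
  homogeneous p al -> homogeneous q be ->
  [disjoint S1 & S2] -> S != finset.set0 ->
  (\sum_(U : {set T} | [disjoint U & S])
    #|U|%:R * (al (S1 :|: U) * be (S2 :|: U))) ^+ 2
  <= p%:R ^+ 2 * \sum_(1 <= r < (minn p q).+1 | (p != q) || (r != p))
     (if (#|S1| == (p - r)%N) && (#|S2| == (q - r)%N) then
        set_contraction r al be S1 S2 ^+ 2 else 0).
Proof.
move=> hal hbe dis S0.
have rhs0 : 0 <= p%:R ^+ 2 * \sum_(1 <= r < (minn p q).+1 | (p != q) || (r != p))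
     (if (#|S1| == (p - r)%N) && (#|S2| == (q - r)%N) then
        set_contraction r al be S1 S2 ^+ 2 else 0) :> R.
  apply: mulr_ge0; first exact: sqr_ge0.
  by apply: sumr_ge0 => r _; case: ifP => // _; exact: sqr_ge0.
have card1 U : [disjoint U & S] -> #|S1 :|: U| = (#|S1| + #|U|)%N.
  move=> /(disjointWr (finset.subsetUl S1 S2)); rewrite disjoint_sym => d1.
  by rewrite cardsU disjoint_setI0// cards0 subn0.
have card2 U : [disjoint U & S] -> #|S2 :|: U| = (#|S2| + #|U|)%N.
  move=> /(disjointWr (finset.subsetUr S1 S2)); rewrite disjoint_sym => d2.
  by rewrite cardsU disjoint_setI0// cards0 subn0.
have [[U [dU U0 nz]]|none] := pselect (exists U, [/\ [disjoint U & S], (0 < #|U|)%N &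
    al (S1 :|: U) * be (S2 :|: U) != 0]); last first.
  rewrite big1 ?expr0n// => U dU; have [->|U0] := eqVneq #|U| 0%N.
    by rewrite mul0r.
  have [->|nz] := eqVneq (al (S1 :|: U) * be (S2 :|: U)) 0; first by rewrite mulr0.
  by case: none; exists U; rewrite dU lt0n U0 nz.
have e1 : (#|S1| + #|U|)%N = p.
  apply/eqP/negP => /negP; rewrite -card1// => /hal e.
  by rewrite e mul0r eqxx in nz.
have e2 : (#|S2| + #|U|)%N = q.
  apply/eqP/negP => /negP; rewrite -card2// => /hbe e.
  by rewrite e mulr0 eqxx in nz.
have -> : \sum_(U : {set T} | [disjoint U & S])
    #|U|%:R * (al (S1 :|: U) * be (S2 :|: U))
  = #|U|%:R * set_contraction #|U| al be S1 S2.
  rewrite /set_contraction mulr_sumr.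
  rewrite (bigID (fun V : {set T} => #|V| == #|U|)) /= [X in _ + X]big1 ?addr0.
    by apply: eq_big => [V|V /andP[_ /eqP ->]//]; rewrite andbC.
  move=> V /andP[dV VU]; rewrite hal ?mul0r ?mulr0// card1//.
  by rewrite -e1 eqn_add2l.
have Upq : (#|U| <= minn p q)%N by rewrite leq_min -{1}e1 -e2 !leq_addl.
(* For p = q, the value #|U| = p would force S1 and S2 to be empty, which S != 0 excludes. This is
   why the full contraction is absent from the bound when the orders agree. *)
have cond : (p != q) || (#|U| != p).
  apply/orP; have [pq|] := eqVneq p q; last by left.
  right; apply/negP => /eqP Up; move/eqP: S0; apply.
  apply/eqP; rewrite /S finset.setU_eq0 -!cards_eq0.
  by rewrite -(eqn_add2r #|U|) e1 Up add0n eqxx -(eqn_add2r #|U|) e2 Up pq add0n /=.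
rewrite exprMn big_mkcond (bigD1_seq #|U|) ?iota_uniq ?mem_index_iota ?U0 ?ltnS//=.
rewrite cond -{2}e1 -e2 !addnK !eqxx /= mulrDr.
rewrite -[leLHS]addr0; apply: lerD.
  by apply: ler_wpM2r; rewrite ?sqr_ge0// ler_pXn2r ?nnegrE// ler_nat -e1 leq_addl.
apply: mulr_ge0; first exact: sqr_ge0.
by apply: sumr_ge0 => r _; case: ifP => // _; case: ifP => // _; exact: sqr_ge0.
Qed.

(** The coefficient of the empty set is the mean, so by Parseval the variance is the sum of the
    other squared coefficients. A nonzero coefficient has #|S| <= p + q, hence at most 2^(p+q)
    splittings of S, and the factor p^2 of [gamma_inner_le] cancels the normalisation 1/p. *)
Lemma gamma_variance_le p q al be : homogeneous p al -> homogeneous q be ->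
  (0 < p)%N ->
  cube_mean (fun S => (carre_du_champ p al be S
     - cube_mean (fun S => walsh_poly al S * walsh_poly be S)) ^+ 2)
  <= 2 ^+ (p + q) * \sum_(1 <= r < (minn p q).+1 | (p != q) || (r != p))
       set_contraction_norm2 p q r al be.
Proof.
move=> hal hbe p0; have pn0 : p%:R != 0 :> R by rewrite pnatr_eq0 -lt0n.
rewrite cube_mean_walsh_mul.
pose ga S := if S == finset.set0 then 0 else gamma_coef al be S.
have gaE S0 : carre_du_champ p al be S0 - \sum_A al A * be A
    = p%:R^-1 * walsh_poly ga S0.
  rewrite carre_du_champE /walsh_poly (bigD1 finset.set0) //=.
  rewrite (gamma_coef0 _ hal) [in RHS](bigD1 finset.set0) //= /ga eqxx mul0r add0r.
  rewrite [walsh finset.set0 _]/walsh big_set0 mulr1 mulrDr mulKf// addrC addKr.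
  by congr (_ * _); apply: eq_bigr => S /negPf ->.
under eq_cube_mean do rewrite gaE exprMn.
rewrite cube_meanZ cube_mean_walsh_poly_sqr exprVn ler_pdivrMl ?exprn_gt0 ?ltr0n//.
rewrite (bigD1 finset.set0) //= {1}/ga eqxx expr0n/= add0r.
pose kap S1 S2 := \sum_(U : {set T} | [disjoint U & S1 :|: S2])
    #|U|%:R * (al (S1 :|: U) * be (S2 :|: U)).
have gkap S : gamma_coef al be S = \sum_(S1 : {set T} | S1 \subset S) kap S1 (S :\: S1).
  apply: eq_bigr => S1 sub; apply: eq_bigl => U.
  suff -> : S1 :|: S :\: S1 = S by []; apply/setP => x; move/fintype.subsetP : sub => /(_ x).
  by rewrite !inE; case: (x \in S1); case: (x \in S) => // /(_ isT).
have gle S : ga S ^+ 2 <= 2 ^+ (p + q) *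
     \sum_(S1 : {set T} | S1 \subset S) kap S1 (S :\: S1) ^+ 2.
  have sge0 : 0 <= \sum_(S1 : {set T} | S1 \subset S) kap S1 (S :\: S1) ^+ 2 :> R.
    by apply: sumr_ge0 => ? _; exact: sqr_ge0.
  rewrite /ga; case: ifP => _; first by rewrite expr0n/= mulr_ge0// exprn_ge0.
  have [Spq|Spq] := leqP #|S| (p + q); first by rewrite gkap; exact: sum_sqr_subset.
  rewrite gkap big1 ?expr0n/= ?mulr_ge0 ?exprn_ge0// => S1 sub.
  apply: big1 => U dU.
  have [c1|/hal ->] := eqVneq #|S1 :|: U| p; last by rewrite mul0r mulr0.
  have [c2|/hbe ->] := eqVneq #|(S :\: S1) :|: U| q; last by rewrite !mulr0.
  exfalso; move: Spq; apply/negP; rewrite -leqNgt -c1 -c2.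
  apply: (@leq_trans (#|S1| + #|S :\: S1|)).
    by rewrite cards_setD_split.
  by apply: leq_add; apply: subset_leq_card; exact: finset.subsetUl.
apply: (le_trans (ler_sum _ (fun S _ => gle S))); rewrite -mulr_sumr.
rewrite mulrCA; apply: ler_wpM2l; first exact: exprn_ge0.
apply: (le_trans (sum_subset_disjoint_le (fun S => S != finset.set0)
  (fun S1 S2 => sqr_ge0 (kap S1 S2)))).
rewrite /set_contraction_norm2 mulr_sumr.
have -> : \sum_(1 <= r < (minn p q).+1 | (p != q) || (r != p))
    p%:R ^+ 2 * (\sum_(S1 : {set T} | #|S1| == (p - r)%N)
    \sum_(S2 : {set T} | #|S2| == (q - r)%N) set_contraction r al be S1 S2 ^+ 2)
  = \sum_(S1 : {set T}) \sum_(S2 : {set T}) p%:R ^+ 2 *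
    \sum_(1 <= r < (minn p q).+1 | (p != q) || (r != p))
     (if (#|S1| == (p - r)%N) && (#|S2| == (q - r)%N) then
        set_contraction r al be S1 S2 ^+ 2 else 0).
  under [RHS]eq_bigr do rewrite -mulr_sumr exchange_big /=.
  rewrite -[RHS]mulr_sumr [in RHS]exchange_big /= mulr_sumr; apply: eq_bigr => r _.
  congr (_ * _); rewrite big_mkcond; apply: eq_bigr => S1 _.
  case: ifP => _; last by rewrite big1.
  by rewrite big_mkcond; apply: eq_bigr.
apply: ler_sum => S1 _; apply: ler_sum => S2 _.
case: ifP => [/andP[S0 dis]|_]; first exact: gamma_inner_le.
apply: mulr_ge0; first exact: sqr_ge0.
by apply: sumr_ge0 => r _; case: ifP => // _; exact: sqr_ge0.
Qed.

(** A set [A] is reached once from each of its subsets S1, with U = A minus S1, hence at most 2^q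
    times when [b A] is nonzero. *)
Lemma sum_disjoint_union (b : {set T} -> R) q :
  (forall A, 0 <= b A) -> (forall A, (q < #|A|)%N -> b A = 0) ->
  \sum_(S1 : {set T}) \sum_(U : {set T} | [disjoint U & S1]) b (S1 :|: U)
  <= 2 ^+ q * \sum_A b A.
Proof.
move=> b0 bq; rewrite pair_big_dep /=.
rewrite (reindex_onto (fun p : {set T} * {set T} => (p.2, p.1 :\: p.2))
   (fun p => (p.1 :|: p.2, p.1)))/=; last first.
  move=> [S1 U] /= /pred0P dis; congr (_, _).
  apply/setP => x; have := dis x.
  by rewrite /= !inE; case: (x \in S1); case: (x \in U).
have eqP1 A S : [disjoint A :\: S & S] && ((S :|: A :\: S, S) == (A, S)) = (S \subset A).
  apply/andP/idP => [[_ /eqP /(congr1 fst) /= <-]|/fintype.subsetP sub].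
    exact: finset.subsetUl.
  split; first by apply/pred0P => x; rewrite /= !inE; case: (x \in S); rewrite ?andbF.
  apply/eqP; congr (_, _); apply/setP => x; have := sub x.
  by rewrite !inE; case: (x \in S); case: (x \in A) => // /(_ isT).
rewrite (eq_bigl (fun p : {set T} * {set T} => p.2 \subset p.1)) => [|[A S]]; last exact: eqP1.
rewrite -(pair_big_dep predT (fun A S : {set T} => S \subset A)
  (fun A S : {set T} => b (S :|: (A :\: S))))/=.
rewrite mulr_sumr; apply: ler_sum => A _.
rewrite (eq_bigr (fun=> b A)) => [|S /fintype.subsetP sub]; last first.
  congr b; apply/setP => x; have := sub x.
  by rewrite !inE; case: (x \in S); case: (x \in A) => // /(_ isT).
rewrite sumr_const (_ : #|_| = #|powerset A|); last by apply: eq_card => S; rewrite !inE.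
rewrite card_powerset -[leLHS]mulr_natl natrX.
have [Aq|/bq ->] := leqP #|A| q; last by rewrite !mulr0.
by apply: ler_wpM2r => //; rewrite ler_eXn2l// ltr1n.
Qed.

(** Hypercontractivity from L^2 to L^4 by counting: the square is expanded in Walsh functions and
    Parseval is applied. Sets of size at most 2q have at most 4^q splittings, and each of the two
    sums of [b] costs 2^q, which gives 16^q. *)
Lemma walsh_poly_moment4 q al : (forall A, (q < #|A|)%N -> al A = 0) ->
  cube_mean (fun S => walsh_poly al S ^+ 4)
  <= 16 ^+ q * (\sum_A al A ^+ 2) ^+ 2.
Proof.
move=> hal.
under eq_cube_mean do rewrite (_ : 4 = 2 * 2)%N// exprM [walsh_poly al _ ^+ 2]walsh_poly_mul.
rewrite cube_mean_walsh_poly_sqr.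
(* [b S1] is the sum of [al A ^+ 2] over the A that contain S1. Cauchy-Schwarz in the common part U
   bounds each product coefficient by values of [b]. *)
pose b S1 := \sum_(U : {set T} | [disjoint U & S1]) al (S1 :|: U) ^+ 2.
have b0 S1 : 0 <= b S1 by apply: sumr_ge0 => ? _; exact: sqr_ge0.
have sub_disj S1 S U : S1 \subset S -> [disjoint U & S] -> [disjoint U & S1].
  by move=> sub; apply: disjointWr.
have kle S S1 : S1 \subset S ->
   (\sum_(U : {set T} | [disjoint U & S]) al (S1 :|: U) * al (S :\: S1 :|: U)) ^+ 2
   <= b S1 * b (S :\: S1).
  move=> sub; apply: (le_trans (sum_cauchy_schwarz _ _ _ _)).
  have sge0 (u : {set T} -> R) : 0 <= \sum_(U : {set T} | [disjoint U & S]) u U ^+ 2.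
    by apply: sumr_ge0 => U _; exact: sqr_ge0.
  by apply: ler_pM => //; apply: ler_sum_subpred => // U; [exact: sub_disj|
    exact: sqr_ge0|apply: sub_disj; exact: finset.subsetDl|exact: sqr_ge0].
have bgle : \sum_S1 b S1 <= 2 ^+ q * \sum_A al A ^+ 2.
  apply: sum_disjoint_union => [A|A /hal ->]; first exact: sqr_ge0.
  by rewrite expr0n.
have sle S : (\sum_(S1 : {set T} | S1 \subset S)
    \sum_(U : {set T} | [disjoint U & S]) al (S1 :|: U) * al (S :\: S1 :|: U)) ^+ 2
   <= 4 ^+ q * \sum_(S1 : {set T} | S1 \subset S) b S1 * b (S :\: S1).
  have rge0 : 0 <= \sum_(S1 : {set T} | S1 \subset S) b S1 * b (S :\: S1).
    by apply: sumr_ge0 => S1 _; exact: mulr_ge0.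
  have [Sq|Sq] := leqP #|S| (2 * q).
    have := @sum_sqr_subset R n (fun S1 S2 => \sum_(U : {set T} | [disjoint U & S])
      al (S1 :|: U) * al (S2 :|: U)) _ _ Sq.
    move=> /le_trans; apply; rewrite exprM -natrX; apply: ler_wpM2l.
      exact: exprn_ge0.
    by apply: ler_sum => S1; exact: kle.
  rewrite big1 ?expr0n/= ?mulr_ge0 ?exprn_ge0// => S1 sub.
  apply: big1 => U dU.
  have [c1|/hal ->] := leqP #|S1 :|: U| q; last by rewrite mul0r.
  have [c2|/hal ->] := leqP #|(S :\: S1) :|: U| q; last by rewrite mulr0.
  exfalso; move: Sq; apply/negP; rewrite -leqNgt mul2n -addnn.
  apply: leq_trans (leq_add c1 c2).
  rewrite -(cards_setD_split sub).
  by apply: leq_add; apply: subset_leq_card; exact: finset.subsetUl.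
apply: (le_trans (ler_sum _ (fun S _ => sle S))); rewrite -mulr_sumr.
rewrite (_ : 16 = 4 * 4); last by rewrite -natrM.
rewrite exprMn -mulrA; apply: ler_wpM2l; first exact: exprn_ge0.
have -> : 4 ^+ q * (\sum_A al A ^+ 2) ^+ 2 = (2 ^+ q * \sum_A al A ^+ 2) ^+ 2 :> R.
  rewrite exprMn -exprM mulnC exprM; congr (_ ^+ _ * _); first by rewrite -natrX.
apply: (@le_trans _ _ ((\sum_S1 b S1) ^+ 2)); last first.
  have b_ge0 : 0 <= \sum_S1 b S1 by exact: sumr_ge0.
  by rewrite ler_pXn2r ?nnegrE// (le_trans b_ge0).
have bb0 S1 S2 : 0 <= b S1 * b S2 by exact: mulr_ge0.
apply: (le_trans (sum_subset_disjoint_le predT bb0)).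
rewrite expr2 mulr_suml; apply: ler_sum => S1 _; rewrite mulr_sumr.
by apply: ler_sum => S2 _; case: ifP.
Qed.

Lemma sum_cards1 (u : {set T} -> R) :
  \sum_(S : {set T} | #|S| == 1%N) u S = \sum_k u [set k]%SET.
Proof.
rewrite -(big_imset _ (in2W (@finset.set1_inj T))) /=; apply: eq_bigl => S.
apply/cards1P/imsetP => [[x ->]|[x _ ->]]; last by exists x.
by exists x; rewrite ?inE.
Qed.

(** The sum of the squared coefficients of the gradient in direction k is the entry ({k}, {k}) of
    the contraction of order q - 1. The diagonal of that contraction therefore bounds the fourth
    moments. *)
Lemma sum_deriv_moment4_le q al : (0 < q)%N -> homogeneous q al ->
  \sum_k cube_mean (fun S => walsh_poly (walsh_deriv k al) S ^+ 4)
  <= 16 ^+ q * set_contraction_norm2 q q q.-1 al al.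
Proof.
move=> q0 hal.
have der0 k A : (q < #|A|)%N -> walsh_deriv k al A = 0.
  move=> qA; rewrite /walsh_deriv; case: ifP => // /negbT kA.
  by apply: hal; rewrite cardsU1 kA add1n neq_ltn (ltn_trans qA) ?orbT.
apply: (@le_trans _ _ (\sum_k 16 ^+ q * (\sum_A walsh_deriv k al A ^+ 2) ^+ 2)).
  by apply: ler_sum => k _; apply: walsh_poly_moment4; exact: der0.
rewrite -mulr_sumr; apply: ler_wpM2l; first exact: exprn_ge0.
have qq : (q - q.-1 = 1)%N by case: (q) q0 => // m _; rewrite subSnn.
rewrite /set_contraction_norm2 qq.
apply: (@le_trans _ _ (\sum_(S1 : {set T} | #|S1| == 1%N)
   set_contraction q.-1 al al S1 S1 ^+ 2)); last first.
  apply: ler_sum => S1 c1; rewrite (bigD1 S1) //= lerDl.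
  by apply: sumr_ge0 => ? _; exact: sqr_ge0.
rewrite le_eqVlt; apply/orP; left; apply/eqP.
rewrite sum_cards1; apply: eq_bigr => k _; congr (_ ^+ 2).
rewrite /set_contraction [RHS]big_mkcond; apply: eq_bigr => A _.
rewrite finset.setUid disjoint_sym disjoints1 /walsh_deriv.
case: ifP => /= [_|/negbT kA]; first by rewrite andbF expr0n.
rewrite andbT; case: eqP => // Aq; rewrite hal ?expr0n// cardsU1 kA add1n.
by apply/eqP => e; apply: Aq; rewrite -e.
Qed.

End chaos.

(** * The smart path *)

Section mean_value.
Context {R : realType}.
Implicit Types (f df : R -> R).

Lemma mvt_norm_le f df (K a b : R) : a <= b ->
  (forall x, is_derive x (1 : R) f (df x)) ->
  (forall x, a <= x <= b -> `|df x| <= K) -> `|f b - f a| <= K * (b - a).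
Proof.
rewrite le_eqVlt => /predU1P[->|ab] fdf dfK; first by rewrite !subrr normr0 mulr0.
have [|c cab ->] := MVT ab (fun x _ => fdf x).
  by apply: derivable_within_continuous => x _; exact: ex_derive.
rewrite normrM [`|b - a|]ger0_norm; last by rewrite subr_ge0 ltW.
apply: ler_wpM2r.
  by rewrite subr_ge0 ltW.
by apply: dfK; move: cab; rewrite in_itv/= => /andP[/ltW -> /ltW ->].
Qed.

Lemma is_derive_opp_arg f df (x : R) : (forall x, is_derive x (1 : R) f (df x)) ->
  is_derive x (1 : R) (fun t => f (- t)) (- df (- x)).
Proof.
move=> fdf; have := fdf (- x) => fx.
by apply: is_derive_eq; rewrite /= mulrN1.
Qed.

(** The trapezoidal rule, and not the midpoint rule, because its nodes are the two end points: these
    will be values at points of the cube, while the midpoint is not one. *)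
Lemma trapezoid_error (psi psi1 psi2 psi3 : R -> R) (K : R) :
  (forall t, is_derive t (1 : R) psi (psi1 t)) ->
  (forall t, is_derive t (1 : R) psi1 (psi2 t)) ->
  (forall t, is_derive t (1 : R) psi2 (psi3 t)) ->
  (forall t, `|psi3 t| <= K) ->
  `|psi 1 - psi (- 1) - (psi1 1 + psi1 (- 1))| <= 2 * K.
Proof.
move=> d1 d2 d3 psi3K.
(* The error on the interval from -t to t. It vanishes at 0, and the terms in psi1 cancel in its
   derivative, which leaves an increment of psi2. *)
pose e t := psi t - psi (- t) - t * (psi1 t + psi1 (- t)).
pose e1 t := - (t * (psi2 t - psi2 (- t))).
have de t : is_derive t (1 : R) e (e1 t).
  have h1 := d1 t; have h2 := d2 t.
  have h3 := is_derive_opp_arg t d1; have h4 := is_derive_opp_arg t d2.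
  apply: is_derive_eq.
  by rewrite /e1 /GRing.scale /=; ring.
have -> : psi 1 - psi (- 1) - (psi1 1 + psi1 (- 1)) = e 1 - e 0.
  by rewrite /e oppr0 subrr mul0r mul1r !subr0.
rewrite -[leRHS](_ : 2 * K * (1 - 0) = _); last by rewrite subr0 mulr1.
apply: (mvt_norm_le ler01 de) => t /andP[t0 t1].
have K0 : 0 <= K by apply: le_trans (psi3K 0).
have : `|psi2 t - psi2 (- t)| <= K * (t - - t).
  by apply: (mvt_norm_le _ d3) => //; lra.
rewrite /e1 normrN normrM ger0_norm// opprK => h.
apply: (@le_trans _ _ (1 * (K * (t + t)))); first exact: ler_pM.
by rewrite mul1r mulrC ler_wpM2r//; lra.
Qed.

End mean_value.

Section trig_poly.
Context {R : realType} {d : nat}.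
Implicit Types (x y a : 'rV[R]_d) (s : seq 'I_d).

Definition dotv a x : R := \sum_i a 0 i * x 0 i.

Lemma dotvDr a x y : dotv a (x + y) = dotv a x + dotv a y.
Proof.
by rewrite /dotv -big_split; apply: eq_bigr => i _; rewrite mxE mulrDr.
Qed.

Lemma dotvDl a b x : dotv (a + b) x = dotv a x + dotv b x.
Proof.
by rewrite /dotv -big_split; apply: eq_bigr => i _; rewrite mxE mulrDl.
Qed.

Lemma dotvZr a (t : R) x : dotv a (t *: x) = t * dotv a x.
Proof. by rewrite /dotv mulr_sumr; apply: eq_bigr => i _; rewrite mxE mulrCA. Qed.

Lemma dotvZl a (t : R) x : dotv (t *: a) x = t * dotv a x.
Proof. by rewrite /dotv mulr_sumr; apply: eq_bigr => i _; rewrite mxE mulrA. Qed.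

Lemma dotv_delta i x : dotv (delta_mx 0 i) x = x 0 i.
Proof.
rewrite /dotv (bigD1 i) //= !mxE !eqxx mul1r big1 ?addr0// => j ji.
by rewrite !mxE (negPf ji) andbF mul0r.
Qed.

(* The triple (c, a, b) stands for x |-> c cos(a . x + b); in these terms the
   partial derivative along i multiplies by a_i and adds pi / 2 to the phase. *)
Definition tp_eval (l : seq (R * 'rV[R]_d * R)) s x : R :=
  \sum_(e <- l) e.1.1 * \prod_(i <- s) e.1.2 0 i
    * cos (dotv e.1.2 x + e.2 + (size s)%:R * (pi / 2)).

Lemma cosDpihalf (t : R) : cos (t + pi / 2) = - sin t.
Proof. by rewrite cosD cos_pihalf sin_pihalf mulr0 mulr1 sub0r. Qed.

Lemma is_derive_tp_eval l s x y t :
  is_derive t (1 : R) (fun t => tp_eval l s (x + t *: y))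
    (\sum_j y 0 j * tp_eval l (j :: s) (x + t *: y)).
Proof.
elim: l => [|e l IH].
  rewrite (_ : (fun t => _) = cst 0); last by apply/funext => u; rewrite /tp_eval big_nil.
  apply: is_derive_eq; rewrite big1// => j _.
  by rewrite /tp_eval big_nil mulr0.
rewrite (_ : (fun t => _) = (fun t => e.1.1 * \prod_(i <- s) e.1.2 0 i
    * cos (dotv e.1.2 x + t * dotv e.1.2 y + e.2 + (size s)%:R * (pi / 2)))
    \+ (fun t => tp_eval l s (x + t *: y))); last first.
  by apply/funext => u; rewrite /tp_eval big_cons dotvDr dotvZr.
apply: is_derive_eq.
under [RHS]eq_bigr do rewrite /tp_eval big_cons mulrDr.
rewrite big_split /=; congr (_ + _).
set A := dotv _ x + _ + _ + _; set B := dotv _ y.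
rewrite [LHS](_ : _ = e.1.1 * \prod_(i <- s) e.1.2 0 i * (- sin A * B)); last first.
  by rewrite scaler0 /GRing.scale /= mulr1 !addr0 !add0r mul1r.
rewrite mulrA (_ : B = \sum_j e.1.2 0 j * y 0 j)// -mulrA !mulr_sumr.
apply: eq_bigr => j _; rewrite big_cons.
rewrite [X in cos X](_ : _ = A + pi / 2); last first.
  by rewrite /A dotvDr dotvZr [size _]/= -[(size s).+1%:R]natr1; ring.
by rewrite cosDpihalf; ring.
Qed.

End trig_poly.

Section interpolation.
Context {R : realType} {d n : nat}.
Variables (q : 'I_d -> nat) (al : 'I_d -> {set 'I_n} -> R).
Hypothesis q0 : forall i, (0 < q i)%N.
Hypothesis hal : forall i, homogeneous (q i) (al i).
Implicit Types (S : {set 'I_n}) (k : 'I_n).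

Definition chaos_vec S : 'rV[R]_d := \row_i walsh_poly (al i) S.
Definition deriv_vec k S : 'rV[R]_d := \row_i walsh_poly (walsh_deriv k (al i)) S.
Definition norm1 (x : 'rV[R]_d) : R := \sum_i `|x 0 i|.

Lemma norm1_ge0 x : 0 <= norm1 x.
Proof. by apply: sumr_ge0. Qed.

Lemma chaos_vec_flip k S :
  chaos_vec (flip k S) = chaos_vec S - (2 * rad k S) *: deriv_vec k S.
Proof. by apply/rowP => i; rewrite !mxE walsh_poly_flip. Qed.

Lemma deriv_vec_flip k S : deriv_vec k (flip k S) = deriv_vec k S.
Proof. by apply/rowP => i; rewrite !mxE walsh_deriv_flip. Qed.

Lemma sum_norm1_le (x : 'rV[R]_d) (t K : R) (u : 'I_d -> R) : 0 <= K ->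
  (forall j, `|u j| <= K) -> `|\sum_j (t *: x) 0 j * u j| <= `|t| * norm1 x * K.
Proof.
move=> K0 uK; apply: (le_trans (ler_norm_sum _ _ _)).
rewrite /norm1 mulr_sumr mulr_suml; apply: ler_sum => j _.
by rewrite mxE !normrM; apply: ler_wpM2l => //; rewrite mulr_ge0.
Qed.

Section one_step.
Variables (l : seq (R * 'rV[R]_d * R)) (K tau : R).
Hypothesis tau01 : 0 <= tau <= 1.
Hypothesis lK : forall (s : seq 'I_d) x, size s = 4 -> `|tp_eval l s x| <= K.

(** The two points lie on one line with direction [y], at the parameters [rad k S] and [- rad k S].
    Applied to a first partial derivative along this line, [trapezoid_error] needs three more
    derivatives, hence the fourth derivatives of the polynomial. *)
Lemma rad_increment_error i k S :
  `|rad k S * (tp_eval l [:: i] (tau *: chaos_vec S)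
               - tp_eval l [:: i] (tau *: chaos_vec (flip k S)))
    - (\sum_j (tau *: deriv_vec k S) 0 j * (tp_eval l [:: j; i] (tau *: chaos_vec S)
        + tp_eval l [:: j; i] (tau *: chaos_vec (flip k S))))|
  <= 2 * ((`|tau| * norm1 (deriv_vec k S)) ^+ 3 * K).
Proof.
have K0 : 0 <= K by apply: le_trans (@lK [:: i; i; i; i] 0 _).
pose y := tau *: deriv_vec k S.
(* The part of tau F that does not depend on coordinate k. *)
pose x := tau *: (chaos_vec S - rad k S *: deriv_vec k S).
pose psi t := tp_eval l [:: i] (x + t *: y).
pose psi1 t := \sum_j y 0 j * tp_eval l [:: j; i] (x + t *: y).
pose psi2 t := \sum_j y 0 j * (\sum_j' y 0 j' * tp_eval l [:: j'; j; i] (x + t *: y)).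
pose psi3 t := \sum_j y 0 j * (\sum_j' y 0 j' *
  (\sum_j'' y 0 j'' * tp_eval l [:: j''; j'; j; i] (x + t *: y))).
have ext (D : R -> 'I_d -> R) (D' : R -> 'I_d -> R) :
   (forall j t, is_derive t (1 : R) (D^~ j) (D' t j)) ->
   forall t, is_derive t (1 : R) (fun t => \sum_j y 0 j * D t j)
     (\sum_j y 0 j * D' t j).
  move=> h t.
  rewrite (_ : (fun t => _) = \sum_j (y 0 j \*: D^~ j)); last first.
    apply/funext => u; rewrite fct_sumE; by apply: eq_bigr.
  by apply: is_derive_sum => j; exact: is_deriveZ.
have d1 t : is_derive t (1 : R) psi (psi1 t) by exact: is_derive_tp_eval.
have d2 t : is_derive t (1 : R) psi1 (psi2 t).
  apply: (ext (fun t j => tp_eval l [:: j; i] (x + t *: y))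
    (fun t j => \sum_j' y 0 j' * tp_eval l [:: j'; j; i] (x + t *: y))) => j u.
  exact: is_derive_tp_eval.
have d3 t : is_derive t (1 : R) psi2 (psi3 t).
  apply: (ext (fun t j => \sum_j' y 0 j' * tp_eval l [:: j'; j; i] (x + t *: y))
    (fun t j => \sum_j' y 0 j' * (\sum_j'' y 0 j'' *
       tp_eval l [:: j''; j'; j; i] (x + t *: y)))) => j u.
  apply: (ext (fun t j' => tp_eval l [:: j'; j; i] (x + t *: y))
    (fun t j' => \sum_j'' y 0 j'' * tp_eval l [:: j''; j'; j; i] (x + t *: y))).
  by move=> j' v; exact: is_derive_tp_eval.
have psi3K t : `|psi3 t| <= (`|tau| * norm1 (deriv_vec k S)) ^+ 3 * K.
  set N := `|tau| * _; have N0 : 0 <= N by rewrite mulr_ge0// norm1_ge0.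
  rewrite (_ : N ^+ 3 * K = N * (N * (N * K))); last ring.
  have step K' u : 0 <= K' -> (forall j, `|u j| <= K') ->
      `|\sum_j y 0 j * u j| <= N * K'.
    by move=> *; exact: sum_norm1_le.
  rewrite /psi3; apply: (step _ _) => [|j]; first by rewrite !mulr_ge0 ?norm1_ge0.
  apply: (step _ _) => [|j']; first by rewrite !mulr_ge0 ?norm1_ge0.
  by apply: (step _ _) => [//|j'']; exact: lK.
have rad2 := rad_sqr k S : rad k S * rad k S = 1 :> R.
have xS : tau *: chaos_vec S = x + rad k S *: y.
  by rewrite /x /y scalerBr !scalerA [tau * rad k S]mulrC subrK.
have xF : tau *: chaos_vec (flip k S) = x + (- rad k S) *: y.
  rewrite chaos_vec_flip /x /y scaleNr !scalerBr !scalerA -addrA -opprD.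
  by rewrite -scalerDl; congr (_ - _ *: _); ring.
have := trapezoid_error d1 d2 d3 psi3K.
rewrite (_ : _ - _ - _ = rad k S * (psi (rad k S) - psi (- rad k S))
   - (psi1 (rad k S) + psi1 (- rad k S))); last first.
  rewrite /rad; case: (k \in S); rewrite ?expr1 ?expr0 ?opprK; ring.
rewrite /psi -xS -xF /psi1 -big_split /= -xS -xF.
by under eq_bigr do rewrite -mulrDr.
Qed.

(** By Euler's identity F_i is 1/q_i times the sum over k of [rad k] times the gradient in direction
    k. Averaging over a flip of coordinate k turns [rad k] into a difference of the test function,
    and [rad_increment_error] measures the failure of the chain rule. The factors 1/q_i and |tau|^3
    are at most 1 and are dropped. *)
Lemma stein_identity_error i :
  `|cube_mean (fun S => chaos_vec S 0 i * tp_eval l [:: i] (tau *: chaos_vec S))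
    - tau * \sum_j cube_mean (fun S => carre_du_champ (q i) (al i) (al j) S
                * tp_eval l [:: j; i] (tau *: chaos_vec S))|
  <= \sum_k cube_mean (fun S => `|deriv_vec k S 0 i| * norm1 (deriv_vec k S) ^+ 3) * K.
Proof.
have K0 : 0 <= K by apply: le_trans (@lK [:: i; i; i; i] 0 _).
have qi0 : (q i)%:R != 0 :> R by rewrite pnatr_eq0 -lt0n.
pose phi S := tp_eval l [:: i] (tau *: chaos_vec S).
pose dphi j S := tp_eval l [:: j; i] (tau *: chaos_vec S).
pose G k S := deriv_vec k S 0 i *
  (rad k S * phi S - \sum_j (tau *: deriv_vec k S) 0 j * dphi j S).
rewrite (_ : _ - _ = (q i)%:R^-1 * \sum_k cube_mean (G k)); last first.
  rewrite -cube_mean_sum -!cube_mean_sum -!cube_meanZ -cube_meanB.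
  apply: eq_cube_mean => S; rewrite /G.
  under [in RHS]eq_bigr do rewrite mulrBr mulrCA mulrA.
  rewrite sumrB -mulr_suml; under [X in _ = _ * (X * _ - _)]eq_bigr do rewrite mxE.
  rewrite (sum_rad_walsh_deriv _ (@hal i)) mulrBr mulrA -/(phi S) mulKf// mxE.
  congr (_ - _); rewrite /carre_du_champ.
  under [in LHS]eq_bigr do rewrite -mulrA mulr_suml.
  rewrite -[in LHS]mulr_sumr mulrCA; congr (_ * _).
  rewrite exchange_big mulr_sumr /=; apply: eq_bigr => k _.
  rewrite !mulr_sumr; apply: eq_bigr => j _.
  by rewrite !mxE /dphi; ring.
have Gle k : `|cube_mean (G k)|
    <= cube_mean (fun S => `|deriv_vec k S 0 i| * norm1 (deriv_vec k S) ^+ 3) * K.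
  (* A flip changes the sign of [rad k] and fixes the gradient in direction k, so the average over
     the pair contains an increment of [phi]. The factor 1/2 of the average absorbs the 2 of the
     trapezoidal bound. *)
  rewrite (cube_mean_flip k) normrM ger0_norm ?invr_ge0//.
  rewrite -(mulKf (lt0r_neq0 (ltr0Sn R 1)) (cube_mean _ * K)).
  apply: ler_wpM2l; first by rewrite invr_ge0.
  apply: (le_trans (ler_norm_cube_mean _)).
  rewrite [leRHS](_ : _ = cube_mean (fun S => 2 * K *
    (`|deriv_vec k S 0 i| * norm1 (deriv_vec k S) ^+ 3))); last first.
    by rewrite cube_meanZ; ring.
  apply: ler_cube_mean => S.
  rewrite /G deriv_vec_flip -mulrDr normrM rad_flip eqxx expr1.
  have := rad_increment_error i k S; rewrite -/(phi S) -/(phi (flip k S)).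
  under eq_bigr do rewrite mulrDr -/(dphi _ S) -/(dphi _ (flip k S)).
  rewrite big_split /= => h.
  rewrite [X in _ * `|X| <= _](_ : _ = rad k S * (phi S - phi (flip k S)) -
    (\sum_j (tau *: deriv_vec k S) 0 j * dphi j S +
     \sum_j (tau *: deriv_vec k S) 0 j * dphi j (flip k S))); last ring.
  apply: (le_trans (ler_wpM2l (normr_ge0 _) h)).
  rewrite exprMn; set D := `|deriv_vec _ _ _ _|; set N := norm1 _.
  have t3 : `|tau| ^+ 3 <= 1 by case/andP: tau01 => *; rewrite exprn_ile1// ger0_norm.
  have N3 : 0 <= D * N ^+ 3 by rewrite mulr_ge0 ?exprn_ge0 ?norm1_ge0 ?normr_ge0.
  rewrite [leLHS](_ : _ = 2 * K * (D * N ^+ 3) * `|tau| ^+ 3); last ring.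
  apply: le_trans (ler_wpM2l _ t3) _; first by apply: mulr_ge0 => //; rewrite mulr_ge0.
  by rewrite mulr1 le_eqVlt; apply/orP; left; apply/eqP; ring.
rewrite normrM ger0_norm ?invr_ge0// -[leRHS]mul1r; apply: ler_pM => //.
  by rewrite invf_le1 ?ltr0n// ler1n.
by apply: (le_trans (ler_norm_sum _ _ _)); exact: ler_sum.
Qed.

End one_step.
End interpolation.

(** * Interpolation between the Walsh polynomials and the Gaussian vector *)

Section smart_path.
Context {R : realType} {d n : nat}.
Variables (q : 'I_d -> nat) (al : 'I_d -> {set 'I_n} -> R).
Hypothesis q0 : forall i, (0 < q i)%N.
Hypothesis hal : forall i, homogeneous (q i) (al i).
Variable Sigma : 'M[R]_d.
Variable l : seq (R * 'rV[R]_d * R).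

Definition quad_form (a : 'rV[R]_d) : R :=
  \sum_i \sum_j Sigma i j * (a 0 i * a 0 j).

(* The trigonometric polynomial x |-> E T(x + sqrt (1 - tau^2) N), where T is
   given by l and N is Gaussian with covariance Sigma. *)
Definition heat_tp (tau : R) : seq (R * 'rV[R]_d * R) :=
  [seq (e.1.1 * expR (- ((1 - tau ^+ 2) * (quad_form e.1.2 / 2))), e.1.2, e.2) | e <- l].

(** The heat equation, term by term: the derivative of the exponential multiplies a cosine of
    frequency a by t times the quadratic form of a, and each product a_i a_j times this cosine is
    minus its second derivative along i and j. As an identity between finite sums it holds for every
    matrix [Sigma]. *)
Lemma is_derive_heat_tp (x : 'rV[R]_d) (t : R) :
  is_derive t (1 : R) (fun t => tp_eval (heat_tp t) [::] (t *: x))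
   (\sum_i x 0 i * tp_eval (heat_tp t) [:: i] (t *: x)
    - t * \sum_i \sum_j Sigma i j * tp_eval (heat_tp t) [:: j; i] (t *: x)).
Proof.
rewrite /heat_tp; elim: l => [|e l' IH].
  rewrite (_ : (fun t => _) = cst 0); last first.
    by apply/funext => u; rewrite /tp_eval big_nil.
  apply: is_derive_eq; rewrite big1 ?sub0r => [|i _]; last first.
    by rewrite /tp_eval big_nil mulr0.
  rewrite big1 ?mulr0 ?oppr0// => i _; rewrite big1// => j _.
  by rewrite /tp_eval big_nil mulr0.
rewrite (_ : (fun t => _) = (fun t => e.1.1 * expR (- ((1 - t ^+ 2) * (quad_form e.1.2 / 2)))
    * cos (t * dotv e.1.2 x + e.2))
  \+ (fun t => tp_eval [seq (e.1.1 * expR (- ((1 - t ^+ 2) * (quad_form e.1.2 / 2))),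
      e.1.2, e.2) | e <- l'] [::] (t *: x))); last first.
  apply/funext => u; rewrite /tp_eval /= big_cons big_nil/= mulr1 mul0r addr0.
  by rewrite dotvZr.
apply: is_derive_eq.
under [in RHS]eq_bigr do rewrite /tp_eval /= big_cons mulrDr.
under [X in _ = _ - _ * X]eq_bigr do under eq_bigr do
  rewrite /tp_eval /= big_cons mulrDr.
under [X in _ = _ - _ * X]eq_bigr do rewrite big_split /=.
rewrite !big_split /= [t * (_ + _)]mulrDr.
have rearr (u v w z : R) : u + v - (w + z) = u - w + (v - z) by ring.
rewrite [RHS]rearr; congr (_ + _).
set E := expR _; set A := t * dotv _ _ + _.
set B := dotv e.1.2 x; set Q := quad_form e.1.2.
rewrite [LHS](_ : _ = e.1.1 * E * (- sin A * B) + e.1.1 * E * (t * Q) * cos A); last first.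
  rewrite /GRing.scale /= -/A -/E -/B -/Q.
  set s1 := sin A; set c1 := cos A.
  by field.
congr (_ + _).
  transitivity (\sum_i e.1.1 * E * - sin A * (e.1.2 0 i * x 0 i)).
    by rewrite -mulr_sumr /B /dotv; ring.
  apply: eq_bigr => i _.
  by rewrite big_cons big_nil dotvZr mul1r cosDpihalf -/A; ring.
transitivity (- (t * \sum_i \sum_j Sigma i j * (e.1.1 * E * (e.1.2 0 i * e.1.2 0 j)
    * - cos A))).
  rewrite [X in - (t * X)](_ : _ = Q * (e.1.1 * E * - cos A)); first by ring.
  rewrite /Q /quad_form mulr_suml; apply: eq_bigr => i _.
  by rewrite mulr_suml; apply: eq_bigr => j _; ring.
congr (- (t * _)); apply: eq_bigr => i _; apply: eq_bigr => j _.
rewrite !big_cons big_nil dotvZr -/A (_ : 2 * (pi / 2) = pi); last by field.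
by rewrite cosDpi; ring.
Qed.

Lemma is_derive_mean_heat_tp (t : R) :
  is_derive t (1 : R)
   (fun t => cube_mean (fun S => tp_eval (heat_tp t) [::] (t *: chaos_vec al S)))
   (cube_mean (fun S =>
    \sum_i chaos_vec al S 0 i * tp_eval (heat_tp t) [:: i] (t *: chaos_vec al S)
    - t * \sum_i \sum_j Sigma i j *
         tp_eval (heat_tp t) [:: j; i] (t *: chaos_vec al S))).
Proof.
rewrite /cube_mean.
rewrite (_ : (fun t => _) = ((2 ^+ n)^-1 \*: \sum_(S : {set 'I_n})
  (fun t => tp_eval (heat_tp t) [::] (t *: chaos_vec al S)))); last first.
  by apply/funext => u; rewrite /= fct_sumE.
apply: is_deriveZ.
elim/big_rec2 : _ => [|S f g _ IH]; first exact: is_derive_cst.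
by apply: is_deriveD => //; exact: is_derive_heat_tp.
Qed.

Variable K : R.
Hypothesis heat_tpK : forall (tau : R) (s : seq 'I_d) x, 0 <= tau <= 1 ->
  size s = 2 \/ size s = 4 -> `|tp_eval (heat_tp tau) s x| <= K.

Lemma smart_path_deriv_le (t : R) : 0 <= t <= 1 ->
  `|cube_mean (fun S =>
    \sum_i chaos_vec al S 0 i * tp_eval (heat_tp t) [:: i] (t *: chaos_vec al S)
    - t * \sum_i \sum_j Sigma i j *
         tp_eval (heat_tp t) [:: j; i] (t *: chaos_vec al S))|
  <= K * (\sum_i \sum_j cube_mean (fun S =>
             `|carre_du_champ (q i) (al i) (al j) S - Sigma i j|)
        + \sum_k cube_mean (fun S => norm1 (deriv_vec al k S) ^+ 4)).
Proof.
move=> t01; have t0 : 0 <= t by case/andP: t01.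
have t1 : t <= 1 by case/andP: t01.
pose F S := chaos_vec al S.
pose G i j S := carre_du_champ (q i) (al i) (al j) S.
pose H s S := tp_eval (heat_tp t) s (t *: F S).
(* [a] is the defect of the integration by parts, and [b] is the comparison of the carre du champ
   with [Sigma]. *)
pose a := \sum_i (cube_mean (fun S => F S 0 i * H [:: i] S)
  - t * \sum_j cube_mean (fun S => G i j S * H [:: j; i] S)).
pose b := t * \sum_i \sum_j cube_mean (fun S => (G i j S - Sigma i j) * H [:: j; i] S).
have -> : cube_mean (fun S => \sum_i F S 0 i * H [:: i] S
    - t * \sum_i \sum_j Sigma i j * H [:: j; i] S) = a + b.
  rewrite cube_meanB cube_mean_sum cube_meanZ /a sumrB -addrA; congr (_ + _).
  rewrite -[X in _ = - X + _]mulr_sumr /b -[LHS]mulrN -[X in _ = X + _]mulrN -[RHS]mulrDr.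
  congr (t * _).
  rewrite cube_mean_sum -!sumrN -big_split; apply: eq_bigr => i _ /=.
  rewrite cube_mean_sum -!sumrN -big_split; apply: eq_bigr => j _ /=.
  rewrite [X in _ = _ + X](_ : _ = cube_mean (fun S => G i j S * H [:: j; i] S
      - Sigma i j * H [:: j; i] S)); last first.
    by apply: eq_cube_mean => S; rewrite mulrBl.
  by rewrite cube_meanB addrA addNr add0r.
rewrite mulrDr addrC; apply: (le_trans (ler_normD _ _)).
apply: lerD; last first.
  rewrite /a; apply: (le_trans (ler_norm_sum _ _ _)).
  rewrite mulr_sumr.
  have K4 (s : seq 'I_d) x : size s = 4 -> `|tp_eval (heat_tp t) s x| <= K.
    by move=> s4; apply: heat_tpK => //; right.
  apply: (le_trans (ler_sum _ (fun i _ => stein_identity_error q0 hal t01 K4 i))).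
  rewrite exchange_big /= le_eqVlt; apply/orP; left; apply/eqP.
  apply: eq_bigr => k _; rewrite -mulr_suml mulrC; congr (_ * _).
  rewrite -cube_mean_sum; apply: eq_cube_mean => S.
  by rewrite -mulr_suml exprS.
rewrite /b normrM ger0_norm// -[leRHS]mul1r; apply: ler_pM => //.
apply: (le_trans (ler_norm_sum _ _ _)); rewrite mulr_sumr; apply: ler_sum => i _.
apply: (le_trans (ler_norm_sum _ _ _)); rewrite mulr_sumr; apply: ler_sum => j _.
apply: (le_trans (ler_norm_cube_mean _)); rewrite -cube_meanZ.
apply: ler_cube_mean => S; rewrite normrM mulrC; apply: ler_wpM2r => //.
by apply: heat_tpK => //; left.
Qed.

Lemma smart_path_le :
  `|cube_mean (fun S => tp_eval l [::] (chaos_vec al S)) - tp_eval (heat_tp 0) [::] 0|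
  <= K * (\sum_i \sum_j cube_mean (fun S =>
             `|carre_du_champ (q i) (al i) (al j) S - Sigma i j|)
        + \sum_k cube_mean (fun S => norm1 (deriv_vec al k S) ^+ 4)).
Proof.
have := mvt_norm_le ler01 is_derive_mean_heat_tp.
rewrite subr0 => /(_ _ smart_path_deriv_le); rewrite mulr1; congr (`| _ - _| <= _).
  apply: eq_cube_mean => S; rewrite scale1r /tp_eval /heat_tp big_map.
  apply: eq_bigr => e _ /=.
  by rewrite expr1n subrr mul0r oppr0 expR0 mulr1.
rewrite (_ : (fun S => _) = (fun=> tp_eval (heat_tp 0) [::] 0)) ?cube_mean_cst//.
by apply/funext => S; rewrite scale0r.
Qed.

Lemma norm1_pow4_le (x : 'rV[R]_d) : norm1 x ^+ 4 <= d%:R ^+ 3 * \sum_i x 0 i ^+ 4.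
Proof.
have := sum_sqr_le_card predT (fun i => `|x 0 i|); rewrite card_ord => le2.
have := sum_sqr_le_card predT (fun i => x 0 i ^+ 2); rewrite card_ord => le4.
rewrite (_ : 4 = 2 * 2)%N// exprM.
have sq0 : 0 <= \sum_i `|x 0 i| ^+ 2 by apply: sumr_ge0 => i _; exact: exprn_ge0.
apply: (@le_trans _ _ ((d%:R * \sum_i `|x 0 i| ^+ 2) ^+ 2)).
  by rewrite ler_pXn2r// nnegrE ?sqr_ge0// mulr_ge0.
under eq_bigr do rewrite real_normK ?num_real//.
under [X in _ <= _ * X]eq_bigr do rewrite exprM.
rewrite exprMn [leRHS](_ : _ = d%:R ^+ 2 * (d%:R * \sum_i x 0 i ^+ 2 ^+ 2)); last first.
  by rewrite exprSr mulrA.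
apply: ler_wpM2l; first exact: exprn_ge0.
exact: le4.
Qed.

Lemma chaos_vec_bound : 0 <= K ->
  `|cube_mean (fun S => tp_eval l [::] (chaos_vec al S)) - tp_eval (heat_tp 0) [::] 0|
  <= K * (\sum_i \sum_j (
        `|Sigma i j - cube_mean (fun S => walsh_poly (al i) S * walsh_poly (al j) S)|
        + Num.sqrt (2 ^+ (q i + q j) *
            \sum_(1 <= r < (minn (q i) (q j)).+1 | (q i != q j) || (r != q i))
              set_contraction_norm2 (q i) (q j) r (al i) (al j)))
     + d%:R ^+ 3 * \sum_i 16 ^+ q i *
          set_contraction_norm2 (q i) (q i) (q i).-1 (al i) (al i)).
Proof.
move=> K0; apply: (le_trans smart_path_le); apply: ler_wpM2l => //; apply: lerD.
  apply: ler_sum => i _; apply: ler_sum => j _.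
  (* [m] is also the mean of the carre du champ, so inserting it leaves a deterministic gap and a
     centred term, whose L^1 norm is bounded by a standard deviation. *)
  set m := cube_mean (fun S => walsh_poly _ _ * _).
  apply: (@le_trans _ _ (cube_mean (fun S => `|Sigma i j - m|
     + `|carre_du_champ (q i) (al i) (al j) S - m|))).
    apply: ler_cube_mean => S; rewrite [leRHS]addrC distrC.
    rewrite [X in _ <= X + _]distrC; apply: le_trans (ler_normD _ _).
    by rewrite [X in _ <= `|X|](_ : _ = Sigma i j - carre_du_champ (q i) (al i) (al j) S)//; ring.
  rewrite cube_meanD cube_mean_cst lerD2l.
  apply: (le_trans (cube_mean_norm_le_sqrt _)); apply: ler_wsqrtr.
  exact: gamma_variance_le.
apply: (@le_trans _ _ (\sum_k cube_mean (fun S => d%:R ^+ 3 *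
   \sum_i walsh_poly (walsh_deriv k (al i)) S ^+ 4))).
  apply: ler_sum => k _; apply: ler_cube_mean => S.
  apply: (le_trans (norm1_pow4_le _)).
  by under eq_bigr do rewrite mxE.
under eq_bigr do rewrite cube_meanZ cube_mean_sum.
rewrite -mulr_sumr exchange_big /=; apply: ler_wpM2l; first exact: exprn_ge0.
by apply: ler_sum => i _; apply: sum_deriv_moment4_le.
Qed.

End smart_path.

(** * Gaussian laws *)

Section normal_moments.
Local Open Scope classical_set_scope.
Context {R : realType}.
Variables m s : R.
Hypothesis s0 : s != 0.
Notation mu := (@lebesgue_measure R).
Let p : R -> R := normal_pdf m s.

Let p_ge0 x : 0 <= p x. Proof. exact: normal_pdf_ge0. Qed.

Let pE x : p x = normal_peak s * expR (- (x - m) ^+ 2 / (s ^+ 2 *+ 2)).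
Proof. by rewrite /p normal_pdfE. Qed.

Let s2 : s ^+ 2 != 0. Proof. by rewrite expf_neq0. Qed.

Let is_derive_p x : is_derive x (1 : R) p (- ((x - m) / s ^+ 2) * p x).
Proof.
rewrite (_ : p = (fun x => normal_peak s * expR (- (x - m) ^+ 2 / (s ^+ 2 *+ 2))));
  last by apply/funext => y; rewrite pE.
apply: is_derive_eq; rewrite /GRing.scale /= -mulr_natr.
set e := expR _; field; exact: s0.
Qed.

(** The square is dominated by exponentials, and an exponential times a normal density is a multiple
    of a shifted normal density. Integrability and decay of the second-moment integrand thus both
    follow from facts about densities. *)
Let sqr_p_le x : (x - m) ^+ 2 * p x
  <= 2 * expR (s ^+ 2 / 2) * (normal_pdf (m + s ^+ 2) s x + normal_pdf (m - s ^+ 2) s x).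
Proof.
have sqr_exp (v : R) : v ^+ 2 <= 2 * (expR v + expR (- v)).
  wlog v0 : v / 0 <= v.
    move=> h; have [/h//|/ltW v0] := leP 0 v.
    by have := h (- v); rewrite oppr_ge0 sqrrN opprK [expR _ + _]addrC => /(_ v0).
  have := expR_ge1Dxn 1 v0; have := expR_gt0 (- v).
  rewrite (_ : 2`! = 2)%N// => h1 h2.
  have : v ^+ 2 / 2 <= expR v by lra.
  by lra.
rewrite !normal_pdfE// pE.
(* Completing the square in the exponent. *)
have shift (c : R) : normal_peak s * normal_fun (m + c * s ^+ 2) s x * expR (c ^+ 2 * s ^+ 2 / 2)
   = expR (c * (x - m)) * (normal_peak s * expR (- (x - m) ^+ 2 / (s ^+ 2 *+ 2))).
  rewrite /normal_fun -[LHS]mulrA [RHS]mulrCA -!expRD; congr (_ * expR _).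
  by rewrite -mulr_natr; field; exact: s0.
have := shift 1; have := shift (-1).
rewrite sqrrN expr1n !mul1r !mulN1r => e1 e2.
set E := expR (s ^+ 2 / 2) in e1 e2 *.
set A := normal_peak s * normal_fun (m + _) _ _ in e2 *.
set B := normal_peak s * normal_fun (m - _) _ _ in e1 *.
rewrite (_ : 2 * E * (A + B) = 2 * (A * E + B * E)); last by ring.
rewrite e1 e2 -mulrDl mulrA; apply: ler_wpM2r; first by rewrite -pE.
exact: sqr_exp.
Qed.

Lemma normal_dominated_integrable (f : R -> R) (K : R) :
  measurable_fun setT f ->
  (forall x, `|f x| <= K * (1 + (x - m) ^+ 2) * p x) ->
  mu.-integrable setT (EFin \o f).
Proof.
move=> mf fle.
pose g x := `|K| * (p x + 2 * expR (s ^+ 2 / 2) *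
  (normal_pdf (m + s ^+ 2) s x + normal_pdf (m - s ^+ 2) s x)).
have ig : mu.-integrable setT (EFin \o g).
  rewrite /g /comp; under eq_fun do rewrite EFinM EFinD EFinM EFinD.
  apply: integrableZl => //; apply: integrableD => //.
    exact: integrable_normal_pdf.
  apply: integrableZl => //; apply: integrableD => //; exact: integrable_normal_pdf.
apply: le_integrable ig => //; first exact/measurable_EFinP.
move=> x _; rewrite /= lee_fin; apply: (le_trans (fle x)).
rewrite -mulrA mulrDl mul1r.
apply: (@le_trans _ _ (`|K| * (p x + (x - m) ^+ 2 * p x))).
  apply: ler_wpM2r; last exact: ler_norm.
  by rewrite addr_ge0// mulr_ge0// sqr_ge0.
apply: le_trans (ler_norm _); apply: ler_wpM2l => //.
by rewrite lerD2l.
Qed.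

Lemma normal_decay : exists C : R, forall x, (x - m) ^+ 2 * p x <= C.
Proof.
exists (2 * expR (s ^+ 2 / 2) * (normal_peak s + normal_peak s)) => x.
apply: (le_trans (sqr_p_le x)); apply: ler_wpM2l.
  by rewrite mulr_ge0// expR_ge0.
by apply: lerD; exact: normal_pdf_ub.
Qed.

(** The fundamental theorem of calculus on the intervals [D n]: at their end points the last
    hypothesis bounds H by C / (n + 1). Dominated convergence extends this to the whole line. *)
Lemma integral_derive0 (H h : R -> R) (C : R) :
  (forall x, is_derive x (1 : R) H (h x)) -> continuous h ->
  mu.-integrable setT (EFin \o h) ->
  (forall x, `|x - m| * `|H x| <= C) ->
  (\int[mu]_x (h x)%:E = 0)%E.
Proof.
move=> dH ch ih HC.
pose D (n : nat) := `[m - n.+1%:R, m + n.+1%:R]%classic.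
pose f_ n := (EFin \o h) \_ (D n).
have mh : measurable_fun setT h by exact: continuous_measurable_fun.
have fh : {ae mu, forall x, setT x -> f_ ^~ x @ \oo --> (EFin \o h) x}.
  apply: aeW => x _; apply: cvg_near_cst.
  near=> n; rewrite /f_ patchE mem_set// /D /= in_itv /=.
  have : `|x - m| <= n%:R.
    near: n; exact: nbhs_infty_ger.
  rewrite ler_norml -natr1 => /andP[? ?]; apply/andP; split; lra.
have mf n : measurable_fun setT (f_ n).
  apply/measurable_restrict => //; first exact: measurable_itv.
  by rewrite setTI; apply/measurable_EFinP; exact: measurable_funTS.
have bnd : {ae mu, forall x n, setT x -> (`|f_ n x| <= (abse \o (EFin \o h)) x)%E}.
  apply: aeW => x n _; rewrite /f_ patchE; case: ifP => //= _.
  by rewrite normr0 lee_fin.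
have [_ _ cv] := @dominated_convergence _ _ _ mu setT measurableT f_ (EFin \o h) _
   mf (measurable_int _ ih) fh (integrable_abse ih) bnd.
have int_n n : (\int[mu]_x f_ n x = (H (m + n.+1%:R) - H (m - n.+1%:R))%:E)%E.
  rewrite -integral_mkcond EFinB; apply: continuous_FTC2.
  - by rewrite ltrD2l gtrN// ltr0n.
  - exact: continuous_subspaceT.
  - have cH : continuous H.
      move=> x; apply: differentiable_continuous; apply/derivable1_diffP.
      exact: ex_derive.
    split; first by move=> x _; exact: ex_derive.
      by apply: cvg_at_right_filter; exact: cH.
    by apply: cvg_at_left_filter; exact: cH.
  - by move=> x _; rewrite derive1E derive_val.
have cv0 : (H (m + n.+1%:R) - H (m - n.+1%:R))%:E @[n --> \oo] --> 0%E; last first.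
  have ex : (fun n => \int[mu]_x f_ n x)%E = (fun n => (H (m + n.+1%:R) - H (m - n.+1%:R))%:E).
    by apply/funext => n; exact: int_n.
  rewrite ex in cv.
  by have := cvg_unique _ cv cv0; apply.
apply: cvg_EFin; first exact: nearW.
apply: (@squeeze_cvgr _ _ _ _ (fun n => - (2 * C * n.+1%:R^-1))
   (fun n => 2 * C * n.+1%:R^-1)).
- apply: nearW => n /=; rewrite -ler_norml.
  apply: (le_trans (ler_normB _ _)).
  have h1 := HC (m + n.+1%:R); have h2 := HC (m - n.+1%:R).
  rewrite addrAC subrr add0r in h1; rewrite addrAC subrr add0r normrN in h2.
  rewrite normr_nat in h1; rewrite normr_nat in h2.
  have n0 : 0 < n.+1%:R :> R by rewrite ltr0n.
  by rewrite ler_pdivlMr// mulrC mulrDr; lra.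
- rewrite -oppr0; apply: cvgN; rewrite -(mulr0 (2 * C)); apply: cvgMr.
  exact: cvg_harmonic.
- rewrite -(mulr0 (2 * C)); apply: cvgMr; exact: cvg_harmonic.
Unshelve. all: by end_near. Qed.

Let abs_le (v : R) : `|v| <= 1 + v ^+ 2.
Proof. by rewrite -[v ^+ 2]real_normK ?num_real//; nra. Qed.

Lemma weighted_integrable (g : R -> R) (K : R) : continuous g ->
  (forall x, `|g x| <= K * (1 + (x - m) ^+ 2)) ->
  mu.-integrable setT (EFin \o (fun x => g x * p x)).
Proof.
move=> cg gK; apply: (@normal_dominated_integrable _ K).
  apply: measurable_funM; first exact: continuous_measurable_fun.
  exact: measurable_normal_pdf.
move=> x; rewrite normrM [`|p x|]ger0_norm//.
exact: ler_wpM2r.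
Qed.

Let cu (x : R) : {for x, continuous (fun x => x - m)}.
Proof. by apply: cvgB; [exact: cvg_id|exact: cvg_cst]. Qed.

Let cp : continuous p. Proof. exact: continuous_normal_pdf. Qed.

Let decay (g : R -> R) : (forall x, `|g x| <= 1 + `|x - m|) ->
  exists C, forall x, `|x - m| * `|g x * p x| <= C.
Proof.
move=> gle; have [C hC] := normal_decay.
exists (2 * C + normal_peak s) => x.
have := hC x; have := normal_pdf_ub m x s0; rewrite -/p => pk.
rewrite normrM [`|p x|]ger0_norm// -[(x - m) ^+ 2]real_normK ?num_real//.
set v := `|x - m| => hv; have v0 : 0 <= v by exact: normr_ge0.
apply: (@le_trans _ _ (v * ((1 + v) * p x))).
  by apply: ler_wpM2l => //; apply: ler_wpM2r => //; exact: gle.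
have : v * p x <= (1 + v ^+ 2) * p x by apply: ler_wpM2r => //; nra.
by lra.
Qed.

Let integral_p : \int[mu]_x p x = 1.
Proof. by rewrite /Rintegral integral_normal_pdf. Qed.

(** Stein's identity for a one-dimensional normal law. The mean, the variance and the differential
    equation of the cosine transform are its cases g = 1, g = x - m and g = sin. *)
Let ibp (g dg : R -> R) (K : R) : (forall x, is_derive x (1 : R) g (dg x)) ->
  continuous dg -> (forall x, `|g x| <= 1 + `|x - m|) ->
  (forall x, `|dg x| <= K) ->
  s ^+ 2 * (\int[mu]_x (dg x * p x)) = \int[mu]_x ((x - m) * g x * p x).
Proof.
move=> dgP cdg gle dgK.
have cg : continuous g.
  move=> x; apply: differentiable_continuous; apply/derivable1_diffP.
  exact: ex_derive.
have i1 : mu.-integrable setT (EFin \o (fun x => dg x * p x)).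
  apply: (@weighted_integrable _ K) => // x; apply: (le_trans (dgK x)).
  by rewrite ler_peMr ?(le_trans _ (dgK x))// lerDl sqr_ge0.
have i2 : mu.-integrable setT (EFin \o (fun x => (x - m) * g x * p x)).
  apply: (@weighted_integrable _ 2) => [x|x].
    by apply: cvgM; [exact: cu|exact: cg].
  rewrite normrM -[(x - m) ^+ 2]real_normK ?num_real//.
  have := gle x; have := normr_ge0 (x - m); set v := `|x - m| => v0 h.
  apply: (@le_trans _ _ (v * (1 + v))); first exact: ler_wpM2l.
  by nra.
have dH x : is_derive x (1 : R) (fun x => g x * p x)
    (dg x * p x - (s ^+ 2)^-1 * ((x - m) * g x * p x)).
  have h1 := dgP x; have h2 := is_derive_p x; apply: is_derive_eq.
  by rewrite /GRing.scale /=; field; exact: s0.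
have ch : continuous (fun x => dg x * p x - (s ^+ 2)^-1 * ((x - m) * g x * p x)).
  move=> x; apply: cvgB; first by apply: cvgM; [exact: cdg|exact: cp].
  apply: cvgMr; apply: cvgM; last exact: cp.
  by apply: cvgM; [exact: cu|exact: cg].
have i2' : mu.-integrable setT (EFin \o (fun x => (s ^+ 2)^-1 * ((x - m) * g x * p x))).
  rewrite (_ : _ \o _ = (fun x => (s ^+ 2)^-1%:E * ((x - m) * g x * p x)%:E)%E)//.
  exact: integrableZl.
have [C hC] := decay gle.
have ih : mu.-integrable setT
    (EFin \o (fun x => dg x * p x - (s ^+ 2)^-1 * ((x - m) * g x * p x))).
  rewrite (_ : _ \o _ = (fun x => (dg x * p x)%:E -
     ((s ^+ 2)^-1 * ((x - m) * g x * p x))%:E)%E)//.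
  exact: integrableB.
have := congr1 fine (integral_derive0 dH ch ih hC).
rewrite -/(Rintegral mu setT _) RintegralB// RintegralZl// => /eqP.
by rewrite subr_eq0 => /eqP ->; rewrite mulrA divff// mul1r.
Qed.

Lemma normal_mean0 : \int[mu]_x ((x - m) * p x) = 0.
Proof.
have : s ^+ 2 * (\int[mu]_x (0 * p x)) = \int[mu]_x ((x - m) * 1 * p x).
  apply: (@ibp (fun=> 1) (fun=> 0) 0) => [x|x|x].
  - exact: cvg_cst.
  - by rewrite normr1 lerDl.
  - by rewrite normr0.
under eq_Rintegral do rewrite mul0r.
rewrite Rintegral_cst// mul0r mulr0.
by under [X in _ = X]eq_Rintegral do rewrite mulr1.
Qed.

Lemma normal_variance : \int[mu]_x ((x - m) ^+ 2 * p x) = s ^+ 2.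
Proof.
have : s ^+ 2 * (\int[mu]_x (1 * p x)) = \int[mu]_x ((x - m) * (x - m) * p x).
  apply: (@ibp (fun x => x - m) (fun=> 1) 1) => [x|x|x|x].
  - by apply: is_derive_eq; rewrite subr0.
  - exact: cvg_cst.
  - by rewrite lerDr.
  - by rewrite normr1.
under eq_Rintegral do rewrite mul1r.
by rewrite integral_p mulr1.
Qed.

(** The cosine transform [phi c] of the centred variable satisfies y' = - s^2 t y by differentiation
    under the integral and Stein's identity. The phase [c] makes cosines sufficient, without complex
    exponentials. *)
Lemma normal_cos (b : R) : \int[mu]_x (cos (x + b) * p x)
  = expR (- (s ^+ 2 / 2)) * cos (m + b).
Proof.
pose phi (c t : R) := \int[mu]_x (cos (t * (x - m) + c) * p x).
have ccos (t c : R) : continuous (fun x : R => cos (t * (x - m) + c)).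
  move=> x; apply: (@continuous_comp _ _ _ (fun x : R => t * (x - m) + c) cos).
    by apply: cvgD; [apply: cvgMr; exact: cu|exact: cvg_cst].
  exact: continuous_cos.
have intcos t c : mu.-integrable setT (EFin \o (fun x => cos (t * (x - m) + c) * p x)).
  apply: (@weighted_integrable _ 1) => // x.
  by rewrite mul1r; apply: (le_trans (cos_max _)); rewrite lerDl sqr_ge0.
have dphi c t : is_derive t (1 : R) (phi c) (- (s ^+ 2) * t * phi c t).
  pose f (t x : R) := cos (t * (x - m) + c) * p x.
  have df (u x : R) : is_derive u (1 : R) (f ^~ x)
      (- ((x - m) * sin (u * (x - m) + c)) * p x).
    by apply: is_derive_eq; rewrite /GRing.scale /=; ring.
  have p1f u x : partial1of2 f u x = - ((x - m) * sin (u * (x - m) + c)) * p x.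
    by rewrite partial1of2E derive_val.
  pose G x := `|x - m| * p x.
  have intG : mu.-integrable setT (EFin \o G).
    apply: (@weighted_integrable _ 1) => [x|x]; last by rewrite mul1r normr_id abs_le.
    by apply: cvg_norm; exact: cu.
  have tI : `]t - 1, t + 1[%classic t by rewrite /= in_itv /=; apply/andP; split; lra.
  have G0 y : 0 <= G y by rewrite mulr_ge0.
  have Gub u y : `]t - 1, t + 1[%classic u -> setT y -> `|partial1of2 f u y| <= G y.
    move=> _ _; rewrite p1f normrM normrN normrM [`|p y|]ger0_norm//.
    apply: ler_wpM2r => //; rewrite -[leRHS]mulr1; apply: ler_wpM2l => //.
    exact: sin_max.
  have der1 u y : `]t - 1, t + 1[%classic u -> setT y -> derivable (f ^~ y) u 1.
    by move=> _ _; exact: ex_derive.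
  have inf u : `]t - 1, t + 1[%classic u -> mu.-integrable setT (EFin \o f u).
    by move=> _; exact: intcos.
  apply: DeriveDef.
    exact: (derivable_under_integral measurableT tI inf der1 G0 intG Gub).
  rewrite -derive1E (differentiation_under_integral measurableT tI inf der1 G0 intG Gub).
  have h : s ^+ 2 * (\int[mu]_x (t * cos (t * (x - m) + c) * p x))
     = \int[mu]_x ((x - m) * sin (t * (x - m) + c) * p x).
    apply: (@ibp (fun x => sin (t * (x - m) + c))
      (fun x => t * cos (t * (x - m) + c)) `|t|) => [x|x|x|x].
    - by apply: is_derive_eq; rewrite /GRing.scale /=; ring.
    - by apply: cvgMr; exact: ccos.
    - by apply: (le_trans (sin_max _)); rewrite lerDl.
    - by rewrite normrM -[leRHS]mulr1; apply: ler_wpM2l => //; exact: cos_max.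
  transitivity (- (\int[mu]_x ((x - m) * sin (t * (x - m) + c) * p x))).
    rewrite -[RHS]mulN1r -RintegralZl//.
      by apply: eq_Rintegral => x _; rewrite p1f; ring.
    apply: (@weighted_integrable _ 1) => [x|x].
      apply: cvgM; first exact: cu.
      apply: (@continuous_comp _ _ _ (fun x : R => t * (x - m) + c) sin).
        by apply: cvgD; [apply: cvgMr; exact: cu|exact: cvg_cst].
      exact: continuous_sin.
    rewrite mul1r normrM; apply: le_trans (abs_le _).
    by rewrite -[leRHS]mulr1; apply: ler_wpM2l => //; exact: sin_max.
  rewrite -h mulNr mulNr; congr (- _); rewrite -mulrA; congr (_ * _).
  by rewrite /phi -RintegralZl//; apply: eq_Rintegral => x _; rewrite mulrA.
have phi0 c : phi c 0 = cos c.
  rewrite /phi; under eq_Rintegral do rewrite mul0r add0r.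
  rewrite RintegralZl ?integral_p ?mulr1//; exact: integrable_normal_pdf.
(* The product of [phi] with the integrating factor exp(s^2 t^2 / 2) has zero derivative; its values
   at 0 and 1 are compared. *)
have -> : cos (m + b) = phi (m + b) 1 * expR (s ^+ 2 / 2).
  have := @is_derive_0_is_cst R (fun t => phi (m + b) t * expR (s ^+ 2 / 2 * t ^+ 2)) 0 1.
  rewrite phi0 expr0n mulr0 expR0 mulr1 expr1n mulr1; apply=> t.
  have h1 := dphi (m + b) t; apply: is_derive_eq.
  by rewrite /GRing.scale /=; set E := expR _; set F := phi _ _; field.
rewrite expRN mulrCA mulVf ?mulr1 ?gt_eqF ?expR_gt0// /phi.
by apply: eq_Rintegral => x _; rewrite mul1r addrA subrK.
Qed.

End normal_moments.

(** * Integrals against one-dimensional Gaussian laws *)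

Section laws.
Local Open Scope classical_set_scope.
Context {R : realType}.
Notation mu := (@lebesgue_measure R).

(** The change of variables gives an integral against the Radon-Nikodym derivative, which equals the
    density almost everywhere because both have the same integrals over measurable sets. *)
Lemma ge0_integral_normal_prob (m s : R) (f : R -> \bar R) : s != 0 ->
  (forall x, 0 <= f x)%E -> measurable_fun setT f ->
  (\int[normal_prob m s]_x f x = \int[mu]_x (f x * (normal_pdf m s x)%:E))%E.
Proof.
move=> s0 f0 mf; have dom := @normal_prob_dominates R m s.
rewrite -(Radon_Nikodym_SigmaFinite.change_of_variables dom f0 measurableT mf).
have mp : measurable_fun setT (EFin \o normal_pdf m s).
  by apply/measurable_EFinP; exact: measurable_normal_pdf.
have mrn := measurable_int _ (Radon_Nikodym_SigmaFinite.f_integrable dom).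
apply: ae_eq_integral => //; [exact: emeasurable_funM|exact: emeasurable_funM|].
have : ae_eq mu setT (Radon_Nikodym_SigmaFinite.f (normal_prob m s) mu)
    (EFin \o normal_pdf m s).
  apply: integral_ae_eq => //; first exact: Radon_Nikodym_SigmaFinite.f_integrable.
  by move=> E _ mE; rewrite -Radon_Nikodym_SigmaFinite.f_integral.
by apply: filterS => x /[apply] ->.
Qed.

Lemma integral_normal_prob (m s : R) (f : R -> R) : s != 0 ->
  measurable_fun setT f ->
  mu.-integrable setT (EFin \o (fun x => f x * normal_pdf m s x)) ->
  (normal_prob m s).-integrable setT (EFin \o f) /\
  \int[normal_prob m s]_x f x = \int[mu]_x (f x * normal_pdf m s x).
Proof.
move=> s0 mf ifp.
have tr (g : R -> R) : (forall x, 0 <= g x) -> measurable_fun setT g ->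
    mu.-integrable setT (EFin \o (fun x => g x * normal_pdf m s x)) ->
    (normal_prob m s).-integrable setT (EFin \o g) /\
    \int[normal_prob m s]_x g x = \int[mu]_x (g x * normal_pdf m s x).
  move=> g0 mg ig.
  have e : (\int[normal_prob m s]_x (g x)%:E
      = \int[mu]_x (g x * normal_pdf m s x)%:E)%E.
    by rewrite ge0_integral_normal_prob//; exact/measurable_EFinP.
  split; last by rewrite /Rintegral e.
  apply/integrableP; split; first exact/measurable_EFinP.
  under eq_integral do rewrite /= ger0_norm//.
  rewrite e; have /integrableP[_] := ig.
  by under eq_integral do rewrite /= ger0_norm ?mulr_ge0 ?normal_pdf_ge0//.
have iabs : mu.-integrable setT (EFin \o (fun x => `|f x| * normal_pdf m s x)).
  rewrite (_ : _ \o _ = abse \o (EFin \o (fun x => f x * normal_pdf m s x))).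
    exact: integrable_abse.
  by apply/funext => x /=; rewrite normrM [`|normal_pdf _ _ _|]ger0_norm ?normal_pdf_ge0.
have [i1 e1] := tr (fun x => `|f x|) (fun x => normr_ge0 _)
  (measurableT_comp (@normr_measurable R setT) mf) iabs.
have isum : mu.-integrable setT (EFin \o (fun x => (f x + `|f x|) * normal_pdf m s x)).
  rewrite (_ : _ \o _ = (fun x => (f x * normal_pdf m s x)%:E
    + (`|f x| * normal_pdf m s x)%:E)%E); first exact: integrableD.
  by apply/funext => x /=; rewrite mulrDl EFinD.
have [||i2 e2] := tr (fun x => f x + `|f x|) _ _ isum.
- by move=> x; have := ler_norm (- f x); rewrite normrN; lra.
- apply: measurable_funD => //; exact: measurableT_comp.
have fE : f = (fun x => (f x + `|f x|) - `|f x|) by apply/funext => x; rewrite addrK.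
have EfE : EFin \o f = (fun x => (f x + `|f x|)%:E - (`|f x|)%:E)%E.
  by apply/funext => x /=; rewrite -EFinB addrK.
split; first by rewrite EfE; exact: integrableB.
rewrite fE RintegralB// e1 e2 -RintegralB//.
by apply: eq_Rintegral => x _; rewrite addrK mulrDl addrK.
Qed.

Context {dO : measure_display} {Omega : measurableType dO}.
Variable P : probability Omega R.

Lemma integral_law (nu : {measure set (measurableTypeR R) -> \bar R}) (Y : Omega -> R)
    (g : R -> R) : measurable_fun setT Y ->
  (forall A : set R, measurable A -> P (Y @^-1` A) = nu A) ->
  measurable_fun setT g -> nu.-integrable setT (EFin \o g) ->
  P.-integrable setT (EFin \o (g \o Y)) /\ \int[P]_w (g (Y w)) = \int[nu]_x g x.
Proof.
move=> mY law mg ig.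
have mEg : measurable_fun setT (EFin \o g) by exact/measurable_EFinP.
have mY' : @measurable_fun _ _ Omega (measurableTypeR R) setT Y := mY.
pose YM : {mfun Omega >-> measurableTypeR R} :=
  HB.pack Y (isMeasurableFun.Build _ _ _ _ _ mY').
have eqm h : (\int[nu]_x h x = \int[distribution P YM]_x h x)%E.
  by apply: eq_measure_integral => A mA _; exact/esym/law.
have int : P.-integrable setT (EFin \o (g \o Y)).
  apply/integrableP; split; first by apply/measurable_EFinP; exact: measurableT_comp.
  have /integrableP[_] := ig.
  by rewrite eqm ge0_integral_distribution//; exact: measurableT_comp.
by split => //; rewrite /Rintegral eqm integral_distribution.
Qed.

(** The interface to Gaussian variables: two moments and the cosine transform. The Dirac mass
    satisfies the same formulas with s = 0, so the degenerate case is visible only in this proof. *)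
Lemma gaussian_variableP (Y : Omega -> R) : measurable_fun setT Y ->
  gaussian_variable P Y -> exists m s : R,
  [/\ P.-integrable setT (EFin \o Y),
      P.-integrable setT (EFin \o (fun w => (Y w - m) ^+ 2)),
      \int[P]_w Y w = m,
      \int[P]_w ((Y w - m) ^+ 2) = s ^+ 2 &
      forall b, \int[P]_w cos (Y w + b) = expR (- (s ^+ 2 / 2)) * cos (m + b)].
Proof.
move=> mY [m [s law]]; exists m, s; move: law.
have ccos (b : R) : continuous (fun x : R => cos (x + b)).
  move=> x; apply: (@continuous_comp _ _ _ (fun x : R => x + b) cos).
    by apply: cvgD; [exact: cvg_id|exact: cvg_cst].
  exact: continuous_cos.
rewrite /gaussian_law; have [->|s0] := eqVneq s 0 => law.
  have tr (g : R -> R) : measurable_fun setT g ->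
      P.-integrable setT (EFin \o (g \o Y)) /\ \int[P]_w (g (Y w)) = g m.
    move=> mg.
    have mEg : measurable_fun setT (EFin \o g) by exact/measurable_EFinP.
    have ig : (@dirac _ (measurableTypeR R) m R).-integrable setT (EFin \o g).
      apply/integrableP; split => //; rewrite integral_dirac//.
        by rewrite diracT mul1e ltry.
      exact: measurableT_comp.
    have law' (A : set R) : measurable A ->
        P (Y @^-1` A) = @dirac _ (measurableTypeR R) m R A.
      by move=> mA; rewrite law// !diracE.
    have [i ->] := integral_law mY law' mg ig; split => //.
    by rewrite /Rintegral integral_dirac// diracT mul1e.
  have [i1 e1] := tr (fun x => x) (@measurable_id _ _ setT).
  have [|i2 e2] := tr (fun x => (x - m) ^+ 2) _.
    by apply: measurable_funX; exact: measurable_funB.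
  split => //; first by rewrite e2 subrr !expr0n.
  move=> b; rewrite expr0n mul0r oppr0 expR0 mul1r.
  have [|_ ->//] := tr (fun x => cos (x + b)) _.
  exact: continuous_measurable_fun (ccos b).
have tr (g : R -> R) (K : R) : continuous g ->
    (forall x, `|g x| <= K * (1 + (x - m) ^+ 2)) ->
    P.-integrable setT (EFin \o (g \o Y)) /\
    \int[P]_w (g (Y w)) = \int[mu]_x (g x * normal_pdf m s x).
  move=> cg gK; have mg : measurable_fun setT g by exact: continuous_measurable_fun.
  have [i e] := integral_normal_prob s0 mg (weighted_integrable s0 cg gK).
  by rewrite -e; exact: integral_law.
have csub : continuous (fun x : R => x - m).
  by move=> x; apply: cvgB; [exact: cvg_id|exact: cvg_cst].
have [x|i1 e1] := tr (fun x => x - m) 1 csub.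
  rewrite mul1r -[(x - m) ^+ 2]real_normK ?num_real//.
  by set v := `|x - m|; have := normr_ge0 (x - m); rewrite -/v; nra.
have [|x|i2 e2] := tr (fun x => (x - m) ^+ 2) 1.
- by move=> x; exact: (continuous_comp (csub x) (@exprn_continuous R 2 _)).
- by rewrite mul1r ger0_norm ?sqr_ge0// lerDr.
have icst : P.-integrable setT (EFin \o (fun _ : Omega => m)).
  exact: finite_measure_integrable_cst.
have i0 : P.-integrable setT (EFin \o Y).
  rewrite (_ : _ \o _ = (fun w => (Y w - m)%:E + m%:E)%E); first exact: integrableD.
  by apply/funext => w /=; rewrite -EFinD subrK.
split => //.
- rewrite (_ : Y = (fun w => (Y w - m) + m)); last by apply/funext => w; rewrite subrK.
  rewrite RintegralD// e1 normal_mean0// add0r Rintegral_cst//.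
  have PT : fine (P setT) = 1 by rewrite probability_setT.
  by rewrite -[RHS]mulr1 -PT.
- by rewrite e2 normal_variance.
move=> b; have [|x|i3 ->] := tr (fun x => cos (x + b)) 1.
- exact: ccos.
- by rewrite mul1r; apply: (le_trans (cos_max _)); rewrite lerDl sqr_ge0.
exact: normal_cos.
Qed.

End laws.

(** * Gaussian vectors and the smoothing of trigonometric polynomials *)

Section gaussian_vectors.
Local Open Scope classical_set_scope.
Context {R : realType} {dO : measure_display} {Omega : measurableType dO}.
Variable P : probability Omega R.

Lemma integrable_sum (I : Type) (r : seq I) (f : I -> Omega -> R) :
  (forall i, P.-integrable setT (EFin \o f i)) ->
  P.-integrable setT (EFin \o (fun w => \sum_(i <- r) f i w)).
Proof.
move=> intf; elim: r => [|i r IH].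
  rewrite (_ : _ \o _ = cst 0%E); first exact: integrable0.
  by apply/funext => w; rewrite /= big_nil.
rewrite (_ : _ \o _ = (fun w => (f i w)%:E + (\sum_(j <- r) f j w)%:E)%E).
  exact: (integrableD measurableT (intf i) IH).
by apply/funext => w; rewrite /= big_cons EFinD.
Qed.

Lemma Rintegral_sum (I : Type) (r : seq I) (f : I -> Omega -> R) :
  (forall i, P.-integrable setT (EFin \o f i)) ->
  \int[P]_w (\sum_(i <- r) f i w) = \sum_(i <- r) \int[P]_w f i w.
Proof.
move=> intf; elim: r => [|i r IH].
  under eq_Rintegral do rewrite big_nil.
  by rewrite big_nil Rintegral_cst// mul0r.
under eq_Rintegral do rewrite big_cons.
by rewrite RintegralD// ?IH ?big_cons//; exact: integrable_sum.
Qed.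

Lemma integrableZ_real (c : R) (f : Omega -> R) :
  P.-integrable setT (EFin \o f) -> P.-integrable setT (EFin \o (fun w => c * f w)).
Proof.
move=> intf; rewrite (_ : _ \o _ = (fun w => c%:E * (f w)%:E)%E)//.
exact: integrableZl.
Qed.

Lemma integrableD_real (f g : Omega -> R) :
  P.-integrable setT (EFin \o f) -> P.-integrable setT (EFin \o g) ->
  P.-integrable setT (EFin \o (fun w => f w + g w)).
Proof.
move=> intf intg; rewrite (_ : _ \o _ = (fun w => (f w)%:E + (g w)%:E)%E)//.
exact: integrableD.
Qed.

Lemma integrableB_real (f g : Omega -> R) :
  P.-integrable setT (EFin \o f) -> P.-integrable setT (EFin \o g) ->
  P.-integrable setT (EFin \o (fun w => f w - g w)).
Proof.
move=> intf intg; rewrite (_ : _ \o _ = (fun w => (f w)%:E - (g w)%:E)%E)//.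
exact: integrableB.
Qed.

Lemma le_integrable_real (f g : Omega -> R) : measurable_fun setT f ->
  (forall w, `|f w| <= g w) -> P.-integrable setT (EFin \o g) ->
  P.-integrable setT (EFin \o f).
Proof.
move=> mf fg; apply: le_integrable => //; first exact/measurable_EFinP.
by move=> w _; rewrite /= lee_fin (le_trans (fg w))// ler_norm.
Qed.

Lemma integrable_mul_real (f g : Omega -> R) :
  measurable_fun setT f -> measurable_fun setT g ->
  P.-integrable setT (EFin \o (fun w => f w ^+ 2)) ->
  P.-integrable setT (EFin \o (fun w => g w ^+ 2)) ->
  P.-integrable setT (EFin \o (fun w => f w * g w)).
Proof.
move=> mf mg intf intg; apply: le_integrable_real (integrableD_real intf intg).
  exact: measurable_funM.
move=> w; rewrite normrM -(real_normK (num_real (f w))) -(real_normK (num_real (g w))).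
by have := normr_ge0 (f w); have := normr_ge0 (g w); nra.
Qed.

Lemma integrable_bounded_real (f : Omega -> R) (K : R) : measurable_fun setT f ->
  (forall w, `|f w| <= K) -> P.-integrable setT (EFin \o f).
Proof.
move=> mf fK; apply: le_integrable_real mf fK _.
exact: finite_measure_integrable_cst.
Qed.

Lemma Rintegral_prob_cst (c : R) : \int[P]_w c = c.
Proof.
rewrite Rintegral_cst//.
have PT : fine (P setT) = 1 by rewrite probability_setT.
by rewrite -[RHS]mulr1 -PT.
Qed.

Lemma Rintegral_sub_le (f g : Omega -> R) (e : R) :
  P.-integrable setT (EFin \o f) -> P.-integrable setT (EFin \o g) ->
  (forall w, `|f w - g w| <= e) -> `|\int[P]_w f w - \int[P]_w g w| <= e.
Proof.
move=> intf intg fg; rewrite -RintegralB//.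
apply: (le_trans (le_normr_Rintegral measurableT (integrableB_real intf intg))).
rewrite -[leRHS]Rintegral_prob_cst; apply: le_Rintegral => //.
  rewrite (_ : _ \o _ = abse \o (EFin \o (fun w => f w - g w)))//.
  by apply: integrable_abse; exact: integrableB_real.
exact: finite_measure_integrable_cst.
Qed.

Context {d : nat}.
Variables (N : 'I_d -> {RV P >-> R}) (Sigma : 'M[R]_d).
Hypothesis gaussN : centred_gaussian_vector N Sigma.

Definition rv_vec (Z : 'I_d -> Omega -> R) w : 'rV[R]_d := \row_i Z i w.

Let Nsqr i : P.-integrable setT (EFin \o N i) /\
  P.-integrable setT (EFin \o (fun w => N i w ^+ 2)).
Proof.
have [gv EN _] := gaussN.
have gi : gaussian_variable P (N i).
  have := gv (fun j => (j == i)%:R).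
  rewrite (_ : (fun w => _) = N i :> (Omega -> R))//; apply/funext => w.
  rewrite (bigD1 i) //= eqxx mul1r big1 ?addr0// => j /negPf ->.
  by rewrite mul0r.
have mN : measurable_fun setT (N i : Omega -> R) by exact: measurable_funPT.
have [m [s [i1 i2 e1 _ _]]] := gaussian_variableP mN gi.
have m0 : m = 0.
  by rewrite -e1; have := congr1 fine (EN i); rewrite unlock.
split => //; rewrite (_ : (fun w => _) = (fun w => (N i w - m) ^+ 2))//.
by apply/funext => w; rewrite m0 /=; ring.
Qed.

Lemma gaussian_integrable i : P.-integrable setT (EFin \o N i).
Proof. by have [] := Nsqr i. Qed.

Lemma gaussian_sqr_integrable i : P.-integrable setT (EFin \o (fun w => N i w ^+ 2)).
Proof. by have [] := Nsqr i. Qed.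

(** The projection of N on [a] is a Gaussian variable of mean 0, and expanding its square shows that
    its variance is the quadratic form of [Sigma] at [a]. *)
Lemma gaussian_cos a b :
  \int[P]_w cos (dotv a (rv_vec N w) + b) = expR (- (quad_form Sigma a / 2)) * cos b.
Proof.
have [gv EN CN] := gaussN.
have mN i : measurable_fun setT (N i : Omega -> R) by exact: measurable_funPT.
have dotE w : dotv a (rv_vec N w) = \sum_i a 0 i * N i w.
  by apply: eq_bigr => i _; rewrite mxE.
have mY : measurable_fun setT (fun w => \sum_i a 0 i * N i w).
  by apply: measurable_sum => i; apply: measurable_funM.
have [m [s [i1 i2 e1 e2 e3]]] := gaussian_variableP mY (gv (fun i => a 0 i)).
have EN0 i : \int[P]_w N i w = 0.
  by have := congr1 fine (EN i); rewrite unlock.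
have m0 : m = 0.
  rewrite -e1 Rintegral_sum => [|i]; last exact/integrableZ_real/gaussian_integrable.
  rewrite big1// => i _; rewrite RintegralZl ?EN0 ?mulr0//.
  exact: gaussian_integrable.
have intNN i j : P.-integrable setT (EFin \o (fun w => N i w * N j w)).
  by apply: integrable_mul_real => //; have [] := Nsqr i; have [] := Nsqr j.
have ENN i j : \int[P]_w (N i w * N j w) = Sigma i j.
  have := congr1 fine (CN i j); rewrite unlock EN EN unlock /= => <-.
  by congr fine; apply: eq_integral => w _; rewrite fctE /= !subr0.
have s2 : s ^+ 2 = quad_form Sigma a.
  rewrite -e2 m0.
  transitivity (\int[P]_w \sum_i \sum_j (a 0 i * a 0 j) * (N i w * N j w)).
    apply: eq_Rintegral => w _; rewrite subr0 expr2 mulr_suml.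
    apply: eq_bigr => i _; rewrite mulr_sumr; apply: eq_bigr => j _.
    by rewrite mulrACA.
  rewrite Rintegral_sum => [|i]; last first.
    by apply: integrable_sum => j; exact: integrableZ_real.
  apply: eq_bigr => i _; rewrite Rintegral_sum => [|j]; last exact: integrableZ_real.
  by apply: eq_bigr => j _; rewrite RintegralZl// ENN mulrC.
under eq_Rintegral do rewrite dotE.
by rewrite e3 m0 add0r s2.
Qed.

Lemma gaussian_cos_scaled (c : R) a b :
  \int[P]_w cos (c * dotv a (rv_vec N w) + b)
  = expR (- (c ^+ 2 * (quad_form Sigma a / 2))) * cos b.
Proof.
under eq_Rintegral do rewrite -dotvZl.
rewrite gaussian_cos; congr (expR (- _) * _); rewrite mulrA; congr (_ / _).
rewrite /quad_form mulr_sumr; apply: eq_bigr => i _; rewrite mulr_sumr.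
by apply: eq_bigr => j _; rewrite !mxE; ring.
Qed.

Lemma measurable_tp_eval l (s : seq 'I_d) (Z : 'I_d -> Omega -> R) x (c : R) :
  (forall i, measurable_fun setT (Z i)) ->
  measurable_fun setT (fun w => tp_eval l s (x + c *: rv_vec Z w)).
Proof.
move=> mZ; rewrite /tp_eval; apply: measurable_sum => e.
apply: measurable_funM; first exact: measurable_cst.
have mcos : measurable_fun [set: R] (@cos R).
  by apply: continuous_measurable_fun; exact: continuous_cos.
apply: (measurableT_comp mcos).
apply: measurable_funD => //; apply: measurable_funD => //.
under eq_fun do rewrite dotvDr dotvZr.
apply: measurable_funD => //; apply: measurable_funM => //.
apply: measurable_sum => i; apply: measurable_funM => //.
by under eq_fun do rewrite mxE; exact: mZ.
Qed.

Lemma tp_eval_bounded l (s : seq 'I_d) : exists K : R, forall x, `|tp_eval l s x| <= K.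
Proof.
elim: l => [|e l [K hK]].
  by exists 0 => x; rewrite /tp_eval big_nil normr0.
exists (`|e.1.1 * \prod_(i <- s) e.1.2 0 i| + K) => x.
rewrite /tp_eval big_cons; apply: (le_trans (ler_normD _ _)); apply: lerD; last exact: hK.
rewrite normrM -[leRHS]mulr1; apply: ler_wpM2l => //; exact: cos_max.
Qed.

Lemma heat_tp_eval l s (tau : R) x : 0 <= tau <= 1 ->
  tp_eval (heat_tp Sigma l tau) s x
  = \int[P]_w tp_eval l s (x + Num.sqrt (1 - tau ^+ 2) *: rv_vec N w).
Proof.
move=> /andP[t0 t1]; set c := Num.sqrt _.
have c2 : c ^+ 2 = 1 - tau ^+ 2 by rewrite sqr_sqrtr// subr_ge0 expr_le1.
have mN i : measurable_fun setT (N i : Omega -> R) by exact: measurable_funPT.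
have intc (e : R * 'rV[R]_d * R) : P.-integrable setT (EFin \o (fun w =>
    e.1.1 * \prod_(i <- s) e.1.2 0 i
    * cos (dotv e.1.2 (x + c *: rv_vec N w) + e.2 + (size s)%:R * (pi / 2)))).
  have [K hK] := tp_eval_bounded [:: e] s.
  apply: (@integrable_bounded_real _ K) => [|w].
    have := @measurable_tp_eval [:: e] s N x c mN.
    by under eq_fun do rewrite /tp_eval big_seq1.
  by have := hK (x + c *: rv_vec N w); rewrite /tp_eval big_seq1.
rewrite /tp_eval Rintegral_sum// /heat_tp big_map; apply: eq_bigr => e _ /=.
rewrite RintegralZl//; last first.
  apply: (@integrable_bounded_real _ 1) => [|w]; last exact: cos_max.
  have := @measurable_tp_eval [:: (1, e.1.2, e.2 + (size s)%:R * (pi / 2))] [::] N x c mN.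
  by under eq_fun do rewrite /tp_eval big_seq1 /= big_nil !mul1r mul0r addr0 addrA.
under eq_Rintegral do rewrite dotvDr dotvZr [dotv _ x + _]addrC -!addrA.
by rewrite gaussian_cos_scaled c2 addrA; ring.
Qed.

(** By [heat_tp_eval] the smoothed polynomial is an average of translates, and so is each of its
    derivatives; averaging preserves a uniform bound. *)
Lemma heat_tp_bound l s (tau K : R) : 0 <= tau <= 1 ->
  (forall x, `|tp_eval l s x| <= K) ->
  forall x, `|tp_eval (heat_tp Sigma l tau) s x| <= K.
Proof.
move=> tau01 hK x; rewrite heat_tp_eval//.
have mN i : measurable_fun setT (N i : Omega -> R) by exact: measurable_funPT.
have int : P.-integrable setT (EFin \o
    (fun w => tp_eval l s (x + Num.sqrt (1 - tau ^+ 2) *: rv_vec N w))).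
  by apply: (@integrable_bounded_real _ K) => [|w //]; exact: measurable_tp_eval.
have int0 : P.-integrable setT (EFin \o (fun _ : Omega => 0 : R)).
  exact: finite_measure_integrable_cst.
have := @Rintegral_sub_le _ (fun=> 0) K int int0.
by rewrite Rintegral_prob_cst subr0; apply => w; rewrite subr0.
Qed.

Lemma heat_tp0 l : tp_eval (heat_tp Sigma l 0) [::] 0 = \int[P]_w tp_eval l [::] (rv_vec N w).
Proof.
rewrite heat_tp_eval ?lexx ?ler01//; apply: eq_Rintegral => w _.
by rewrite expr0n subr0 sqrtr1 scale1r add0r.
Qed.

End gaussian_vectors.

(** * Approximation of test functions by trigonometric polynomials *)

Section partial_derivatives.
Local Open Scope classical_set_scope.
Context {R : realType} {d : nat}.
Implicit Types (T U G phi : 'rV[R]_d -> R) (x y : 'rV[R]_d) (i j : 'I_d).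
Local Notation e_ i := (basis_vector i : 'rV[R]_d).

(** Partial derivatives are read on the lines parallel to an axis, so that the rules of one-variable
    calculus apply directly. *)
Definition has_partial i T T' : Prop := forall x t,
  is_derive t (1 : R) (fun t : R => T (x + t *: e_ i)) (T' (x + t *: e_ i)).

Lemma has_partial_eq i T T' U' : has_partial i T T' ->
  (forall x, T' x = U' x) -> has_partial i T U'.
Proof. by move=> h e x t; rewrite -e. Qed.

Lemma has_partial_unique i T T' U' :
  has_partial i T T' -> has_partial i T U' -> T' =1 U'.
Proof.
move=> h1 h2 x; have := h1 x 0; have := h2 x 0.
rewrite scale0r addr0 => -[_ <-] [_ <-]//.
Qed.

Lemma has_partialD i T T' U U' : has_partial i T T' -> has_partial i U U' ->
  has_partial i (fun x => T x + U x) (fun x => T' x + U' x).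
Proof. by move=> h1 h2 x t; exact: is_deriveD. Qed.

Lemma has_partialM i T T' U U' : has_partial i T T' -> has_partial i U U' ->
  has_partial i (fun x => T x * U x) (fun x => T' x * U x + T x * U' x).
Proof.
move=> h1 h2 x t; have d1 := h1 x t; have d2 := h2 x t.
by apply: is_derive_eq; rewrite /GRing.scale /= addrC [_ * T' _]mulrC.
Qed.

Lemma has_partialZ i (c : R) T T' : has_partial i T T' ->
  has_partial i (fun x => c * T x) (fun x => c * T' x).
Proof. by move=> h x t; exact: is_deriveZ. Qed.

Lemma coord_line x (t : R) i j : (x + t *: e_ i) 0 j = x 0 j + t * (j == i)%:R.
Proof. by rewrite !mxE eqxx. Qed.

Lemma has_partial_cos i j (c b : R) :
  has_partial i (fun x => cos (c * x 0 j + b))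
    (fun x => c * (j == i)%:R * cos (c * x 0 j + (b + pi / 2))).
Proof.
move=> x t; under eq_fun do rewrite coord_line.
apply: is_derive_eq; rewrite coord_line addrA cosDpihalf /GRing.scale /=.
by set s := sin _; ring.
Qed.

Lemma derivable_line G x t i : derivable G (x + t *: e_ i) (e_ i) ->
  is_derive t (1 : R) (fun t : R => G (x + t *: e_ i)) ('D_(e_ i) G (x + t *: e_ i)).
Proof.
move=> dG.
have e : (fun h : R => h^-1 *: (G (x + (h *: (1 : R) + t) *: e_ i) - G (x + t *: e_ i)))
   = (fun h : R => h^-1 *: (G (h *: e_ i + (x + t *: e_ i)) - G (x + t *: e_ i))).
  apply/funext => h; congr (_ *: (G _ - _)).
  by rewrite (_ : h *: (1 : R) = h) ?scalerDl 1?addrCA//; exact: mulr1.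
apply: DeriveDef; first by rewrite /derivable e.
by rewrite /derive e.
Qed.

(** The derivatives are quantified existentially because those of a walk are obtained as formulas.
    [has_partial_unique] later identifies them with the explicit derivatives of a trigonometric
    polynomial. *)
Fixpoint bounded_partials (k : nat) (C : R) T : Prop :=
  (forall x, `|T x| <= C) /\
  if k is k'.+1 then forall i, exists2 T', has_partial i T T' & bounded_partials k' C T'
  else True.

Lemma bounded_partials0 k C T : bounded_partials k C T -> forall x, `|T x| <= C.
Proof. by case: k => [|k] []. Qed.

Lemma bounded_partials_pred k C T :
  bounded_partials k.+1 C T -> bounded_partials k C T.
Proof.
elim: k T => [|k IH] T [h1 h2]; first by split.
by split => // i; have [T' hT' /IH bT'] := h2 i; exists T'.
Qed.

Lemma bounded_partials_le k C C' T : C <= C' ->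
  bounded_partials k C T -> bounded_partials k C' T.
Proof.
move=> CC'; elim: k T => [|k IH] T [h1 h2]; split => //.
- by move=> x; exact: le_trans (h1 x) CC'.
- by move=> x; exact: le_trans (h1 x) CC'.
- by move=> i; have [T' hT' /IH bT'] := h2 i; exists T'.
Qed.

Lemma bounded_partialsD k C1 C2 T U : bounded_partials k C1 T ->
  bounded_partials k C2 U -> bounded_partials k (C1 + C2) (fun x => T x + U x).
Proof.
elim: k T U => [|k IH] T U [h1 h2] [h3 h4]; split => //.
- by move=> x; exact: le_trans (ler_normD _ _) (lerD (h1 x) (h3 x)).
- by move=> x; exact: le_trans (ler_normD _ _) (lerD (h1 x) (h3 x)).
- move=> i; have [T' hT' bT'] := h2 i; have [U' hU' bU'] := h4 i.
  by exists (fun x => T' x + U' x); [exact: has_partialD|exact: IH].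
Qed.

(** Leibniz: each of the k derivatives doubles the number of products. *)
Lemma bounded_partialsM k C1 C2 T U : bounded_partials k C1 T ->
  bounded_partials k C2 U ->
  bounded_partials k (2 ^+ k * (C1 * C2)) (fun x => T x * U x).
Proof.
elim: k T U => [|k IH] T U bT bU.
  split => // x; rewrite expr0 mul1r normrM.
  by apply: ler_pM => //; [exact: bounded_partials0 bT x|exact: bounded_partials0 bU x].
have C1_ge0 := le_trans (normr_ge0 _) (bounded_partials0 bT 0).
have C2_ge0 := le_trans (normr_ge0 _) (bounded_partials0 bU 0).
split=> [x|i].
  rewrite normrM -[leLHS]mul1r; apply: ler_pM => //.
    by rewrite exprn_ege1// ler1n.
  by apply: ler_pM => //; [exact: bounded_partials0 bT x|exact: bounded_partials0 bU x].
have [_ /(_ i)[T' hT' bT']] := bT; have [_ /(_ i)[U' hU' bU']] := bU.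
exists (fun x => T' x * U x + T x * U' x); first exact: has_partialM.
rewrite exprS -mulrA mulr2n mulrDl !mul1r.
by apply: bounded_partialsD; apply: IH => //; exact: bounded_partials_pred.
Qed.

Lemma bounded_partialsZ k C (c : R) T : `|c| <= 1 -> bounded_partials k C T ->
  bounded_partials k C (fun x => c * T x).
Proof.
move=> c1; elim: k T => [|k IH] T [h1 h2]; split => //.
- by move=> x; rewrite normrM -[leRHS]mul1r; apply: ler_pM.
- by move=> x; rewrite normrM -[leRHS]mul1r; apply: ler_pM.
- move=> i; have [T' hT' bT'] := h2 i.
  by exists (fun x => c * T' x); [exact: has_partialZ|exact: IH].
Qed.

Lemma bounded_partials_cos k j (c b : R) : `|c| <= 1 ->
  bounded_partials k 1 (fun x => cos (c * x 0 j + b)).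
Proof.
move=> c1; elim: k b => [|k IH] b; first by split => // x; exact: cos_max.
split=> [x|i]; first exact: cos_max.
eexists; first exact: has_partial_cos.
apply: bounded_partialsZ; last exact: IH.
rewrite normrM -[leRHS]mul1r; apply: ler_pM => //.
by rewrite normr_nat lern1; case: eqP.
Qed.

Fixpoint smooth_unit (k : nat) G : Prop :=
  (forall x, `|G x| <= 1) /\
  if k is k'.+1 then (forall x i, derivable G x (e_ i)) /\
    forall i, smooth_unit k' ('D_(e_ i) G) else True.

Lemma smooth_unit0 k G : smooth_unit k G -> forall x, `|G x| <= 1.
Proof. by case: k => [|k] []. Qed.

Definition centred_difference (delta : R) i G y : R :=
  (2 * delta)^-1 * (G (y + delta *: e_ i) - G (y - delta *: e_ i)).

Lemma centred_difference_le1 delta i G : 0 < delta ->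
  (forall x, derivable G x (e_ i)) -> (forall x, `|'D_(e_ i) G x| <= 1) ->
  forall y, `|centred_difference delta i G y| <= 1.
Proof.
move=> d0 dG G1 y; rewrite /centred_difference.
have d2 : 0 < 2 * delta by rewrite mulr_gt0.
rewrite normrM ger0_norm; last by rewrite invr_ge0 ltW.
rewrite mulrC ler_pdivrMr// mul1r.
have := @mvt_norm_le R (fun t : R => G (y + t *: e_ i))
  (fun t => 'D_(e_ i) G (y + t *: e_ i)) 1 (- delta) delta.
rewrite scaleNr mul1r opprK (_ : delta + delta = 2 * delta); last by ring.
apply => [|t|t _]; [by lra|exact: derivable_line|exact: G1].
Qed.

Lemma derive_centred_difference delta i j G :
  (forall x, derivable G x (e_ j)) ->
  (forall x, derivable (centred_difference delta i G) x (e_ j)) /\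
  'D_(e_ j) (centred_difference delta i G)
    = centred_difference delta i ('D_(e_ j) G).
Proof.
move=> dG.
have shift (c : 'rV[R]_d) x : is_derive x (e_ j) (fun y => G (y + c)) ('D_(e_ j) G (x + c)).
  have e : (fun h : R => h^-1 *: (G (h *: e_ j + x + c) - G (x + c)))
     = (fun h : R => h^-1 *: (G (h *: e_ j + (x + c)) - G (x + c))).
    by apply/funext => h; rewrite addrA.
  apply: DeriveDef; first by rewrite /derivable e; exact: dG.
  by rewrite /derive e.
have main x : is_derive x (e_ j) (centred_difference delta i G)
    (centred_difference delta i ('D_(e_ j) G) x).
  exact: is_deriveZ.
split=> [x|]; first exact: ex_derive.
by apply/funext => x; rewrite derive_val.
Qed.

(** Centred differences commute with partial derivatives, and by the mean value theorem they obey
    the bounds of one derivative. One order of smoothness of [G] is thus exchanged for the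
    difference, uniformly in [delta]. *)
Lemma smooth_unit_difference k delta i G : 0 < delta ->
  (forall x j, derivable G x (e_ j)) -> (forall j, smooth_unit k ('D_(e_ j) G)) ->
  smooth_unit k (centred_difference delta i G).
Proof.
move=> d0; elim: k G => [|k IH] G dG sG.
  split => //; apply: centred_difference_le1 => // x; exact: smooth_unit0 (sG i) x.
split.
  apply: centred_difference_le1 => // x; exact: smooth_unit0 (sG i) x.
split=> [x j|j].
  by have [+ _] := @derive_centred_difference delta i j G (fun x => dG x j); apply.
have [_ ->] := @derive_centred_difference delta i j G (fun x => dG x j).
apply: IH => [x j'|j'].
  by have [_ [+ _]] := sG j; apply.
by have [_ [_ +]] := sG j; apply.
Qed.

End partial_derivatives.

(** * The random walk and its derivatives in the parameter x *)

Section random_walk.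
Local Open Scope classical_set_scope.
Context {R : realType} {d : nat}.
Implicit Types (T U G phi : 'rV[R]_d -> R) (x y : 'rV[R]_d) (i j : 'I_d) (w : seq 'I_d).
Local Notation e_ i := (basis_vector i : 'rV[R]_d).
Variables (delta lam : R).

(* Expectation of phi at the end point of a walk started at y whose steps are
   +/- delta along the coordinates listed in w, a step along i having mean
   delta * sin (lam * x_i).  It is a trigonometric polynomial in x. *)
Fixpoint walk w phi y x : R :=
  if w is i :: w' then
    (1 + sin (lam * x 0 i)) / 2 * walk w' phi (y + delta *: e_ i) x
    + (1 - sin (lam * x 0 i)) / 2 * walk w' phi (y - delta *: e_ i) x
  else phi y.

Let prob_ge0 (t : R) : 0 <= (1 + sin t) / 2 /\ 0 <= (1 - sin t) / 2.
Proof. by have := sin_max t; rewrite ler_norml => /andP[]; split; lra. Qed.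

Lemma walk_norm_sub_le w phi psi (c : R) y x : (forall u, `|phi u - c| <= psi u) ->
  `|walk w phi y x - c| <= walk w psi y x.
Proof.
move=> h; elim: w y => [|i w IH] y //=.
have [p0 q0] := prob_ge0 (lam * x 0 i).
have h1 := ler_wpM2l p0 (IH (y + delta *: e_ i)).
have h2 := ler_wpM2l q0 (IH (y - delta *: e_ i)).
rewrite [X in `|X|](_ : _ = (1 + sin (lam * x 0 i)) / 2 * (walk w phi (y + delta *: e_ i) x - c)
   + (1 - sin (lam * x 0 i)) / 2 * (walk w phi (y - delta *: e_ i) x - c)); last by field.
apply: (le_trans (ler_normD _ _)); apply: lerD; by rewrite normrM [`|_ / 2|]ger0_norm.
Qed.

Lemma walk_cst w (c : R) y x : walk w (fun=> c) y x = c.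
Proof. by elim: w y => //= i w IH y; rewrite !IH; field. Qed.

Lemma walk_le1 w phi y x : (forall u, `|phi u| <= 1) -> `|walk w phi y x| <= 1.
Proof.
move=> h; rewrite -[X in `|X|]subr0 -[leRHS](walk_cst w 1 y x).
by apply: walk_norm_sub_le => u; rewrite subr0.
Qed.

Lemma walk_swap i j w phi y x :
  walk (i :: j :: w) phi y x = walk (j :: i :: w) phi y x.
Proof.
rewrite /= -!addrA [delta *: e_ j + delta *: e_ i]addrC.
rewrite [- (delta *: e_ j) + delta *: e_ i]addrC.
rewrite [- (delta *: e_ i) + delta *: e_ j]addrC.
rewrite [- (delta *: e_ i) - _]addrC.
by ring.
Qed.

(** Steps commute, so that one along [i] may be taken first. *)
Lemma walk_rem i w phi y x : i \in w -> walk (i :: rem i w) phi y x = walk w phi y x.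
Proof.
elim: w y => [//|j w IH] y; rewrite inE [rem i _]/=; case: (eqVneq j i) => [->//|ji].
rewrite orFb => iw; rewrite walk_swap.
transitivity ((1 + sin (lam * x 0 j)) / 2 * walk (i :: rem i w) phi (y + delta *: e_ j) x
  + (1 - sin (lam * x 0 j)) / 2 * walk (i :: rem i w) phi (y - delta *: e_ j) x); first by [].
by rewrite !IH.
Qed.

Lemma walk_difference w i phi y x : delta != 0 ->
  walk w (centred_difference delta i phi) y x
  = (2 * delta)^-1 * (walk w phi (y + delta *: e_ i) x - walk w phi (y - delta *: e_ i) x).
Proof.
move=> d0; elim: w y => [//|j w IH] y /=; rewrite !IH.
by rewrite -!addrA [delta *: e_ j + _]addrC [- (delta *: e_ j) + _]addrC
  [delta *: e_ j - _]addrC [- (delta *: e_ j) - _]addrC; ring.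
Qed.

Lemma sinE (t : R) : sin t = - cos (t + pi / 2).
Proof. by rewrite cosDpihalf opprK. Qed.

Lemma has_partial_sin i j (c : R) :
  has_partial i (fun x : 'rV[R]_d => sin (c * x 0 j))
    (fun x => c * (j == i)%:R * cos (c * x 0 j + 0)).
Proof.
move=> x t; under eq_fun do rewrite coord_line.
apply: is_derive_eq; rewrite coord_line addr0 /GRing.scale /=.
by set s := cos _; ring.
Qed.

(** Differentiating the two probabilities of one step along [i] gives opposite factors of size lam
    cos / 2, hence delta lam cos times a centred difference of [phi] at the end of the remaining
    walk. Since steps commute, all steps along [i] contribute the same amount. *)
Lemma has_partial_walk i w phi y : delta != 0 -> has_partial i (walk w phi y)
  (fun x => (count_mem i w)%:R * delta * lam * (cos (lam * x 0 i + 0)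
      * walk (rem i w) (centred_difference delta i phi) y x)).
Proof.
move=> d0; elim: w y => [|j w IH] y.
  move=> x t; rewrite /= !mul0r.
  exact: is_derive_cst.
have hp : has_partial i (fun x : 'rV[R]_d => (1 + sin (lam * x 0 j)) / 2)
    (fun x => 2^-1 * (lam * (j == i)%:R * cos (lam * x 0 j + 0))).
  move=> x t; have h := has_partial_sin i j lam x t.
  by apply: is_derive_eq; rewrite /GRing.scale /=; ring.
have hq : has_partial i (fun x : 'rV[R]_d => (1 - sin (lam * x 0 j)) / 2)
    (fun x => - (2^-1 * (lam * (j == i)%:R * cos (lam * x 0 j + 0)))).
  move=> x t; have h := has_partial_sin i j lam x t.
  by apply: is_derive_eq; rewrite /GRing.scale /=; ring.
have := has_partialD (has_partialM hp (IH (y + delta *: e_ j)))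
  (has_partialM hq (IH (y - delta *: e_ j))).
move=> h; apply: (has_partial_eq h) => x.
have [ji|ji] := eqVneq j i; last first.
  rewrite /= (negPf ji) mulr0 mul0r mulr0 oppr0 !mul0r !add0r /=.
  by set c := cos _; ring.
rewrite ji /= eqxx mulr1 addrACA.
rewrite [X in X + _ = _](_ : _ = 2^-1 * (lam * cos (lam * x 0 i + 0)) *
  (2 * delta * ((2 * delta)^-1 * (walk w phi (y + delta *: e_ i) x
           - walk w phi (y - delta *: e_ i) x)))); last first.
  by set c := cos _; field; exact: d0.
rewrite -walk_difference//.
have [iw|iw] := boolP (i \in w).
  rewrite -(walk_rem _ _ _ iw) /= natrD.
  set c := cos _; set A := walk _ _ _ _; set B := walk _ _ _ _; set q := (count_mem i w)%:R.
  have -> : (true : nat)%:R = 1 :> R by [].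
  by field.
rewrite natrD (count_memPn iw) !mul0r !mulr0 !addr0; set c := cos _.
by have -> : (true : nat)%:R = 1 :> R by []; field.
Qed.

(** In [bounded_partials_walk], passing from order k to k + 1 multiplies a walk by a cosine, which
    costs 2^k by Leibniz, and k + k^2 <= (k + 1)^2. *)
Definition walk_constant (k : nat) : R := 2 ^+ (k * k).

Lemma bounded_partials_walk k w phi y : 0 < delta -> 0 <= lam <= 1 ->
  (forall i, (count_mem i w)%:R * delta * lam <= 1) -> smooth_unit k phi ->
  bounded_partials k (walk_constant k) (walk w phi y).
Proof.
move=> d0 /andP[lam0 lam1]; elim: k w phi y => [|k IH] w phi y wle sphi.
  split => // x; rewrite /walk_constant mul0n expr0.
  exact/walk_le1/(smooth_unit0 sphi).
split=> [x|i].
  apply: (@le_trans _ _ 1); first exact/walk_le1/(smooth_unit0 sphi).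
  by rewrite exprn_ege1// ler1n.
eexists; first by apply: has_partial_walk; rewrite gt_eqF.
apply: bounded_partialsZ.
  by rewrite ger0_norm// !mulr_ge0// ltW.
have rle j : (count_mem j (rem i w))%:R * delta * lam <= 1.
  apply: le_trans (wle j); apply: ler_wpM2r => //; apply: ler_wpM2r; first exact: ltW.
  by rewrite ler_nat; apply: leq_count_subseq; exact: rem_subseq.
have sdiff : smooth_unit k (centred_difference delta i phi).
  by case: sphi => _ [dphi sphi]; exact: smooth_unit_difference.
have lam_norm : `|lam| <= 1 by rewrite ger0_norm.
have := bounded_partialsM (bounded_partials_cos k i 0 lam_norm) (IH _ _ y rle sdiff).
apply: bounded_partials_le; rewrite mul1r -exprD ler_eXn2l ?ltr1n//.
by rewrite mulSn mulnS leq_addl.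
Qed.

Lemma walk_sum_sqr w (kap eta : R) (c : 'I_d -> R) y x :
  walk w (fun u => \sum_i (kap * (u 0 i - c i) ^+ 2 + eta)) y x
  = \sum_i (kap * ((y 0 i + (count_mem i w)%:R * delta * sin (lam * x 0 i) - c i) ^+ 2
      + (count_mem i w)%:R * delta ^+ 2 * (1 - sin (lam * x 0 i) ^+ 2)) + eta).
Proof.
elim: w y => [|j w IH] y.
  by apply: eq_bigr => i _; rewrite /= !mul0r !addr0.
rewrite /= !IH !mulr_sumr -big_split; apply: eq_bigr => i _ /=.
rewrite !mxE eqxx /= (eq_sym i j); have [<-|_] := eqVneq j i.
  rewrite natrD; set s := sin _.
  by have -> : (true : nat)%:R = 1 :> R by []; field.
by rewrite add0n /= mulr0 subr0 addr0; field.
Qed.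

(** The elementary bound |v| <= kap v^2 + 1/kap replaces the distance to [z] by a second moment,
    which [walk_sum_sqr] computes exactly as squared bias plus variance. *)
Lemma walk_approx w G y x (kap : R) (z : 'rV[R]_d) : 0 < kap ->
  (forall a b : 'rV[R]_d, `|G a - G b| <= \sum_i `|a 0 i - b 0 i|) ->
  `|walk w G y x - G z| <= \sum_i (kap * ((y 0 i + (count_mem i w)%:R * delta
       * sin (lam * x 0 i) - z 0 i) ^+ 2
      + (count_mem i w)%:R * delta ^+ 2 * (1 - sin (lam * x 0 i) ^+ 2)) + kap^-1).
Proof.
move=> k0 G1; rewrite -(walk_sum_sqr w kap kap^-1 (fun i => z 0 i)).
apply: walk_norm_sub_le => u; apply: (le_trans (G1 u z)); apply: ler_sum => i _.
rewrite -[(_ - _) ^+ 2]real_normK ?num_real//; set v := `|_|.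
rewrite -(ler_pM2r k0) mulrDl mulVf ?gt_eqF//.
by have := sqr_ge0 (v * kap - 1); nra.
Qed.

End random_walk.

Section trig_poly_closure.
Local Open Scope classical_set_scope.
Context {R : realType} {d : nat}.
Implicit Types (T U : 'rV[R]_d -> R) (x : 'rV[R]_d).

Definition is_trig_poly T : Prop :=
  exists l : seq (R * 'rV[R]_d * R), forall x, T x = tp_eval l [::] x.

Lemma tp_eval_nil_cat (l l' : seq (R * 'rV[R]_d * R)) s x :
  tp_eval (l ++ l') s x = tp_eval l s x + tp_eval l' s x.
Proof. by rewrite /tp_eval big_cat. Qed.

Lemma is_trig_polyD T U : is_trig_poly T -> is_trig_poly U ->
  is_trig_poly (fun x => T x + U x).
Proof.
by move=> [l hl] [l' hl']; exists (l ++ l') => x; rewrite tp_eval_nil_cat hl hl'.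
Qed.

Lemma is_trig_polyZ (c : R) T : is_trig_poly T -> is_trig_poly (fun x => c * T x).
Proof.
move=> [l hl]; exists [seq (c * e.1.1, e.1.2, e.2) | e <- l] => x.
rewrite hl /tp_eval big_map mulr_sumr; apply: eq_bigr => e _ /=.
by rewrite !mulrA.
Qed.

Lemma is_trig_poly_cst (c : R) : is_trig_poly (fun=> c).
Proof.
exists [:: (c, 0, 0)] => x; rewrite /tp_eval big_seq1 /= big_nil mulr1 mul0r !addr0.
rewrite (_ : dotv 0 x = 0) ?cos0 ?mulr1//.
by rewrite /dotv big1// => i _; rewrite mxE mul0r.
Qed.

Lemma is_trig_polyMcos (a : 'rV[R]_d) (b : R) T : is_trig_poly T ->
  is_trig_poly (fun x => cos (dotv a x + b) * T x).
Proof.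
move=> [l hl].
exists ([seq (e.1.1 / 2, e.1.2 + a, e.2 + b) | e <- l]
     ++ [seq (e.1.1 / 2, e.1.2 - a, e.2 - b) | e <- l]) => x.
rewrite tp_eval_nil_cat hl /tp_eval !big_map mulr_sumr -big_split.
apply: eq_bigr => e _ /=; rewrite !big_nil !mulr1 !mul0r !addr0 !dotvDl.
rewrite -scaleN1r dotvZl mulN1r.
rewrite (_ : _ + _ + (e.2 + b) = (dotv e.1.2 x + e.2) + (dotv a x + b)); last by ring.
rewrite (_ : _ + _ + (e.2 - b) = (dotv e.1.2 x + e.2) - (dotv a x + b)); last by ring.
set A := dotv e.1.2 _ + _; set B := dotv a x + b.
by rewrite cosB cosD; field.
Qed.

Lemma is_trig_poly_walk delta lam w (phi : 'rV[R]_d -> R) y :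
  is_trig_poly (walk delta lam w phi y).
Proof.
elim: w y => [|i w IH] y; first exact: is_trig_poly_cst.
have tsin (z : 'rV[R]_d) : is_trig_poly (fun x => sin (lam * x 0 i) * walk delta lam w phi z x).
  have [l hl] := is_trig_polyZ (-1) (is_trig_polyMcos (lam *: basis_vector i) (pi / 2) (IH z)).
  exists l => x; rewrite -hl dotvZl dotv_delta sinE; ring.
have [l1 h1] := is_trig_polyZ (2^-1) (is_trig_polyD (IH (y + delta *: basis_vector i))
  (tsin (y + delta *: basis_vector i))).
have [l2 h2] := is_trig_polyZ (2^-1) (is_trig_polyD (IH (y - delta *: basis_vector i))
  (is_trig_polyZ (-1) (tsin (y - delta *: basis_vector i)))).
exists (l1 ++ l2) => x; rewrite tp_eval_nil_cat -h1 -h2 /=; ring.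
Qed.

Lemma has_partial_tp_eval i (l : seq (R * 'rV[R]_d * R)) s :
  has_partial i (tp_eval l s) (tp_eval l (i :: s)).
Proof.
move=> x t; have h := is_derive_tp_eval l s x (basis_vector i) t.
apply: is_derive_eq; rewrite (bigD1 i) //= mxE !eqxx mul1r big1 ?addr0// => j ji.
by rewrite mxE (negPf ji) andbF mul0r.
Qed.

(** The head of a list is the derivative taken last, so that [bounded_partials] must be unfolded
    from the end of [s']; hence the induction by [last_ind]. *)
Lemma tp_eval_bounded_partials k (C : R) (l : seq (R * 'rV[R]_d * R)) s T :
  bounded_partials k C T -> (forall x, T x = tp_eval l s x) ->
  forall s' x, (size s' <= k)%N -> `|tp_eval l (s' ++ s) x| <= C.
Proof.
move=> + + s'; elim/last_ind: s' k s T => [|s' i IH] k s T bT hT x sk.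
  by rewrite cat0s -hT; exact: bounded_partials0 bT x.
rewrite cat_rcons; case: k bT sk => [|k] bT; rewrite size_rcons// ltnS => sk.
have [_ /(_ i)[T' hT' bT']] := bT.
apply: (IH k (i :: s) T') => // z.
apply: (has_partial_unique hT').
by move=> u t; have := has_partial_tp_eval i l s u t; rewrite (_ : tp_eval l s = T)//; exact/funext.
Qed.

End trig_poly_closure.

(** * Approximation of a test function with control of derivatives *)

Section test_functions.
Local Open Scope classical_set_scope.
Context {R : realType} {d : nat}.
Variable g : 'rV[R]_d -> R.
Hypothesis tg : d4_test_functions g.
Local Notation e_ i := (basis_vector i : 'rV[R]_d).

Lemma test_function_partial_le1 (s : seq 'I_d) x : (1 <= size s <= 4)%N ->
  `|partial_derivative s g x| <= 1.
Proof.
move=> s14; have [_ /(_ _ s14)] := tg; rewrite /Mk => h.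
have := le_trans (le_bigmax _ (fun s0 : (size s).-tuple 'I_d =>
   ereal_sup [set (`|partial_derivative s0 g x|)%:E | x in [set: 'rV[R]_d]]) (in_tuple s)) h.
move=> {}h; rewrite -lee_fin; apply: le_trans h.
by apply: ereal_sup_ubound; exists x.
Qed.

Lemma test_function_smooth k (s : seq 'I_d) : (0 < size s)%N ->
  (size s + k <= 4)%N -> smooth_unit k (partial_derivative s g).
Proof.
elim: k s => [|k IH] s s0 sk.
  by split => // x; apply: test_function_partial_le1; rewrite s0 -(addn0 (size s)).
split=> [x|].
  by apply: test_function_partial_le1; rewrite s0 (leq_trans (leq_addr _ _) sk).
split=> [x i|i]; last by apply: (IH (i :: s)) => //=; rewrite addSnnS.
have [[dg _] _] := tg; apply: dg.
by rewrite (leq_trans _ sk)// -addSnnS leq_addr.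
Qed.

Lemma test_function_derivable x i : derivable g x (e_ i).
Proof. by have [[dg _] _] := tg; exact: (dg [::]). Qed.

(** The coordinates of [b] are replaced by those of [a] one at a time; each replacement moves along
    one axis, where the derivative is at most 1 in absolute value. *)
Lemma test_function_lipschitz (a b : 'rV[R]_d) :
  `|g a - g b| <= \sum_i `|a 0 i - b 0 i|.
Proof.
pose upd (s : seq 'I_d) : 'rV[R]_d := \row_j (if j \in s then a 0 j else b 0 j).
suff main (s : seq 'I_d) : uniq s ->
    `|g (upd s) - g b| <= \sum_(i <- s) `|a 0 i - b 0 i|.
  have -> : a = upd (enum 'I_d) by apply/rowP => j; rewrite mxE mem_enum.
  have := main (enum 'I_d) (enum_uniq _); rewrite big_enum /=.
  rewrite [X in _ -> _ <= X](eq_bigr (fun i => `|a 0 i - b 0 i|))// => i _.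
  by rewrite mxE mem_enum.
elim: s => [_|i s IH /= /andP[is_ us]].
  rewrite big_nil (_ : upd [::] = b) ?subrr ?normr0//.
  by apply/rowP => j; rewrite mxE.
rewrite big_cons; apply: le_trans (lerD _ (IH us)).
  exact: ler_distD.
have -> : upd (i :: s) = upd s + (a 0 i - b 0 i) *: e_ i.
  apply/rowP => j; rewrite coord_line !mxE inE; have [->|ji] := eqVneq j i.
    by rewrite (negPf is_) mulr1 addrC subrK.
  by rewrite /= mulr0 addr0.
set t := a 0 i - b 0 i.
have dG x u : is_derive u (1 : R) (fun t : R => g (x + t *: e_ i)) ('D_(e_ i) g (x + u *: e_ i)).
  by apply: derivable_line; exact: test_function_derivable.
have D1 x : `|'D_(e_ i) g x| <= 1 by exact: (test_function_partial_le1 (s := [:: i])).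
have [t0|t0] := leP 0 t.
  have := mvt_norm_le t0 (dG (upd s)) (fun u _ => D1 _).
  by rewrite scale0r addr0 subr0 mul1r [`|t|]ger0_norm//; apply.
have := mvt_norm_le (ltW t0) (dG (upd s)) (fun u _ => D1 _).
by rewrite scale0r addr0 sub0r mul1r [`|t|]ltr0_norm// distrC; apply.
Qed.

Lemma sin_sub_le (u : R) : `|sin u - u| <= u ^+ 2.
Proof.
have dcos (t : R) : is_derive t (1 : R) cos (- sin t) by exact: is_derive_cos.
have cos1 (v : R) : 0 <= v -> `|cos v - 1| <= v.
  move=> v0; have := mvt_norm_le v0 dcos (K := 1).
  rewrite cos0 mul1r subr0; apply => t _; rewrite normrN; exact: sin_max.
have main (v : R) : 0 <= v -> `|sin v - v| <= v ^+ 2.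
  move=> v0; have dsin (t : R) : is_derive t (1 : R) (fun t => sin t - t) (cos t - 1).
    exact: is_deriveB.
  have := mvt_norm_le v0 dsin (K := v).
  rewrite sin0 !subr0 -expr2; apply => t /andP[t0 tv].
  exact: le_trans (cos1 t t0) tv.
have [/main//|/ltW u0] := leP 0 u.
have := main (- u); rewrite sinN sqrrN oppr_ge0 => /(_ u0).
by rewrite (_ : - sin u - - u = - (sin u - u)) ?normrN//; ring.
Qed.

(** A test function may be unbounded, so [bounded_partials_walk] applies only after one
    differentiation by [has_partial_walk]. Three derivatives then remain, and 2^3 is the cost of the
    cosine in that formula. *)
Definition approx_constant : R := 2 ^+ 3 * walk_constant 3.

Lemma test_function_approx (n : nat) : (0 < n)%N ->
  exists l : seq (R * 'rV[R]_d * R),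
  (forall (s : seq 'I_d) x, (1 <= size s <= 4)%N -> `|tp_eval l s x| <= approx_constant) /\
  forall x, `|tp_eval l [::] x - g x|
     <= (2 * d%:R + \sum_i x 0 i ^+ 2) * n%:R^-1.
Proof.
move=> n0; have n0R : 0 < n%:R :> R by rewrite ltr0n.
have nn0 : n%:R != 0 :> R by rewrite gt_eqF.
have n1R : 1 <= n%:R :> R by rewrite ler1n.
(* With n^4 steps along each axis, (number of steps) * delta * lam = 1 keeps the derivatives
   bounded, the mean end point is n sin(x_i / n), and the variance per coordinate is at most n^4
   delta^2 = n^-2. With kap = n the walk error is at most 2/n per coordinate. *)
pose delta : R := n%:R ^- 3; pose lam : R := n%:R^-1.
pose w := flatten [seq nseq (n ^ 4) i | i <- enum 'I_d].
have cw i : count_mem i w = (n ^ 4)%N.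
  rewrite /w count_flatten -map_comp sumnE big_map big_enum /= (bigD1 i) //=.
  rewrite count_nseq /= eqxx mul1n big1 ?addn0// => j ji.
  by rewrite count_nseq /= (negPf ji).
have d0 : 0 < delta by rewrite invr_gt0 exprn_gt0.
have lam01 : 0 <= lam <= 1 by rewrite invr_ge0 ler0n /= invf_le1.
have wd i : (count_mem i w)%:R * delta * lam = 1.
  by rewrite cw natrX /delta /lam; field.
have [l hl] := is_trig_poly_walk delta lam w g 0.
exists l; split=> [s x s14|x].
  case/lastP: s s14 => [//|s i]; rewrite size_rcons /= ltnS => s3.
  have wle j : (count_mem j w)%:R * delta * lam <= 1 by rewrite wd.
  have dn0 : delta != 0 by rewrite gt_eqF.
  have hp := has_partial_walk lam i w g 0 dn0.
  have rle j : (count_mem j (rem i w))%:R * delta * lam <= 1.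
    case/andP: lam01 => lam0 _.
    apply: le_trans (wle j); apply: ler_wpM2r => //; apply: ler_wpM2r; first exact: ltW.
    by rewrite ler_nat; apply: leq_count_subseq; exact: rem_subseq.
  have sdiff : smooth_unit 3 (centred_difference delta i g).
    apply: smooth_unit_difference => // [y j|j]; first exact: test_function_derivable.
    exact: (test_function_smooth (s := [:: j])).
  have lam_norm : `|lam| <= 1 by case/andP: lam01 => ? ?; rewrite ger0_norm.
  have bp := bounded_partialsM (bounded_partials_cos 3 i 0 lam_norm)
    (bounded_partials_walk 0 d0 lam01 rle sdiff).
  rewrite mul1r in bp.
  rewrite -cats1; apply: (tp_eval_bounded_partials (k := 3) bp) => [y|//].
  apply: etrans (has_partial_unique hp _ y); first by rewrite wd mul1r.
  move=> u t; have := has_partial_tp_eval i l [::] u t.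
  by rewrite (_ : tp_eval l [::] = walk delta lam w g 0)//; apply/funext => z; rewrite hl.
rewrite -hl.
(* [z] is the mean end point. Fluctuations around it give the term 2 d / n, and its distance to [x]
   gives the quadratic term, since n |sin u - u| <= n u^2 at u = x_i / n. *)
pose z : 'rV[R]_d := \row_i (n%:R * sin (lam * x 0 i)).
apply: (le_trans (ler_distD (g z) _ _)).
rewrite mulrDl; apply: lerD.
  apply: (le_trans (walk_approx delta lam w 0 x z n0R test_function_lipschitz)).
  rewrite [leRHS](_ : _ = \sum_(i < d) 2 * n%:R^-1); last first.
    by rewrite sumr_const card_ord -mulr_natr; ring.
  apply: ler_sum => i _.
  rewrite !mxE cw add0r natrX.
  rewrite (_ : n%:R ^+ 4 * delta * sin (lam * x 0 i) - _ = 0); last first.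
    by rewrite /delta; field.
  rewrite expr0n /= add0r.
  rewrite (_ : n%:R * _ = lam * (1 - sin (lam * x 0 i) ^+ 2)); last first.
    by rewrite /delta /lam; field.
  rewrite mulr2n mulrDl mul1r lerD2r -/lam.
  rewrite -[leRHS]mulr1; apply: ler_wpM2l; first by case/andP: lam01.
  by rewrite lerBlDr lerDl sqr_ge0.
apply: (le_trans (test_function_lipschitz _ _)); rewrite mulr_suml.
apply: ler_sum => i _; rewrite mxE.
rewrite (_ : _ - _ = n%:R * (sin (lam * x 0 i) - lam * x 0 i)); last first.
  by rewrite /lam; set s := sin _; field.
rewrite normrM ger0_norm//.
apply: le_trans (ler_wpM2l (ler0n _ _) (sin_sub_le _)) _.
by rewrite le_eqVlt /lam; apply/orP; left; apply/eqP; field.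
Qed.

Lemma tp_eval_lipschitz (l : seq (R * 'rV[R]_d * R)) (K : R) :
  (forall i x, `|tp_eval l [:: i] x| <= K) ->
  forall x y, `|tp_eval l [::] x - tp_eval l [::] y| <= K * \sum_i `|x 0 i - y 0 i|.
Proof.
move=> hK x y.
have dl := is_derive_tp_eval l [::] y (x - y).
have := mvt_norm_le ler01 dl (K := K * \sum_i `|x 0 i - y 0 i|).
rewrite scale0r addr0 scale1r [y + _]addrC subrK subr0 mulr1; apply => t _.
apply: (le_trans (ler_norm_sum _ _ _)); rewrite mulr_sumr; apply: ler_sum => i _.
by rewrite !mxE normrM mulrC; apply: ler_wpM2r.
Qed.

End test_functions.

(** * Contractions of infinite kernels *)

Section boxes.
Local Open Scope classical_set_scope.
Context {R : realType}.

(** The words of length [q] over the letters below [n]. With words in place of tuples, splitting a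
    sum into free and contracted variables is concatenation, without casts between tuple lengths. *)
Fixpoint box (q n : nat) : seq (seq nat) :=
  if q is q'.+1 then [seq k :: s | k <- iota 0 n, s <- box q' n] else [:: [::]].

Lemma mem_box q n s : (s \in box q n) = (size s == q) && all (fun k => k < n)%N s.
Proof.
elim: q s => [|q IH] [|k s] //=.
  by apply/allpairsP => -[[k s] []].
apply/allpairsP/idP => [[[k' s'] /= [+ + [-> ->]]]|].
  by rewrite mem_iota IH add0n leq0n /= => -> /andP[/eqP -> ->]; rewrite eqxx.
rewrite eqSS => /and3P[sq kn sn]; exists (k, s); split => //=.
  by rewrite mem_iota.
by rewrite IH sq.
Qed.

Lemma box_uniq q n : uniq (box q n).
Proof.
elim: q => //= q IH; apply: allpairs_uniq => //; first exact: iota_uniq.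
by move=> [k s] [k' s'] _ _ /= [-> ->].
Qed.

Lemma sum_box0 n (phi : seq nat -> R) : \sum_(s <- box 0 n) phi s = phi [::].
Proof. by rewrite big_seq1. Qed.

Lemma sum_box_cat p r n (phi : seq nat -> R) :
  \sum_(s <- box (p + r) n) phi s
  = \sum_(s1 <- box p n) \sum_(s2 <- box r n) phi (s1 ++ s2).
Proof.
elim: p phi => [|p IH] phi; first by rewrite big_seq1.
rewrite addSn /= !big_allpairs_dep; apply: eq_bigr => k _.
by rewrite IH.
Qed.

Lemma sum_box_le p n m (phi : seq nat -> R) : (n <= m)%N -> (forall s, 0 <= phi s) ->
  \sum_(s <- box p n) phi s <= \sum_(s <- box p m) phi s.
Proof.
move=> nm phi0; elim: p phi phi0 => [|p IH] phi phi0 /=; first by rewrite !big_seq1.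
rewrite !big_allpairs_dep.
rewrite -(subnKC nm) iotaD big_cat /= subnKC//.
apply: (@le_trans _ _ (\sum_(k <- iota 0 n) \sum_(s <- box p m) phi (k :: s))).
  by apply: ler_sum => k _; exact: IH.
by rewrite lerDl; apply: sumr_ge0 => k _; exact: sumr_ge0.
Qed.

Lemma as_tupleE q (s : seq nat) : size s = q -> as_tuple q s = s :> seq nat.
Proof.
move=> sq; apply: (@eq_from_nth _ 0%N); first by rewrite size_tuple.
move=> k; rewrite size_tuple => kq.
by rewrite -[k]/(nat_of_ord (Ordinal kq)) -tnth_nth tnth_mktuple.
Qed.

Lemma as_tuple_val q (t : q.-tuple nat) : as_tuple q t = t.
Proof. by apply: val_inj; rewrite /= as_tupleE ?size_tuple. Qed.

Variables (q : nat) (b : q.-tuple nat -> R).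
Hypothesis b0 : forall t, 0 <= b t.

Definition box_sum n : R := \sum_(s <- box q n) b (as_tuple q s).

Lemma box_sum_nondecreasing : nondecreasing_seq box_sum.
Proof. by move=> n m nm; exact: sum_box_le. Qed.

Let tbox n := [seq as_tuple q s | s <- box q n].

Let tbox_uniq n : uniq (tbox n).
Proof.
rewrite map_inj_in_uniq ?box_uniq// => s s'.
rewrite !mem_box => /andP[/eqP h _] /andP[/eqP h' _] /(congr1 val).
by rewrite /= !as_tupleE.
Qed.

Let mem_tbox n (t : q.-tuple nat) : (t \in tbox n) = all (fun k => k < n)%N t.
Proof.
apply/mapP/idP => [[s]|tn].
  by rewrite mem_box => /andP[/eqP sq sn] ->; rewrite as_tupleE.
by exists (tval t); rewrite ?as_tuple_val// mem_box size_tuple eqxx.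
Qed.

Lemma box_sum_le_esum n : ((box_sum n)%:E <= \esum_(t in [set: q.-tuple nat]) (b t)%:E)%E.
Proof.
apply: esum_ge; exists [set` tbox n].
  by split => //; exact: finite_seq.
rewrite -fsbig_seq ?tbox_uniq//=.
by rewrite big_map /box_sum sumEFin.
Qed.

Lemma esum_le_box_sum (M : R) : (forall n, box_sum n <= M) ->
  (\esum_(t in [set: q.-tuple nat]) (b t)%:E <= M%:E)%E.
Proof.
move=> bM; apply: ub_ereal_sup => _ [A [finA _] <-].
rewrite fsbig_finite//= sumEFin lee_fin.
pose L : seq (q.-tuple nat) := finmap.enum_fset (fset_set A).
rewrite -/L; have uL : uniq L by exact: finmap.fset_uniq.
pose n := (\max_(t <- L) \max_(k <- t) k).+1.
apply: le_trans (bM n).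
have -> : box_sum n = \sum_(t <- tbox n) b t by rewrite big_map.
have Asub : {subset L <= tbox n}.
  move=> t tA; rewrite mem_tbox; apply/allP => k kt; rewrite ltnS.
  apply: (leq_trans _ (leq_bigmax_seq _ tA _)) => //.
  exact: leq_bigmax_seq kt _.
rewrite [leRHS](bigID (fun t => t \in L)) /=.
rewrite -[X in _ <= X + _]big_filter.
have -> : \sum_(i <- [seq i <- tbox n | i \in L]) b i = \sum_(t <- L) b t.
  apply: perm_big; apply: uniq_perm; rewrite ?filter_uniq// => t.
  by rewrite mem_filter; case: (boolP (t \in L)) => //= /Asub.
by rewrite lerDl; exact: sumr_ge0.
Qed.

Lemma esum_box_cvg (M : R) : (forall n, box_sum n <= M) ->
  box_sum n @[n --> \oo] --> fine (\esum_(t in [set: q.-tuple nat]) (b t)%:E).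
Proof.
move=> bM; set E := esum _ _.
have cv : cvgn box_sum.
  apply: nondecreasing_is_cvgn; first exact: box_sum_nondecreasing.
  by exists M => _ [n _ <-].
have Efin : E \is a fin_num.
  rewrite ge0_fin_numE; last by apply: esum_ge0 => t _; rewrite lee_fin.
  by rewrite (le_lt_trans (esum_le_box_sum bM))// ltry.
suff -> : fine E = limn box_sum by [].
apply/eqP; rewrite eq_le; apply/andP; split.
  rewrite -lee_fin fineK//; apply: esum_le_box_sum => n.
  exact: nondecreasing_cvgn_le box_sum_nondecreasing cv n.
apply: limr_le => //; apply: nearW => n.
by rewrite -lee_fin fineK//; exact: box_sum_le_esum.
Qed.

Lemma box_sum_le_fine_esum n : (\esum_(t in [set: q.-tuple nat]) (b t)%:E < +oo)%E ->
  box_sum n <= fine (\esum_(t in [set: q.-tuple nat]) (b t)%:E).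
Proof.
move=> fin; rewrite -lee_fin fineK ?box_sum_le_esum// ge0_fin_numE//.
by apply: esum_ge0 => t _; rewrite lee_fin.
Qed.

End boxes.

(** * Truncated contractions and their convergence *)

Section contraction_limit.
Local Open Scope classical_set_scope.
Context {R : realType}.
Implicit Types (F G : seq nat -> R).

Lemma cvg_sum_seq (I : eqType) (r : seq I) (u : I -> R^nat) (l : I -> R) :
  (forall i, i \in r -> u i n @[n --> \oo] --> l i) ->
  \sum_(i <- r) u i n @[n --> \oo] --> \sum_(i <- r) l i.
Proof.
elim: r => [|i r IH] h.
  by rewrite big_nil; under eq_fun do rewrite big_nil; exact: cvg_cst.
rewrite big_cons; under eq_fun do rewrite big_cons.
apply: cvgD; first by apply: h; rewrite mem_head.
by apply: IH => j jr; apply: h; rewrite inE jr orbT.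
Qed.

Lemma minkowski_sum (I : Type) (r : seq I) (a b : I -> R) :
  Num.sqrt (\sum_(i <- r) a i ^+ 2)
  <= Num.sqrt (\sum_(i <- r) (a i - b i) ^+ 2) + Num.sqrt (\sum_(i <- r) b i ^+ 2).
Proof.
set D := \sum_(i <- r) (a i - b i) ^+ 2; set B := \sum_(i <- r) b i ^+ 2.
have D0 : 0 <= D by apply: sumr_ge0 => i _; exact: sqr_ge0.
have B0 : 0 <= B by apply: sumr_ge0 => i _; exact: sqr_ge0.
rewrite -[leRHS]ger0_norm ?addr_ge0 ?sqrtr_ge0// -sqrtr_sqr; apply: ler_wsqrtr.
rewrite sqrrD !sqr_sqrtr//.
have -> : \sum_(i <- r) a i ^+ 2 = D + (\sum_(i <- r) (a i - b i) * b i) *+ 2 + B.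
  rewrite -sumrMnl -!big_split; apply: eq_bigr => i _ /=.
  by rewrite -mulr_natr; ring.
rewrite lerD2r lerD2l lerMn2r /= -sqrtrM//.
apply: (le_trans (ler_norm _)); apply: ler_norm_sqrt_sqr.
exact: sum_cauchy_schwarz.
Qed.

Definition box_contraction n r F G (s1 s2 : seq nat) : R :=
  \sum_(a <- box r n) F (s1 ++ a) * G (s2 ++ a).

Definition box_contraction_norm2 n p q r F G : R :=
  \sum_(s1 <- box p n) \sum_(s2 <- box q n) box_contraction n r F G s1 s2 ^+ 2.

Definition box_norm2 n p F : R := \sum_(s <- box p n) F s ^+ 2.

Lemma box_norm2_ge0 n p F : 0 <= box_norm2 n p F.
Proof. by apply: sumr_ge0 => s _; exact: sqr_ge0. Qed.

Lemma sum_box_split r n m (phi : seq nat -> R) : (n <= m)%N ->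
  \sum_(a <- box r m) phi a = \sum_(a <- box r n) phi a
    + \sum_(a <- box r m | ~~ all (fun k => k < n)%N a) phi a.
Proof.
move=> nm; rewrite (bigID (fun a => all (fun k => k < n)%N a)) /=; congr (_ + _).
rewrite -big_filter; apply: perm_big; apply: uniq_perm; rewrite ?filter_uniq ?box_uniq// => s.
rewrite mem_filter !mem_box; case: (boolP (all _ s)) => [an|_]; last by rewrite andbF.
rewrite andbT /=; apply: andb_idr => _.
by apply/allP => k ks; apply: leq_trans nm; exact: (allP an).
Qed.

Lemma box_tail_le p r n m F : (n <= m)%N ->
  \sum_(s <- box p n) \sum_(a <- box r m | ~~ all (fun k => k < n)%N a) F (s ++ a) ^+ 2
  <= box_norm2 m (p + r) F - box_norm2 n (p + r) F.
Proof.
move=> nm; rewrite /box_norm2 !sum_box_cat.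
have F0 s : 0 <= \sum_(a <- box r m) F (s ++ a) ^+ 2.
  by apply: sumr_ge0 => a _; exact: sqr_ge0.
rewrite lerBrDr; apply: (le_trans _ (sum_box_le p nm F0)).
rewrite -big_split; apply: ler_sum => s _ /=.
by rewrite (sum_box_split r (fun a => F (s ++ a) ^+ 2) nm) addrC.
Qed.

(** Only words [a] that leave the smaller box survive in the difference. Cauchy-Schwarz then
    separates F and G, and each factor is part of the squared norm between the two boxes. *)
Lemma box_contraction_diff_le p q r n m F G : (n <= m)%N ->
  \sum_(s1 <- box p n) \sum_(s2 <- box q n)
     (box_contraction m r F G s1 s2 - box_contraction n r F G s1 s2) ^+ 2
  <= (box_norm2 m (p + r) F - box_norm2 n (p + r) F)
     * (box_norm2 m (q + r) G - box_norm2 n (q + r) G).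
Proof.
move=> nm; pose t (s : seq nat) H :=
  \sum_(a <- box r m | ~~ all (fun k => k < n)%N a) H (s ++ a) ^+ 2 : R.
have t0 s H : 0 <= t s H by apply: sumr_ge0 => a _; exact: sqr_ge0.
apply: (@le_trans _ _ ((\sum_(s1 <- box p n) t s1 F) * (\sum_(s2 <- box q n) t s2 G))).
  rewrite mulr_suml; apply: ler_sum => s1 _; rewrite mulr_sumr; apply: ler_sum => s2 _.
  rewrite /box_contraction (sum_box_split r (fun a => F (s1 ++ a) * G (s2 ++ a)) nm).
  by rewrite addrAC subrr add0r; exact: sum_cauchy_schwarz.
by apply: ler_pM; rewrite ?box_tail_le// sumr_ge0.
Qed.

Lemma box_contraction_norm2_le p q r n F G :
  box_contraction_norm2 n p q r F G <= box_norm2 n (p + r) F * box_norm2 n (q + r) G.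
Proof.
rewrite /box_norm2 !sum_box_cat mulr_suml; apply: ler_sum => s1 _.
by rewrite mulr_sumr; apply: ler_sum => s2 _; exact: sum_cauchy_schwarz.
Qed.

Lemma real_sum_box_cvg r (D : set (r.-tuple nat)) (u : r.-tuple nat -> R) (M : R) :
  (forall a, ~ D a -> u a = 0) ->
  (forall n, \sum_(s <- box r n) `|u (as_tuple r s)| <= M) ->
  \sum_(s <- box r n) u (as_tuple r s) @[n --> \oo] --> real_sum D u.
Proof.
move=> uD uM; rewrite /real_sum.
have posE (v : r.-tuple nat -> R) : (forall a, ~ D a -> v a = 0) ->
    (\esum_(t in D) (Num.max (v t) 0)%:E = \esum_(t in [set: r.-tuple nat]) (Num.max (v t) 0)%:E)%E.
  move=> vD; rewrite esum_mkcond; apply: eq_esum => t _; case: ifPn => //.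
  by rewrite notin_setE => /vD ->; rewrite maxxx.
have uDN a : ~ D a -> - u a = 0 by move=> /uD ->; rewrite oppr0.
rewrite (posE _ uD) (posE (fun a => - u a) uDN).
have bM (v : r.-tuple nat -> R) : (forall t, `|v t| = `|u t|) ->
    forall n, box_sum (fun t => Num.max (v t) 0) n <= M.
  move=> vu n; apply: le_trans (uM n); apply: ler_sum => s _.
  by rewrite -vu ge_max ler_norm normr_ge0.
have mx0 (v : r.-tuple nat -> R) t : 0 <= Num.max (v t) 0 by rewrite le_max lexx orbT.
have c1 := esum_box_cvg (mx0 u) (bM u (fun _ => erefl)).
have c2 := esum_box_cvg (mx0 (fun t => - u t)) (bM (fun t => - u t) (fun t => normrN (u t))).
rewrite [X in X @ _ --> _](_ : _ = (fun n => box_sum (fun t => Num.max (u t) 0) n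
   - box_sum (fun t => Num.max (- u t) 0) n)); first exact: cvgB.
apply/funext => n; rewrite /box_sum -sumrB; apply: eq_bigr => s _.
case/orP: (le_total 0 (u (as_tuple r s))) => h.
  by rewrite max_l// max_r ?oppr_le0// subr0.
by rewrite max_r// max_l ?oppr_ge0// sub0r opprK.
Qed.

Lemma square_summable_box p (f : p.-tuple nat -> R) : square_summable f ->
  box_norm2 n p (fun s => f (as_tuple p s)) @[n --> \oo] --> l2norm f ^+ 2 /\
  forall n, box_norm2 n p (fun s => f (as_tuple p s)) <= l2norm f ^+ 2.
Proof.
move=> sf; set E := (\esum_(t in [set: p.-tuple nat]) ((f t) ^+ 2)%:E)%E.
have f0 t : 0 <= f t ^+ 2 by exact: sqr_ge0.
have Efin : (E < +oo)%E.
  apply: le_lt_trans sf; apply: le_esum => t _; rewrite /= lee_fin; exact: ler_norm.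
have le n : box_sum (fun t => f t ^+ 2) n <= fine E by exact: box_sum_le_fine_esum.
have e : l2norm f ^+ 2 = fine E.
  by rewrite sqr_sqrtr// fine_ge0// esum_ge0// => t _; rewrite lee_fin.
by rewrite e; split => //; exact: (esum_box_cvg (b := fun t => f t ^+ 2) f0 le).
Qed.

End contraction_limit.

Section contraction_norm.
Local Open Scope classical_set_scope.
Context {R : realType}.
Variables (p q r : nat) (f : p.-tuple nat -> R) (g : q.-tuple nat -> R).
Hypothesis rp : (r <= p)%N.
Hypothesis rq : (r <= q)%N.
Hypothesis ff : ell02 f.
Hypothesis gg : ell02 g.
Let F s := f (as_tuple p s).
Let G s := g (as_tuple q s).

Let U (s1 s2 : seq nat) : R := real_sum [set a : r.-tuple nat | uniq a]
  (fun a => F (s1 ++ a) * G (s2 ++ a)).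

Let box_contraction_cvg s1 s2 : size s1 = (p - r)%N -> size s2 = (q - r)%N ->
  box_contraction n r F G s1 s2 @[n --> \oo] --> U s1 s2.
Proof.
move=> sz1 sz2.
have [sf _ nf] := ff; have [sg _ ng] := gg.
have [_ bF] := square_summable_box sf; have [_ bG] := square_summable_box sg.
have inner k (H : seq nat -> R) (s : seq nat) (M : R) : size s = (k - r)%N -> (r <= k)%N ->
    (forall n, box_norm2 n k H <= M) -> forall n, \sum_(a <- box r n) H (s ++ a) ^+ 2 <= M.
  (* The fixed word [s] may have letters beyond [n], so the box is enlarged until it contains [s];
     the sum over [a] is then part of one squared norm. *)
  move=> szs rk bH n; pose n' := maxn n (\max_(i <- s) i).+1.
  apply: le_trans (bH n'); rewrite /box_norm2 -(subnK rk) sum_box_cat.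
  have H0 t : 0 <= \sum_(a <- box r n') H (t ++ a) ^+ 2.
    by apply: sumr_ge0 => a _; exact: sqr_ge0.
  have sb : s \in box (k - r) n'.
    rewrite mem_box szs eqxx /=; apply/allP => i si.
    by rewrite leq_max ltnS (leq_bigmax_seq _ si) ?orbT.
  rewrite (big_rem _ sb) /=.
  apply: (@le_trans _ _ (\sum_(a <- box r n') H (s ++ a) ^+ 2)).
    by apply: sum_box_le => [|a]; [exact: leq_maxl|exact: sqr_ge0].
  by rewrite lerDl; apply: sumr_ge0 => t _; exact: H0.
have := @real_sum_box_cvg R r [set a : r.-tuple nat | uniq a]
  (fun a => F (s1 ++ a) * G (s2 ++ a)) (l2norm f ^+ 2 + l2norm g ^+ 2).
have e : (fun n => \sum_(s <- box r n) F (s1 ++ as_tuple r s) * G (s2 ++ as_tuple r s))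
   = (fun n => box_contraction n r F G s1 s2).
  apply/funext => n; rewrite /box_contraction big_seq [RHS]big_seq; apply: eq_bigr => s.
  by rewrite mem_box => /andP[/eqP sr _]; rewrite as_tupleE.
rewrite e; apply => [a /negP na|n].
  rewrite /F nf ?mul0r//.
  by rewrite as_tupleE ?size_cat ?sz1 ?size_tuple ?subnK// cat_uniq (negPf na) !andbF.
apply: le_trans (lerD (inner p F s1 _ sz1 rp bF n) (inner q G s2 _ sz2 rq bG n)).
rewrite -big_split big_seq [leRHS]big_seq; apply: ler_sum => s /=.
rewrite mem_box => /andP[/eqP sr _]; rewrite as_tupleE// normrM.
rewrite -(real_normK (num_real (F _))) -(real_normK (num_real (G _))).
by have := normr_ge0 (F (s1 ++ s)); have := normr_ge0 (G (s2 ++ s)); nra.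
Qed.

Let W n := \sum_(s1 <- box (p - r) n) \sum_(s2 <- box (q - r) n) U s1 s2 ^+ 2.

Let eps n := (l2norm f ^+ 2 - box_norm2 n p F) * (l2norm g ^+ 2 - box_norm2 n q G).

(** [box_contraction_diff_le] with [n] fixed, in the limit of an infinite outer box. *)
Let diff_le n : \sum_(s1 <- box (p - r) n) \sum_(s2 <- box (q - r) n)
     (U s1 s2 - box_contraction n r F G s1 s2) ^+ 2 <= eps n.
Proof.
have [sf _ nf] := ff; have [sg _ ng] := gg.
have [cF bF] := square_summable_box sf; have [cG bG] := square_summable_box sg.
have c1 : \sum_(s1 <- box (p - r) n) \sum_(s2 <- box (q - r) n)
     (box_contraction m r F G s1 s2 - box_contraction n r F G s1 s2) ^+ 2
     @[m --> \oo] --> \sum_(s1 <- box (p - r) n) \sum_(s2 <- box (q - r) n)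
     (U s1 s2 - box_contraction n r F G s1 s2) ^+ 2.
  apply: cvg_sum_seq => s1; rewrite mem_box => /andP[/eqP sz1 _].
  apply: cvg_sum_seq => s2; rewrite mem_box => /andP[/eqP sz2 _].
  have h : box_contraction m r F G s1 s2 - box_contraction n r F G s1 s2
      @[m --> \oo] --> U s1 s2 - box_contraction n r F G s1 s2.
    by apply: cvgB; [exact: box_contraction_cvg|exact: cvg_cst].
  under eq_fun do rewrite expr2; rewrite expr2; exact: cvgM.
have c2 : (box_norm2 m p F - box_norm2 n p F) * (box_norm2 m q G - box_norm2 n q G)
     @[m --> \oo] --> eps n.
  by apply: cvgM; apply: cvgB; [exact: cF|exact: cvg_cst|exact: cG|exact: cvg_cst].
apply: (ler_cvg_to c1 c2); near=> m.
have nm : (n <= m)%N by near: m; exact: nbhs_infty_ge.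
by have := box_contraction_diff_le (p - r) (q - r) r F G nm; rewrite !subnK.
Unshelve. all: by end_near. Qed.

Let eps0 : Num.sqrt (eps n) @[n --> \oo] --> (0 : R).
Proof.
have [sf _ nf] := ff; have [sg _ ng] := gg.
have [cF bF] := square_summable_box sf; have [cG bG] := square_summable_box sg.
have h : eps n @[n --> \oo] --> (0 : R).
  rewrite -(mul0r (0 : R)) -{1}(subrr (l2norm f ^+ 2)) -(subrr (l2norm g ^+ 2)).
  by apply: cvgM; apply: cvgB => //; exact: cvg_cst.
by rewrite -[X in _ --> X]sqrtr0; apply: continuous_cvg => //; exact: sqrt_continuous.
Qed.

Let pair_sumE n (u : seq nat -> seq nat -> R) :
  \sum_(s1 <- box (p - r) n) \sum_(s2 <- box (q - r) n) u s1 s2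
  = \sum_(s <- [seq (s1, s2) | s1 <- box (p - r) n, s2 <- box (q - r) n]) u s.1 s.2.
Proof. by rewrite big_allpairs_dep. Qed.

Let sqrt_le1 n : Num.sqrt (W n)
  <= Num.sqrt (eps n) + Num.sqrt (box_contraction_norm2 n (p - r) (q - r) r F G).
Proof.
rewrite /W /box_contraction_norm2 !pair_sumE.
apply: le_trans (minkowski_sum _ _ (fun s => box_contraction n r F G s.1 s.2)) _.
rewrite lerD2r; apply: ler_wsqrtr; apply: le_trans (diff_le n).
by rewrite pair_sumE.
Qed.

Let sqrt_le2 n : Num.sqrt (box_contraction_norm2 n (p - r) (q - r) r F G)
  <= Num.sqrt (eps n) + Num.sqrt (W n).
Proof.
rewrite /W /box_contraction_norm2 !pair_sumE.
apply: le_trans (minkowski_sum _ _ (fun s => U s.1 s.2)) _.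
rewrite lerD2r; apply: ler_wsqrtr; apply: le_trans (diff_le n).
rewrite pair_sumE le_eqVlt; apply/orP; left; apply/eqP; apply: eq_bigr => s _.
by rewrite -sqrrN opprB.
Qed.

Let W_box n : W n = box_sum (fun t => Defs.contraction r f g t ^+ 2) n.
Proof.
rewrite /box_sum sum_box_cat /W big_seq [RHS]big_seq; apply: eq_bigr => s1.
rewrite mem_box => /andP[/eqP sz1 _].
rewrite big_seq [RHS]big_seq; apply: eq_bigr => s2.
rewrite mem_box => /andP[/eqP sz2 _]; rewrite /Defs.contraction.
by rewrite as_tupleE ?size_cat ?sz1 ?sz2// take_size_cat// drop_size_cat.
Qed.

Let W_cvg : Num.sqrt (W n) @[n --> \oo] --> l2norm (Defs.contraction r f g).
Proof.
have [sf _ nf] := ff; have [sg _ ng] := gg.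
have [cF bF] := square_summable_box sf; have [cG bG] := square_summable_box sg.
(* One product of norms bounds the square root of [eps], the other bounds the box contraction; [M]
   serves to show that the contraction is square-summable. *)
pose M := 2 * l2norm f * l2norm g.
have lf0 : 0 <= l2norm f by exact: sqrtr_ge0.
have lg0 : 0 <= l2norm g by exact: sqrtr_ge0.
have sq (a b x y : R) : 0 <= x -> 0 <= y -> 0 <= a <= x ^+ 2 -> 0 <= b <= y ^+ 2 ->
    Num.sqrt (a * b) <= x * y.
  move=> x0 y0 /andP[a0 ax] /andP[b0 bY].
  rewrite -[x * y]ger0_norm ?mulr_ge0// -sqrtr_sqr; apply: ler_wsqrtr.
  by rewrite exprMn; exact: ler_pM.
have WM n : Num.sqrt (W n) <= M.
  apply: (le_trans (sqrt_le1 n)).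
  rewrite /M -mulrA mulr2n mulrDl mul1r; apply: lerD.
    by apply: sq => //; rewrite subr_ge0 ?bF ?bG /= lerBlDr lerDl box_norm2_ge0.
  apply: (le_trans (ler_wsqrtr (box_contraction_norm2_le _ _ _ _ _ _))).
  by rewrite !subnK//; apply: sq => //; rewrite box_norm2_ge0 /= ?bF ?bG.
have W0 n : 0 <= W n.
  by apply: sumr_ge0 => s1 _; apply: sumr_ge0 => s2 _; exact: sqr_ge0.
have M0 : 0 <= M by rewrite !mulr_ge0.
have WM2 n : box_sum (fun t => Defs.contraction r f g t ^+ 2) n <= M ^+ 2.
  rewrite -W_box -[W n]sqr_sqrtr// ler_pXn2r ?nnegrE ?sqrtr_ge0//.
have := esum_box_cvg (fun t => sqr_ge0 (Defs.contraction r f g t)) WM2.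
under eq_fun do rewrite -W_box.
by move=> h; apply: continuous_cvg => //; exact: sqrt_continuous.
Qed.

(** A box contraction truncates free and contracted variables together, whereas [W] truncates only
    the free ones and is a box sum of the squared contraction. Minkowski's inequality bounds the
    difference of the two norms by the square root of [eps], a product of kernel tails. *)
Lemma box_contraction_norm_cvg :
  Num.sqrt (box_contraction_norm2 n (p - r) (q - r) r F G) @[n --> \oo]
  --> l2norm (Defs.contraction r f g).
Proof.
have h1 : Num.sqrt (W n) - Num.sqrt (eps n) @[n --> \oo] --> l2norm (Defs.contraction r f g).
  by rewrite -[l2norm _]subr0; apply: cvgB; [exact: W_cvg|exact: eps0].
have h2 : Num.sqrt (eps n) + Num.sqrt (W n) @[n --> \oo] --> l2norm (Defs.contraction r f g).
  by rewrite -[l2norm _]add0r; apply: cvgD; [exact: eps0|exact: W_cvg].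
apply: (squeeze_cvgr _ h1 h2); apply: nearW => n.
by rewrite lerBlDl sqrt_le1 sqrt_le2.
Qed.

End contraction_norm.

(** * Exchange of contracted and free variables; comparison of the two bounds *)

Section second_bound.
Local Open Scope classical_set_scope.
Context {R : realType}.

(* Exchanging the contracted and the free variables: both sides expand to sums
   of products of four kernel values, and Cauchy-Schwarz separates F and G. *)
Lemma box_contraction_norm2_swap_le n p q r (F G : seq nat -> R) :
  (forall s a, size s = p -> size a = r -> F (s ++ a) = F (a ++ s)) ->
  (forall s a, size s = q -> size a = r -> G (s ++ a) = G (a ++ s)) ->
  box_contraction_norm2 n p q r F G ^+ 2
  <= box_contraction_norm2 n r r p F F * box_contraction_norm2 n r r q G G.
Proof.
move=> symF symG.
pose X k (H : seq nat -> R) a b := box_contraction n k H H a b.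
have -> : box_contraction_norm2 n p q r F G
    = \sum_(a <- box r n) \sum_(b <- box r n) X p F a b * X q G a b.
  transitivity (\sum_(s1 <- box p n) \sum_(s2 <- box q n)
    \sum_(a <- box r n) \sum_(b <- box r n)
      (F (a ++ s1) * F (b ++ s1)) * (G (a ++ s2) * G (b ++ s2))).
    apply: eq_big_seq => s1; rewrite mem_box => /andP[/eqP z1 _].
    apply: eq_big_seq => s2; rewrite mem_box => /andP[/eqP z2 _].
    rewrite expr2 /box_contraction mulr_suml.
    apply: eq_big_seq => a; rewrite mem_box => /andP[/eqP za _].
    rewrite mulr_sumr.
    apply: eq_big_seq => b; rewrite mem_box => /andP[/eqP zb _].
    by rewrite (symF s1 a)// (symF s1 b)// (symG s2 a)// (symG s2 b)// mulrACA.
  under eq_bigr do rewrite exchange_big /=.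
  rewrite exchange_big /=; apply: eq_bigr => a _.
  under eq_bigr do rewrite exchange_big /=.
  rewrite exchange_big /=; apply: eq_bigr => b _.
  rewrite /X /box_contraction mulr_suml; apply: eq_bigr => s1 _.
  by rewrite mulr_sumr.
have := sum_cauchy_schwarz [seq (a, b) | a <- box r n, b <- box r n] xpredT
  (fun u => X p F u.1 u.2) (fun u => X q G u.1 u.2).
by rewrite !big_allpairs_dep.
Qed.

Lemma ell02_cat_comm k (f : k.-tuple nat -> R) s a : ell02 f ->
  (size s + size a)%N = k -> f (as_tuple k (s ++ a)) = f (as_tuple k (a ++ s)).
Proof.
move=> [_ symf _] sk; apply: symf.
by rewrite !as_tupleE ?size_cat ?[(size a + _)%N]addnC// perm_catC.
Qed.

Lemma box_contraction_norm2_cvg p q r (f : p.-tuple nat -> R) (g : q.-tuple nat -> R) :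
  (r <= p)%N -> (r <= q)%N -> ell02 f -> ell02 g ->
  box_contraction_norm2 n (p - r) (q - r) r
    (fun s => f (as_tuple p s)) (fun s => g (as_tuple q s)) @[n --> \oo]
  --> l2norm (Defs.contraction r f g) ^+ 2.
Proof.
move=> rp rq ff gg; have h := box_contraction_norm_cvg rp rq ff gg.
rewrite (_ : (fun n => _) = (fun n =>
  Num.sqrt (box_contraction_norm2 n (p - r) (q - r) r
    (fun s => f (as_tuple p s)) (fun s => g (as_tuple q s)))
  * Num.sqrt (box_contraction_norm2 n (p - r) (q - r) r
    (fun s => f (as_tuple p s)) (fun s => g (as_tuple q s))))).
  by rewrite expr2; exact: cvgM.
apply/funext => n; rewrite -expr2 sqr_sqrtr//.
by apply: sumr_ge0 => s1 _; apply: sumr_ge0 => s2 _; exact: sqr_ge0.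
Qed.

Lemma contraction_norm_swap_le p q r (f : p.-tuple nat -> R) (g : q.-tuple nat -> R) :
  (r <= p)%N -> (r <= q)%N -> ell02 f -> ell02 g ->
  l2norm (Defs.contraction r f g) ^+ 2
  <= l2norm (Defs.contraction (p - r) f f) * l2norm (Defs.contraction (q - r) g g).
Proof.
move=> rp rq ff gg.
pose F s := f (as_tuple p s); pose G s := g (as_tuple q s).
have cf := box_contraction_norm_cvg (leq_subr r p) (leq_subr r p) ff ff.
have cg := box_contraction_norm_cvg (leq_subr r q) (leq_subr r q) gg gg.
apply: (@ler_cvg_to _ \oo _ _
  (fun n => box_contraction_norm2 n (p - r) (q - r) r F G)
  (fun n => Num.sqrt (box_contraction_norm2 n (p - (p - r)) (p - (p - r)) (p - r) F F)
    * Num.sqrt (box_contraction_norm2 n (q - (q - r)) (q - (q - r)) (q - r) G G))).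
- exact: box_contraction_norm2_cvg.
- exact: cvgM.
apply: nearW => n; rewrite !subKn//.
rewrite -sqrtrM; last first.
  by apply: sumr_ge0 => s1 _; apply: sumr_ge0 => s2 _; exact: sqr_ge0.
apply: le_trans (ler_norm _) _; apply: ler_norm_sqrt_sqr.
apply: box_contraction_norm2_swap_le => s a zs za; apply: ell02_cat_comm => //.
  by rewrite zs za subnK.
by rewrite zs za subnK.
Qed.

(** The contraction of order 0 is the tensor product. It appears when the exchange is applied with
    all variables of one kernel contracted, and it is the source of the mixed term with
    [l2norm (f j)] in the second bound. *)
Lemma contraction0_norm p (f : p.-tuple nat -> R) : ell02 f ->
  l2norm (Defs.contraction 0 f f) = l2norm f ^+ 2.
Proof.
move=> ff; have [sf _ _] := ff.
have c := box_contraction_norm_cvg (leq0n p) (leq0n p) ff ff.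
have [c' _] := square_summable_box sf.
apply: (cvg_unique _ c) => //.
rewrite (_ : (fun n => _) = (fun n => box_norm2 n p (fun s => f (as_tuple p s))))//.
apply/funext => n; rewrite -[RHS]ger0_norm ?box_norm2_ge0// -sqrtr_sqr; congr Num.sqrt.
rewrite /box_contraction_norm2 subn0 expr2 /box_norm2 mulr_suml; apply: eq_bigr => s1 _.
rewrite mulr_sumr; apply: eq_bigr => s2 _.
by rewrite /box_contraction sum_box0 !cats0 exprMn.
Qed.

Section bounds_comparison.
Context {d : nat}.
Variables (q : 'I_d -> nat) (f : forall i, (q i).-tuple nat -> R).
Arguments f : clear implicits.
Variable gap : 'I_d -> 'I_d -> R.
Hypothesis ff : forall i, ell02 (f i).

Let S := second_bound f gap.

Let inner_le i j : Num.max (gap i j)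
      (\big[Num.max/0]_(1 <= r < q i)
        Num.max (cnorm f i i r)
       (Num.max ((cnorm f i i r) ^+ 2)
                (l2norm (f j) * Num.sqrt (cnorm f i i r)))) <= S.
Proof.
rewrite /S /second_bound.
apply: le_trans (le_bigmax _ _ i); exact: (le_bigmax _ _ j).
Qed.

Lemma second_bound_ge0 : 0 <= S.
Proof. by rewrite /S /second_bound; elim/big_rec: _ => // i x _ x0; rewrite le_max x0 orbT. Qed.

Lemma first_bound_ge0 : 0 <= first_bound f gap.
Proof. by rewrite /first_bound; elim/big_rec: _ => // i x _ x0; rewrite le_max x0 orbT. Qed.

Lemma gap_le_second i j : gap i j <= S.
Proof. by apply: le_trans (inner_le i j); rewrite le_max lexx. Qed.

Let term_le i j r : (1 <= r < q i)%N -> Num.max (cnorm f i i r)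
       (Num.max ((cnorm f i i r) ^+ 2)
                (l2norm (f j) * Num.sqrt (cnorm f i i r))) <= S.
Proof.
move=> rq; apply: le_trans (inner_le i j); rewrite le_max; apply/orP; right.
by apply: (Order.TotalTheory.le_bigmax_seq 0 r xpredT (fun r => Num.max (cnorm f i i r)
   (Num.max ((cnorm f i i r) ^+ 2) (l2norm (f j) * Num.sqrt (cnorm f i i r)))));
  rewrite ?mem_index_iota.
Qed.

Let cn_le i r : (1 <= r < q i)%N -> cnorm f i i r <= S.
Proof. by move=> rq; apply: le_trans (term_le i rq); rewrite le_max lexx. Qed.

Let cn2_le i r : (1 <= r < q i)%N -> cnorm f i i r ^+ 2 <= S.
Proof. by move=> rq; apply: le_trans (term_le i rq); rewrite !le_max lexx orbT. Qed.

Let cnm_le i j r : (1 <= r < q i)%N -> l2norm (f j) * Num.sqrt (cnorm f i i r) <= S.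
Proof. by move=> rq; apply: le_trans (term_le j rq); rewrite !le_max lexx !orbT. Qed.

Let cnorm_ge0 i j r : 0 <= cnorm f i j r.
Proof. exact: sqrtr_ge0. Qed.

Let sqr_le (x a b : R) : 0 <= x -> x ^+ 2 <= a * b -> 0 <= a <= S -> 0 <= b <= S -> x <= S.
Proof.
move=> x0 xab /andP[a0 aS] /andP[b0 bS].
rewrite -(@ler_pXn2r _ 2) ?nnegrE ?second_bound_ge0//.
by apply: le_trans xab _; rewrite expr2; exact: ler_pM.
Qed.

(** After the exchange, a mixed contraction norm is at most the geometric mean of two norms of the
    form f ⋆ f. These are terms of [S] unless r equals one of the orders, where one of them becomes
    a squared kernel norm. *)
Lemma first_le_second : first_bound f gap <= S.
Proof.
rewrite /first_bound; apply: bigmax_le => [|i _]; first exact: second_bound_ge0.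
apply: bigmax_le => [|j _]; first exact: second_bound_ge0.
rewrite !ge_max gap_le_second /=; apply/and3P; split.
- have [_|qij] := eqVneq (q i) (q j); first by rewrite mulr0 second_bound_ge0.
  rewrite mulr1 big_nat; apply: bigmax_le => [|r /andP[r1 rq]]; first exact: second_bound_ge0.
  rewrite ltnS leq_min in rq; case/andP: rq => ri rj.
  have := contraction_norm_swap_le ri rj (ff i) (ff j); rewrite -/(cnorm f i j r) => h.
  (* If r = q_i, then r < q_j because the orders differ, and the exchange gives the mixed term of
     the second bound with the roles of i and j interchanged. *)
  have [ri'|ri'] := eqVneq r (q i).
    have rj' : (r < q j)%N by rewrite ltn_neqAle rj andbT ri'.
    have e0 : (q i - r = 0)%N by rewrite ri' subnn.
    move: h; rewrite e0 contraction0_norm// -/(cnorm f j j (q j - r)) => h.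
    apply: le_trans (cnm_le i (i := j) (r := q j - r) _); last first.
      by rewrite subn_gt0 rj' ltn_subrL r1 (leq_trans r1 rj).
    rewrite -(@ler_pXn2r _ 2) ?nnegrE ?mulr_ge0 ?sqrtr_ge0//.
    by rewrite exprMn (@sqr_sqrtr _ (cnorm f j j _)).
  have ri'' : (r < q i)%N by rewrite ltn_neqAle ri ri'.
  have rangei : (1 <= q i - r < q i)%N.
    by rewrite subn_gt0 ri'' ltn_subrL r1 (leq_trans r1 ri).
  have [rj'|rj'] := eqVneq r (q j).
    have e0 : (q j - r = 0)%N by rewrite rj' subnn.
    move: h; rewrite e0 contraction0_norm//.
    rewrite -/(cnorm f i i (q i - r)) => h.
    apply: le_trans (cnm_le j rangei).
    rewrite -(@ler_pXn2r _ 2) ?nnegrE ?mulr_ge0 ?sqrtr_ge0//.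
    by rewrite exprMn (@sqr_sqrtr _ (cnorm f i i _))// mulrC.
  have rj'' : (r < q j)%N by rewrite ltn_neqAle rj rj'.
  have rangej : (1 <= q j - r < q j)%N.
    by rewrite subn_gt0 rj'' ltn_subrL r1 (leq_trans r1 rj).
  by apply: (sqr_le _ h); rewrite ?cnorm_ge0 ?sqrtr_ge0// cn_le.
- have [qij|_] := eqVneq (q i) (q j); last by rewrite mulr0 second_bound_ge0.
  rewrite mulr1 big_nat; apply: bigmax_le => [|r /andP[r1 ri]]; first exact: second_bound_ge0.
  have rj : (r < q j)%N by rewrite -qij.
  have rangei : (1 <= q i - r < q i)%N by rewrite subn_gt0 ri ltn_subrL r1 (ltn_trans _ ri).
  have rangej : (1 <= q j - r < q j)%N by rewrite subn_gt0 rj ltn_subrL r1 (ltn_trans _ rj).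
  have h := contraction_norm_swap_le (ltnW ri) (ltnW rj) (ff i) (ff j).
  by apply: (sqr_le _ h); rewrite ?sqrtr_ge0//; [exact: (cn_le rangei)|exact: (cn_le rangej)].
- rewrite big_nat; apply: bigmax_le => [|r rq]; first exact: second_bound_ge0.
  exact: cn2_le.
Qed.

End bounds_comparison.
End second_bound.

(** * From the cube to multiple integrals *)

Section sets_and_words.
Context {R : realType} {n : nat}.
Local Notation T := 'I_n.
Implicit Types (A U S : {set T}).

Definition word A : seq nat := [seq val i | i <- enum A].

Lemma size_word A : size (word A) = #|A|.
Proof. by rewrite size_map -cardE. Qed.

Lemma word_uniq A : uniq (word A).
Proof. by rewrite map_inj_uniq ?enum_uniq//; exact: val_inj. Qed.

Lemma mem_word A (i : T) : (val i \in word A) = (i \in A).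
Proof. by rewrite mem_map ?mem_enum//; exact: val_inj. Qed.

Lemma word_lt A k : k \in word A -> (k < n)%N.
Proof. by move=> /mapP[i _ ->]; exact: ltn_ord. Qed.

Lemma word_sorted A : sorted ltn (word A).
Proof.
rewrite /word (_ : enum A = seq.filter (mem A) (enum T)); last by rewrite enumT.
rewrite sorted_map; apply: sorted_filter => [? ? ? |]; first exact: ltn_trans.
by rewrite -sorted_map val_enum_ord iota_ltn_sorted.
Qed.

Lemma word_box A q : #|A| = q -> word A \in box q n.
Proof.
by move=> Aq; rewrite mem_box size_word Aq eqxx; apply/allP => k /word_lt.
Qed.

Lemma word_inj : injective word.
Proof. by move=> A B e; apply/setP => i; rewrite -[LHS]mem_word e mem_word. Qed.

Definition letters (a : seq nat) : {set T} := [set i | val i \in a].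

Lemma letters_perm_eq a : uniq a -> all (fun k => k < n)%N a ->
  perm_eq a (word (letters a)).
Proof.
move=> ua an; apply: uniq_perm; rewrite ?word_uniq// => k.
apply/idP/idP => [ka|].
  have kn := allP an k ka.
  by rewrite -[k]/(val (Ordinal kn)) mem_word inE.
by move=> /mapP[i]; rewrite mem_enum inE => ia ->.
Qed.

Lemma letters_word_perm a A : perm_eq a (word A) -> letters a = A.
Proof. by move=> /perm_mem e; apply/setP => i; rewrite inE e mem_word. Qed.

(** Each set of size q is the set of letters of exactly q! words without repetition. *)
Lemma sum_box_sets q (phi : seq nat -> R) :
  (forall a b, perm_eq a b -> phi a = phi b) ->
  (forall a, ~~ uniq a -> phi a = 0) ->
  \sum_(a <- box q n) phi a
  = q`!%:R * \sum_(A : {set T} | #|A| == q) phi (word A).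
Proof.
move=> sphi nphi; rewrite (bigID uniq) /= [X in _ + X]big1 ?addr0 => [|a /nphi//].
transitivity (\sum_(a <- box q n | uniq a) \sum_(A : {set T} | #|A| == q)
    (if letters a == A then phi (word A) else 0)).
  rewrite big_seq_cond [RHS]big_seq_cond; apply: eq_bigr => a /andP[].
  rewrite mem_box => /andP[/eqP aq an] ua; have pe := letters_perm_eq ua an.
  rewrite (bigD1 (letters a)) /=; last by rewrite -size_word -(perm_size pe) aq.
  rewrite eqxx big1 ?addr0 ?(sphi _ _ pe)// => A /andP[_].
  by rewrite eq_sym => /negPf ->.
rewrite exchange_big mulr_sumr /=; apply: eq_bigr => A /eqP Aq.
rewrite -big_mkcondr big_const_seq iter_addr_0 -[LHS]mulr_natl; congr (_%:R * _).
rewrite -Aq -size_word -(size_permutations (word_uniq A)) -size_filter.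
apply: perm_size; apply: uniq_perm; rewrite ?permutations_uniq ?filter_uniq ?box_uniq// => a.
rewrite mem_filter mem_permutations mem_box; apply/idP/idP.
  move=> /andP[/andP[ua /eqP la] /andP[_ an]].
  by rewrite -la; exact: letters_perm_eq.
move=> pe; rewrite (perm_uniq pe) word_uniq (letters_word_perm pe) eqxx /=.
rewrite (perm_size pe) size_word Aq eqxx /=.
by apply/allP => k; rewrite (perm_mem pe) => /word_lt.
Qed.

Lemma sum_sets_le_box q (phi : seq nat -> R) : (forall a, 0 <= phi a) ->
  \sum_(A : {set T} | #|A| == q) phi (word A) <= \sum_(a <- box q n) phi a.
Proof.
move=> phi0; pose L := [seq word A | A <- enum {set T} & #|A| == q].
have -> : \sum_(A : {set T} | #|A| == q) phi (word A) = \sum_(a <- L) phi a.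
  by rewrite big_map big_filter big_enum_cond.
have uL : uniq L.
  by rewrite (map_inj_uniq word_inj) filter_uniq// enum_uniq.
rewrite [leRHS](bigID (fun a => a \in L)) /=.
have -> : \sum_(a <- L) phi a = \sum_(a <- box q n | a \in L) phi a.
  rewrite -[RHS]big_filter; apply: perm_big; apply: uniq_perm => //.
    by rewrite filter_uniq ?box_uniq.
  move=> a; rewrite mem_filter; case: (boolP (a \in L)) => //= /mapP[A].
  by rewrite mem_filter => /andP[/eqP Aq _] ->; rewrite word_box.
by rewrite lerDl; exact: sumr_ge0.
Qed.

Section kernels.
Variables (p q : nat) (f : p.-tuple nat -> R) (g : q.-tuple nat -> R).
Hypothesis symf : symmetric_fun f.
Hypothesis symg : symmetric_fun g.
Hypothesis nf : forall t : p.-tuple nat, ~~ uniq t -> f t = 0.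
Hypothesis ng : forall t : q.-tuple nat, ~~ uniq t -> g t = 0.

(** The factor k! is the one in front of the sum over increasing indices in the multiple
    integral. *)
Definition walsh_coef k (h : k.-tuple nat -> R) A : R :=
  if #|A| == k then k`!%:R * h (as_tuple k (word A)) else 0.

Lemma walsh_coef_homogeneous k (h : k.-tuple nat -> R) :
  homogeneous k (walsh_coef h).
Proof. by move=> A /negPf Ak; rewrite /walsh_coef Ak. Qed.

Lemma walsh_coef_setU k (h : k.-tuple nat -> R) S U : symmetric_fun h ->
  (#|S| + #|U| = k)%N -> [disjoint U & S] ->
  walsh_coef h (S :|: U) = k`!%:R * h (as_tuple k (word S ++ word U)).
Proof.
move=> symh SU dis; rewrite /walsh_coef cardsU disjoint_setI0 1?disjoint_sym//.
rewrite cards0 subn0 SU eqxx; congr (_ * _); apply: symh.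
rewrite !as_tupleE ?size_cat ?size_word ?SU//; last first.
  by rewrite cardsU disjoint_setI0 1?disjoint_sym// cards0 subn0.
apply: uniq_perm; rewrite ?word_uniq ?cat_uniq ?word_uniq//= ?andbT.
  apply/hasPn => k' /mapP[i iU ->]; rewrite mem_word.
  by rewrite mem_enum in iU; apply/negP => iS; have := pred0P dis i; rewrite /= iU iS.
move=> k'; rewrite mem_cat; apply/idP/idP.
  move=> /mapP[i]; rewrite mem_enum inE => iSU ->; by rewrite !mem_word.
by case/orP => /mapP[i]; rewrite mem_enum => iSU ->; rewrite mem_word inE iSU ?orbT.
Qed.

(** The product p! q! comes from the two coefficients, and 1 / r! from the orderings of the
    contracted set U. Words with a repetition, or meeting [S1] or [S2], add nothing because the
    kernels vanish off the tuples with distinct entries. *)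
Lemma set_contraction_word r S1 S2 : (r <= p)%N -> (r <= q)%N ->
  #|S1| = (p - r)%N -> #|S2| = (q - r)%N ->
  set_contraction r (walsh_coef f) (walsh_coef g) S1 S2
  = p`!%:R * q`!%:R / r`!%:R
    * box_contraction n r (fun s => f (as_tuple p s)) (fun s => g (as_tuple q s))
        (word S1) (word S2).
Proof.
move=> rp rq c1 c2; pose F s := f (as_tuple p s); pose G s := g (as_tuple q s).
(* [sum_box_sets] asks for symmetry and vanishing on words of every length, whereas [as_tuple] pads
   with 0 or truncates; the test on the length removes these spurious values. *)
pose phi a := if size a == r then F (word S1 ++ a) * G (word S2 ++ a) else 0.
have -> : box_contraction n r F G (word S1) (word S2) = \sum_(a <- box r n) phi a.
  apply: eq_big_seq => a; rewrite mem_box => /andP[/eqP ar _].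
  by rewrite /phi ar eqxx.
have nophi a (S : {set T}) k (h : k.-tuple nat -> R) : size a = r -> (r <= k)%N ->
    #|S| = (k - r)%N -> (forall t : k.-tuple nat, ~~ uniq t -> h t = 0) ->
    ~~ uniq (word S ++ a) -> h (as_tuple k (word S ++ a)) = 0.
  move=> ar rk cS nh nu; apply: nh.
  by rewrite as_tupleE// size_cat size_word ar cS subnK.
have permh a b (S : {set T}) k (h : k.-tuple nat -> R) : size a = r -> (r <= k)%N ->
    #|S| = (k - r)%N -> symmetric_fun h -> perm_eq a b ->
    h (as_tuple k (word S ++ a)) = h (as_tuple k (word S ++ b)).
  move=> ar rk cS symh ab; apply: symh.
  rewrite !as_tupleE ?perm_cat2l//; rewrite size_cat size_word -?(perm_size ab) ar cS subnK//.
rewrite (@sum_box_sets r phi); last 2 first.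
- move=> a b ab; rewrite /phi -(perm_size ab); case: eqP => // ar.
  by rewrite /F /G (permh a b S1)// (permh a b S2).
- move=> a nu; rewrite /phi; case: eqP => // ar.
  by rewrite /F nophi ?mul0r// cat_uniq (negPf nu) !andbF.
rewrite mulrA divfK ?pnatr_eq0 -?lt0n ?fact_gt0// /set_contraction mulr_sumr.
rewrite big_mkcondr /=; apply: eq_bigr => U /eqP Ur.
rewrite /phi size_word Ur eqxx; case: ifPn => dis.
  have dis1 := disjointWr (finset.subsetUl S1 S2) dis.
  have dis2 := disjointWr (finset.subsetUr S1 S2) dis.
  by rewrite !walsh_coef_setU ?c1 ?c2 ?Ur ?subnK//; rewrite /F /G; ring.
(* If U meets [S1] the value of f is zero, and if it meets [S2] that of g is. *)
have : ~~ [disjoint U & S1] || ~~ [disjoint U & S2].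
  rewrite -negb_and; apply: contra dis => /andP[d1 d2].
  rewrite disjoint_sym finset.disjoints_subset finset.subUset.
  by rewrite -!finset.disjoints_subset [X in X && _]disjoint_sym d1 disjoint_sym.
have nuc S : ~~ [disjoint U & S] -> ~~ uniq (word S ++ word U).
  rewrite -setI_eq0 => /set0Pn[i]; rewrite inE => /andP[iU iS].
  rewrite cat_uniq !negb_and negbK; apply/orP; right; apply/orP; left.
  by apply/hasP; exists (val i); rewrite mem_word.
by case/orP => /nuc nu; rewrite /F /G;
  [rewrite nophi ?size_word|rewrite [g _]nophi ?size_word]; rewrite // ?mul0r ?mulr0.
Qed.

(** Sets are identified with their increasing words, which form part of the box, and the factor 1 /
    r! is bounded by 1. *)
Lemma set_contraction_norm2_le r : (r <= p)%N -> (r <= q)%N ->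
  set_contraction_norm2 p q r (walsh_coef f) (walsh_coef g)
  <= (p`!%:R * q`!%:R) ^+ 2 * box_contraction_norm2 n (p - r) (q - r) r
       (fun s => f (as_tuple p s)) (fun s => g (as_tuple q s)).
Proof.
move=> rp rq; pose bc := box_contraction n r
  (fun s => f (as_tuple p s)) (fun s => g (as_tuple q s)).
have b0 s1 s2 : 0 <= bc s1 s2 ^+ 2 by exact: sqr_ge0.
rewrite /box_contraction_norm2 mulr_sumr.
have h0 s1 : 0 <= (p`!%:R * q`!%:R) ^+ 2 * \sum_(s2 <- box (q - r) n) bc s1 s2 ^+ 2.
  by rewrite mulr_ge0 ?sqr_ge0// sumr_ge0.
apply: le_trans (sum_sets_le_box _ h0); apply: ler_sum => S1 /eqP c1.
apply: (@le_trans _ _ ((p`!%:R * q`!%:R) ^+ 2 *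
  \sum_(S2 : {set T} | #|S2| == (q - r)%N) bc (word S1) (word S2) ^+ 2)).
  rewrite mulr_sumr; apply: ler_sum => S2 /eqP c2.
  rewrite set_contraction_word// exprMn; apply: ler_wpM2r => //.
  rewrite ler_pXn2r ?nnegrE ?mulr_ge0 ?invr_ge0//.
  by rewrite -[leRHS]mulr1; apply: ler_wpM2l; rewrite ?mulr_ge0// invf_le1 ?ltr0n ?ler1n fact_gt0.
apply: ler_wpM2l; first exact: sqr_ge0.
exact: (sum_sets_le_box _ (fun s2 => b0 (word S1) s2)).
Qed.

End kernels.

Lemma sum_sorted_tuples q (psi : q.-tuple T -> R) (psi' : {set T} -> R) :
  (forall t : q.-tuple T, uniq t -> sorted ltn (map val t) ->
     psi t = psi' [set i in t]%SET) ->
  \sum_(t : q.-tuple T | sorted ltn (map val t)) psi t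
  = \sum_(A : {set T} | #|A| == q) psi' A.
Proof.
move=> h.
have sorted_uniq_t (t : q.-tuple T) : sorted ltn (map val t) -> uniq t.
  move=> st; rewrite -(map_inj_uniq val_inj).
  exact: (sorted_uniq ltn_trans ltnn).
rewrite (partition_big (fun t : q.-tuple T => [set i in t]%SET) (fun A => #|A| == q)) /=;
  last first.
  move=> t /sorted_uniq_t ut; rewrite cardsE; apply/eqP.
  by rewrite (card_uniqP ut) size_tuple.
apply: eq_bigr => A /eqP Aq.
have szA : size (enum A) == q by rewrite -cardE Aq.
have sortA : sorted ltn (map val (Tuple szA)) by exact: word_sorted.
rewrite (big_pred1 (Tuple szA)) => [|t].
  rewrite h ?sorted_uniq_t//; congr psi'; apply/setP => i.
  by rewrite inE mem_enum.
apply/andP/eqP => [[st /eqP tA]|->]; last first.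
  by split => //; apply/eqP/setP => i; rewrite inE mem_enum.
apply: val_inj => /=; apply: (inj_map val_inj).
apply: (irr_sorted_eq ltn_trans ltnn) => // k.
by apply/mapP/mapP => -[i it ->]; exists i => //; move: it; rewrite -tA mem_enum inE.
Qed.

End sets_and_words.

Section partial_integral.
Local Open Scope classical_set_scope.
Context {R : realType} {dO : measure_display} {Omega : measurableType dO}.

Lemma multiple_integral_partialE (X : nat -> Omega -> R) q (f : q.-tuple nat -> R)
    (n : nat) w :
  multiple_integral_partial X f n w
  = \sum_(A : {set 'I_n}) walsh_coef f A * \prod_(k in A) X k w.
Proof.
rewrite /multiple_integral_partial.
rewrite (sum_sorted_tuples (psi' := fun A => f (as_tuple q (word A)) * \prod_(k in A) X k w)).
  rewrite mulr_sumr big_mkcond; apply: eq_bigr => A _; rewrite /walsh_coef.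
  by case: ifP => _; rewrite ?mul0r// mulrA.
move=> t ut st; congr (f _ * _).
  apply: val_inj => /=; rewrite as_tupleE; last first.
    by rewrite size_word cardsE (card_uniqP ut) size_tuple.
  apply: (irr_sorted_eq ltn_trans ltnn) => //.
    exact: word_sorted.
  move=> k; apply/mapP/mapP => -[i it ->]; exists i => //; move: it;
    by rewrite mem_enum inE.
rewrite -(big_tuple _ _ _ xpredT (fun k : 'I_n => X k w)) /=.
rewrite big_uniq//=; apply: eq_bigl => i; by rewrite inE.
Qed.

End partial_integral.

(** * Expectations of functions of finitely many signs as means over the cube *)

Section rademacher_mean.
Local Open Scope classical_set_scope.
Context {R : realType} {dO : measure_display} {Omega : measurableType dO}.
Variables (P : probability Omega R) (X : nat -> {RV P >-> R}).
Hypothesis radX : rademacher_sequence X.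
Variable n : nat.
Implicit Types (S : {set 'I_n}).

Definition sign_event S : set Omega := [set w | forall k : 'I_n, X k w = rad k S].

Let B S (k : nat) : set R := [set (-1) ^+ (k \in word S)].

Let sign_eventE S :
  sign_event S = \bigcap_(k in [set` iota 0 n]) (X k @^-1` B S k).
Proof.
apply/seteqP; split=> [w h k /=|w h k].
  rewrite mem_iota add0n /= => kn.
  by rewrite /B /= -[k]/(val (Ordinal kn)) mem_word; exact: (h (Ordinal kn)).
have := h (val k); rewrite /B /= mem_word; apply.
by rewrite mem_iota /= add0n.
Qed.

Let measurable_X k (C : set R) : measurable C -> measurable (X k @^-1` C).
Proof. by move=> mC; rewrite -[_ @^-1` _]setTI; exact: measurable_funPT. Qed.

Let measurable_sign_event S : measurable (sign_event S).
Proof.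
rewrite sign_eventE; apply: bigcap_measurableType => k _.
by apply: measurable_X; exact: measurable_set1.
Qed.

Let prob_sign_event S : P (sign_event S) = ((2 ^+ n)^-1)%:E.
Proof.
have [ind half] := radX.
rewrite sign_eventE ind ?iota_uniq//; last by move=> k; exact: measurable_set1.
congr EFin; rewrite (eq_bigr (fun=> 2^-1)) => [|k _].
  by rewrite big_const_seq count_predT size_iota iter_mulr_1 exprVn.
have [h1 h2] := half k; rewrite /B; case: (k \in word S).
  by rewrite expr1 h2.
by rewrite expr0 h1.
Qed.

Let sign_event_unique S S' w : sign_event S w -> sign_event S' w -> S = S'.
Proof.
move=> h h'; apply/setP => k; have := h k; rewrite (h' k) /rad.
case: (k \in S); case: (k \in S') => //; rewrite expr0 expr1 => e; exfalso; lra.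
Qed.

Let ind S w : R := \1_(sign_event S) w.

Let int_ind S : P.-integrable setT (EFin \o ind S) /\ \int[P]_w ind S w = (2 ^+ n)^-1.
Proof.
split; last first.
  rewrite /Rintegral /ind integral_indic// classical_sets.setIT.
  exact: (congr1 fine (prob_sign_event S)).
apply: (@integrable_bounded_real _ _ _ _ _ 1); first exact: measurable_indic.
by move=> w; rewrite /ind indicE; case: (_ \in _); rewrite ?normr1 ?normr0.
Qed.

Let sum_ind (phi : {set 'I_n} -> R) w S : sign_event S w ->
  \sum_S' phi S' * ind S' w = phi S.
Proof.
move=> Sw; rewrite (bigD1 S) //= /ind indicE mem_set// mulr1 big1 ?addr0// => S' S'S.
rewrite indicE memNset ?mulr0// => S'w.
by rewrite (sign_event_unique S'w Sw) eqxx in S'S.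
Qed.

(** The 2^n sign events are disjoint with probability 2^-n each, so that [Z], the indicator of their
    complement, is nonnegative with mean 0. *)
Let ae_sign_event : {ae P, forall w, exists S, sign_event S w}.
Proof.
pose Z w : R := 1 - \sum_S 1 * ind S w.
have iZ : P.-integrable setT (EFin \o Z).
  apply: integrableB_real; first exact: finite_measure_integrable_cst.
  by apply: integrable_sum => S; apply: integrableZ_real; have [] := int_ind S.
have none w : ~ (exists S, sign_event S w) -> Z w = 1.
  move=> no; rewrite /Z big1 ?subr0// => S _.
  by rewrite /ind indicE memNset ?mulr0// => Sw; apply: no; exists S.
have Z0 w : 0 <= Z w.
  have [[S Sw]|no] := pselect (exists S, sign_event S w); last by rewrite none.
  by rewrite /Z (sum_ind (fun=> 1) Sw) subrr.
have EZ : \int[P]_w Z w = 0.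
  rewrite RintegralB//; last 2 first.
  - exact: finite_measure_integrable_cst.
  - by apply: integrable_sum => S; apply: integrableZ_real; have [] := int_ind S.
  rewrite Rintegral_prob_cst Rintegral_sum; last first.
    by move=> S; apply: integrableZ_real; have [] := int_ind S.
  rewrite (eq_bigr (fun=> (2 ^+ n)^-1)) => [|S _].
    rewrite sumr_const card_cube -[X in _ - X]mulr_natl natrX.
    by rewrite mulfV ?expf_neq0// subrr.
  have [i e] := int_ind S; by under eq_Rintegral do rewrite mul1r.
have EZ0 : (\int[P]_w `|(Z w)%:E| = 0)%E.
  under eq_integral do rewrite gee0_abs ?lee_fin//.
  by rewrite -[LHS]fineK ?integrable_fin_num// -[fine _]/(Rintegral P setT Z) EZ.
have /(ae_eq_integral_abs P measurableT) := EZ0.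
move=> /(_ (measurable_int _ iZ)); apply: filterS => w /(_ Logic.I) /= Zw0.
apply: contrapT => no; move: Zw0; rewrite none// => -[] /eqP.
by rewrite oner_eq0.
Qed.

(** Almost surely some sign event holds, and on it [h] is constant; hence [h] agrees almost
    everywhere with a finite combination of indicators of equal probability. *)
Lemma rademacher_mean (h : Omega -> R) (phi : {set 'I_n} -> R) :
  measurable_fun setT h ->
  (forall w S, (forall k : 'I_n, X k w = rad k S) -> h w = phi S) ->
  P.-integrable setT (EFin \o h) /\ \int[P]_w h w = cube_mean phi.
Proof.
move=> mh hphi; pose g w : R := \sum_S phi S * ind S w.
have ig : P.-integrable setT (EFin \o g).
  by apply: integrable_sum => S; apply: integrableZ_real; have [] := int_ind S.
have hg : {ae P, forall w, h w = g w}.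
  apply: filterS ae_sign_event => w [S Sw].
  by rewrite /g (sum_ind phi Sw) (hphi w S).
have mEh : measurable_fun setT (EFin \o h) by exact/measurable_EFinP.
have e (u : R -> \bar R) : measurable_fun setT (u \o h) -> measurable_fun setT (u \o g) ->
    (\int[P]_w u (h w) = \int[P]_w u (g w))%E.
  move=> mu1 mu2; apply: ae_eq_integral => //.
  by apply: filterS hg => w /= -> _.
split.
  apply/integrableP; split => //.
  have /integrableP[mg] := ig; rewrite -(e (fun x => `|x%:E|%E))//.
  - exact: measurableT_comp mEh.
  - exact: measurableT_comp mg.
rewrite /Rintegral (e EFin)//; last exact: measurable_int ig.
rewrite -/(Rintegral P setT g) Rintegral_sum; last first.
  by move=> S; apply: integrableZ_real; have [] := int_ind S.
rewrite /cube_mean mulr_sumr; apply: eq_bigr => S _; have [i eS] := int_ind S.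
by rewrite RintegralZl// eS mulrC.
Qed.

Lemma walsh_poly_rad q (f : q.-tuple nat -> R) w S :
  (forall k : 'I_n, X k w = rad k S) ->
  multiple_integral_partial X f n w = walsh_poly (walsh_coef f) S.
Proof.
move=> h; rewrite multiple_integral_partialE; apply: eq_bigr => A _.
by congr (_ * _); apply: eq_bigr => k _; exact: h.
Qed.

Lemma measurable_multiple_integral_partial q (f : q.-tuple nat -> R) :
  measurable_fun setT (multiple_integral_partial X f n).
Proof.
rewrite (_ : multiple_integral_partial X f n
  = (fun w => \sum_(A : {set 'I_n}) walsh_coef f A * \prod_(k in A) X k w)); last first.
  by apply/funext => w; rewrite multiple_integral_partialE.
apply: measurable_sum => A; apply: measurable_funM => //.
rewrite (_ : (fun w => _) = (fun w => \prod_(k <- enum A) X k w)); last first.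
  by apply/funext => w; rewrite big_enum.
apply: measurable_prod => k _; exact: measurable_funPT.
Qed.

End rademacher_mean.

Section quadratic_limits.
Local Open Scope classical_set_scope.
Context {R : realType}.

(** Young's inequality with a free parameter takes the place of Cauchy-Schwarz for integrals: [eta]
    is fixed first so that the first term is small, then [n] tends to infinity. *)
Lemma cvg_of_young_bound (u : R^nat) (l A : R) (a : R^nat) (B : R -> R) :
  a n @[n --> \oo] --> (0 : R) ->
  (forall eta, 0 < eta -> \forall n \near \oo, `|l - u n| <= eta * A + a n * B eta) ->
  u n @[n --> \oo] --> l.
Proof.
move=> a0 h; apply/cvgrPdist_le => e e0.
pose eta := e / (2 * (`|A| + 1)).
have A1 : 0 < `|A| + 1 by rewrite ltr_wpDl.
have eta0 : 0 < eta by rewrite divr_gt0// mulr_gt0.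
have etaA : eta * A <= e / 2.
  apply: (@le_trans _ _ (eta * (`|A| + 1))).
    by apply: ler_wpM2l; [exact: ltW|apply: le_trans (ler_norm _) _; rewrite lerDl].
  by rewrite /eta le_eqVlt; apply/orP; left; apply/eqP; field; rewrite gt_eqF.
have aB : a n * B eta @[n --> \oo] --> (0 : R).
  by rewrite -(mul0r (B eta)); apply: cvgM => //; exact: cvg_cst.
have /cvgrPdist_le /(_ (e / 2)) := aB; rewrite divr_gt0// => /(_ isT) haB.
near=> n; have h1 : `|l - u n| <= eta * A + a n * B eta by near: n; exact: h.
have h2 : `|0 - a n * B eta| <= e / 2 by near: n.
by rewrite sub0r normrN in h2; have := ler_norm (a n * B eta); lra.
Unshelve. all: by end_near. Qed.

Lemma young_product (x y eta : R) : 0 < eta ->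
  `|x * y| <= eta * x ^+ 2 + eta^-1 * y ^+ 2.
Proof.
move=> eta0; rewrite normrM -(real_normK (num_real x)) -(real_normK (num_real y)).
move: (normr_ge0 x) (normr_ge0 y); set u := `|x|; set v := `|y| => u0 v0.
rewrite -(ler_pM2l eta0) mulrDr !mulrA mulfV ?gt_eqF// mul1r.
by have := sqr_ge0 (eta * u - v); nra.
Qed.

Lemma young_linear (v eta : R) : 0 < eta -> `|v| <= eta + eta^-1 * v ^+ 2.
Proof.
by move=> eta0; have := young_product 1 v eta0; rewrite mul1r expr1n mulr1.
Qed.

End quadratic_limits.

(** * Convergence of covariances and of means of trigonometric polynomials under truncation *)

Section approximation_in_L2.
Local Open Scope classical_set_scope.
Context {R : realType} {d : nat} {dO : measure_display} {Omega : measurableType dO}.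
Variables (P : probability Omega R) (X : nat -> {RV P >-> R}) (q : 'I_d -> nat).
Variables (f : forall i : 'I_d, (q i).-tuple nat -> R) (F : 'I_d -> {RV P >-> R}).
Arguments f : clear implicits.
Hypothesis radX : rademacher_sequence X.
Hypothesis intF : forall i, is_multiple_integral P X (f i) (F i).

Let Fn n i w : R := multiple_integral_partial X (f i) n w.
Let D n i w : R := F i w - Fn n i w.
Let al n i : {set 'I_n} -> R := walsh_coef (f i).

Let mF i : measurable_fun setT (F i : Omega -> R).
Proof. exact: measurable_funPT. Qed.

Let mFn n i : measurable_fun setT (Fn n i).
Proof. exact: measurable_multiple_integral_partial. Qed.

Let mD n i : measurable_fun setT (D n i).
Proof. exact: measurable_funB. Qed.

Let D2 : (forall i, \forall n \near \oo, P.-integrable setT (EFin \o (fun w => D n i w ^+ 2)))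
  /\ forall i, \int[P]_w (D n i w ^+ 2) @[n --> \oo] --> (0 : R).
Proof.
have h i := intF i.
have fin i : (\forall n \near \oo, 'E_P[fun w => (D n i w ^+ 2)%R] \is a fin_num)%E.
  exact: cvg_is_fine (h i).
split=> i.
  apply: filterS (fin i) => n; rewrite unlock => finn.
  apply/integrableP; split; first by apply/measurable_EFinP; exact: measurable_funX.
  under eq_integral do rewrite /= ger0_norm ?sqr_ge0//.
  by rewrite ltey_eq finn.
have /fine_cvgP[_] := h i; rewrite (_ : fine \o _ = (fun n => \int[P]_w (D n i w ^+ 2))) //.
by apply/funext => n; rewrite /= unlock.
Qed.

Let FnS n w S : (forall k : 'I_n, X k w = rad k S) ->
  rv_vec (Fn n) w = chaos_vec (@al n) S.
Proof. by move=> h; apply/rowP => i; rewrite !mxE; exact: walsh_poly_rad. Qed.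

Let Fn2_integrable n i j : P.-integrable setT (EFin \o (fun w => Fn n i w * Fn n j w)) /\
  \int[P]_w (Fn n i w * Fn n j w)
  = cube_mean (fun S => walsh_poly (@al n i) S * walsh_poly (@al n j) S).
Proof.
apply: (@rademacher_mean _ _ _ P X radX n (fun w => Fn n i w * Fn n j w)).
  exact: measurable_funM.
by move=> w S h; congr (_ * _); exact: walsh_poly_rad.
Qed.

(** Convergence to 0 in the extended reals makes the second moment of the error finite for some [n],
    and the truncated integral [Fn n i] takes finitely many values almost surely. *)
Lemma multiple_integral_sqr_integrable i :
  P.-integrable setT (EFin \o (fun w => F i w ^+ 2)).
Proof.
have [/(_ i) [n _ /(_ n (leqnn _)) iD] _] := D2.
have [iFn _] := Fn2_integrable n i i.
apply: (@le_integrable_real _ _ _ _ _ (fun w => 2 * (D n i w ^+ 2 + Fn n i w * Fn n i w))).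
- exact: measurable_funX.
- move=> w; rewrite ger0_norm ?sqr_ge0// /D.
  by have := sqr_ge0 (F i w - 2 * Fn n i w); nra.
- by apply: integrableZ_real; exact: integrableD_real.
Qed.

Let a n : R := \sum_i \int[P]_w (D n i w ^+ 2).

Let a_cvg : a n @[n --> \oo] --> (0 : R).
Proof.
have [_ c] := D2; rewrite (_ : 0 = \sum_(i < d) 0 :> R); last by rewrite big1.
by apply: cvg_sum_seq => i _; exact: c.
Qed.

Let D2near : \forall n \near \oo, forall i, P.-integrable setT (EFin \o (fun w => D n i w ^+ 2)).
Proof. by have [h _] := D2; apply: filter_forall. Qed.

Let Fcov_integrable i j : P.-integrable setT (EFin \o (fun w => F i w * F j w)).
Proof. by apply: integrable_mul_real => //; exact: multiple_integral_sqr_integrable. Qed.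

Lemma covariance_cvg i j :
  cube_mean (fun S => walsh_poly (@al n i) S * walsh_poly (@al n j) S)
  @[n --> \oo] --> fine 'E_P[(F i : Omega -> R) * F j]%E.
Proof.
pose A := \int[P]_w (F i w ^+ 2) + \int[P]_w (F j w ^+ 2).
apply: (@cvg_of_young_bound _ _ _ A a (fun eta => 2 * (eta^-1 + 1)) a_cvg) => eta eta0.
near=> n.
have iD : forall k, P.-integrable setT (EFin \o (fun w => D n k w ^+ 2)).
  by near: n; exact: D2near.
have [iFn <-] := Fn2_integrable n i j.
have -> : fine 'E_P[(F i : Omega -> R) * F j]%E = \int[P]_w (F i w * F j w) by rewrite unlock.
rewrite -RintegralB//.
have iF := multiple_integral_sqr_integrable.
pose M w := eta * (F i w ^+ 2 + F j w ^+ 2) + (eta^-1 + 1) * (D n i w ^+ 2 + D n j w ^+ 2).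
have iM : P.-integrable setT (EFin \o M).
  by apply: integrableD_real; apply: integrableZ_real; exact: integrableD_real.
have idiff := integrableB_real (Fcov_integrable i j) iFn.
apply: (le_trans (le_normr_Rintegral measurableT idiff)).
apply: (@le_trans _ _ (\int[P]_w M w)).
  apply: le_Rintegral => //.
    rewrite (_ : _ \o _ = abse \o (EFin \o (fun w => F i w * F j w - Fn n i w * Fn n j w)))//.
    exact: integrable_abse.
  move=> w _.
  (* Only F, whose second moments do not depend on [n], and the errors D occur here, so Young's
     inequality gives eta times a constant plus a small term. *)
  rewrite (_ : _ - _ = F i w * D n j w + D n i w * F j w - D n i w * D n j w); last first.
    by rewrite /D; ring.
  have y1 := young_product (F i w) (D n j w) eta0; have y2 := young_product (F j w) (D n i w) eta0.
  have y3 : `|D n i w * D n j w| <= D n i w ^+ 2 + D n j w ^+ 2.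
    rewrite normrM -(real_normK (num_real (D n i w))) -(real_normK (num_real (D n j w))).
    by have := normr_ge0 (D n i w); have := normr_ge0 (D n j w); nra.
  apply: (le_trans (ler_normB _ _)); apply: (le_trans (lerD (ler_normD _ _) (lexx _))).
  by rewrite [D n i w * F j w]mulrC /M; lra.
have e : \int[P]_w M w = eta * A
    + (eta^-1 + 1) * (\int[P]_w (D n i w ^+ 2) + \int[P]_w (D n j w ^+ 2)).
  rewrite RintegralD//; try by apply: integrableZ_real; exact: integrableD_real.
  by rewrite !RintegralZl// ?RintegralD//; exact: integrableD_real.
have Da k : \int[P]_w (D n k w ^+ 2) <= a n.
  rewrite /a (bigD1 k) //= lerDl.
  by apply: sumr_ge0 => k' _; apply: Rintegral_ge0 => w _; exact: sqr_ge0.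
rewrite e lerD2l [a n * _]mulrCA [X in _ <= 2 * X]mulrC mulrCA.
apply: ler_wpM2l; first by rewrite addr_ge0// invr_ge0 ltW.
by rewrite mulr2n mulrDl mul1r; exact: lerD.
Unshelve. all: by end_near. Qed.

Lemma tp_eval_mean_cvg (l : seq (R * 'rV[R]_d * R)) (K : R) :
  (forall i x, `|tp_eval l [:: i] x| <= K) ->
  cube_mean (fun S => tp_eval l [::] (chaos_vec (@al n) S))
  @[n --> \oo] --> \int[P]_w tp_eval l [::] (rv_vec F w).
Proof.
move=> hK.
have mtp (Z : 'I_d -> Omega -> R) : (forall i, measurable_fun setT (Z i)) ->
    measurable_fun setT (fun w => tp_eval l [::] (rv_vec Z w)).
  move=> mZ; have := measurable_tp_eval l [::] 0 1 mZ.
  by under eq_fun do rewrite scale1r add0r.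
have [K' hK'] := tp_eval_bounded l [::].
apply: (@cvg_of_young_bound _ _ _ (K * d%:R) a (fun eta => `|K| * eta^-1) a_cvg) => eta eta0.
near=> n.
have iD : forall k, P.-integrable setT (EFin \o (fun w => D n k w ^+ 2)).
  by near: n; exact: D2near.
have [iT <-] : P.-integrable setT (EFin \o (fun w => tp_eval l [::] (rv_vec (Fn n) w))) /\
    \int[P]_w tp_eval l [::] (rv_vec (Fn n) w)
    = cube_mean (fun S => tp_eval l [::] (chaos_vec (@al n) S)).
  apply: (@rademacher_mean _ _ _ P X radX n (fun w => tp_eval l [::] (rv_vec (Fn n) w))).
    by apply: mtp.
  by move=> w S h; rewrite (FnS h).
have iTF : P.-integrable setT (EFin \o (fun w => tp_eval l [::] (rv_vec F w))).
  by apply: (@integrable_bounded_real _ _ _ _ _ K'); [exact: mtp|move=> w; exact: hK'].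
rewrite -RintegralB//.
have idiff := integrableB_real iTF iT.
apply: (le_trans (le_normr_Rintegral measurableT idiff)).
pose M w := \sum_i `|K| * (eta + eta^-1 * D n i w ^+ 2).
have iM : P.-integrable setT (EFin \o M).
  apply: integrable_sum => i; apply: integrableZ_real; apply: integrableD_real.
    exact: finite_measure_integrable_cst.
  exact: integrableZ_real.
have K0 (i : 'I_d) : 0 <= K by exact: le_trans (normr_ge0 _) (hK i 0).
apply: (@le_trans _ _ (\int[P]_w M w)).
  apply: le_Rintegral => //.
    rewrite (_ : _ \o _ = abse \o (EFin \o
      (fun w => tp_eval l [::] (rv_vec F w) - tp_eval l [::] (rv_vec (Fn n) w))))//.
    exact: integrable_abse.
  move=> w _; apply: (le_trans (tp_eval_lipschitz hK _ _)).
  rewrite mulr_sumr; apply: ler_sum => i _; rewrite [`|K|]ger0_norm ?K0//.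
  apply: ler_wpM2l; first exact: K0.
  by rewrite !mxE; exact: young_linear.
rewrite le_eqVlt; apply/orP; left; apply/eqP; rewrite /M Rintegral_sum; last first.
  move=> i; apply: integrableZ_real; apply: integrableD_real.
    exact: finite_measure_integrable_cst.
  exact: integrableZ_real.
rewrite /a mulr_suml (_ : eta * (K * d%:R) = \sum_(i < d) eta * `|K|); last first.
  case: (posnP d) => [d0|dpos].
    by rewrite big1 => [|i]; [rewrite d0 !mulr0|move: (ltn_ord i); rewrite [X in (_ < X)%N]d0].
  rewrite sumr_const card_ord (ger0_norm (K0 (Ordinal dpos))) -mulr_natr; ring.
rewrite -big_split; apply: eq_bigr => i _ /=.
rewrite RintegralZl//; last first.
  apply: integrableD_real; first exact: finite_measure_integrable_cst.
  exact: integrableZ_real.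
rewrite RintegralD//; last 2 first.
- exact: finite_measure_integrable_cst.
- exact: integrableZ_real.
by rewrite Rintegral_prob_cst RintegralZl//; ring.
Unshelve. all: by end_near. Qed.

End approximation_in_L2.

Section test_function_means.
Local Open Scope classical_set_scope.
Context {R : realType} {d : nat} {dO : measure_display} {Omega : measurableType dO}.
Variables (P : probability Omega R) (Z : 'I_d -> Omega -> R) (g : 'rV[R]_d -> R).
Hypothesis mZ : forall i, measurable_fun setT (Z i).
Hypothesis iZ : forall i, P.-integrable setT (EFin \o (fun w => Z i w ^+ 2)).
Hypothesis tg : d4_test_functions g.

Let W w : R := 2 * d%:R + \sum_i rv_vec Z w 0 i ^+ 2.

Let iW : P.-integrable setT (EFin \o W).
Proof.
apply: integrableD_real; first exact: finite_measure_integrable_cst.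
apply: integrable_sum => i.
by rewrite (_ : (fun w => _) = (fun w => Z i w ^+ 2))//; apply/funext => w; rewrite mxE.
Qed.

Let W0 w : 0 <= W w.
Proof. by rewrite addr_ge0 ?mulr_ge0// sumr_ge0// => i _; exact: sqr_ge0. Qed.

Let mtp l : measurable_fun setT (fun w => tp_eval l [::] (rv_vec Z w)).
Proof.
have := measurable_tp_eval l [::] 0 1 mZ.
by under eq_fun do rewrite scale1r add0r.
Qed.

(** The composition with the test function is a pointwise limit of trigonometric polynomials in the
    coordinates, hence measurable. *)
Let mg : measurable_fun setT (fun w => g (rv_vec Z w)).
Proof.
pose l n := projT1 (cid (test_function_approx tg (ltn0Sn n))).
apply: (@measurable_fun_cvg _ _ _ _ (fun n w => tp_eval (l n) [::] (rv_vec Z w))) => // w _.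
have h n : `|tp_eval (l n) [::] (rv_vec Z w) - g (rv_vec Z w)| <= W w * n.+1%:R^-1.
  by rewrite /l; case: cid => l' [_ h] /=; exact: h.
apply/cvgrPdist_le => e e0.
have c : W w * n.+1%:R^-1 @[n --> \oo] --> (0 : R).
  rewrite -(mulr0 (W w)); apply: cvgMr; exact: cvg_harmonic.
move/cvgrPdist_le : c => /(_ e e0); apply: filterS => n.
rewrite sub0r normrN => hn; rewrite distrC; apply: le_trans (h n) _.
by apply: le_trans hn; exact: ler_norm.
Qed.

Lemma test_function_integrable : P.-integrable setT (EFin \o (fun w => g (rv_vec Z w))).
Proof.
have [l [_ h]] := test_function_approx tg (ltn0Sn 0).
have [K hK] := tp_eval_bounded l [::].
apply: (@le_integrable_real _ _ _ _ _ (fun w => K + W w)) => // [w|].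
  have := h (rv_vec Z w); rewrite invr1 mulr1 -/(W w) => hw.
  rewrite -[g _](subKr (tp_eval l [::] (rv_vec Z w))).
  by apply: le_trans (ler_normB _ _) _; exact: lerD.
by apply: integrableD_real => //; exact: finite_measure_integrable_cst.
Qed.

Lemma test_function_mean_approx n l : (0 < n)%N ->
  (forall x, `|tp_eval l [::] x - g x| <= (2 * d%:R + \sum_i x 0 i ^+ 2) * n%:R^-1) ->
  `|\int[P]_w tp_eval l [::] (rv_vec Z w) - \int[P]_w g (rv_vec Z w)|
  <= (\int[P]_w W w) * n%:R^-1.
Proof.
move=> n0 h; have [K hK] := tp_eval_bounded l [::].
have il : P.-integrable setT (EFin \o (fun w => tp_eval l [::] (rv_vec Z w))).
  exact: integrable_bounded_real (mtp l) (fun w => hK _).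
rewrite -RintegralB//; last exact: test_function_integrable.
have idiff := integrableB_real il test_function_integrable.
apply: (le_trans (le_normr_Rintegral measurableT idiff)).
rewrite -RintegralZr//; apply: le_Rintegral => //.
  rewrite (_ : _ \o _ = abse \o (EFin \o
      (fun w => tp_eval l [::] (rv_vec Z w) - g (rv_vec Z w))))//.
  exact: integrable_abse.
by under eq_fun do rewrite mulrC; exact: integrableZ_real.
Qed.

End test_function_means.

(** * The bound on the distance *)

Section normal_approximation.
Local Open Scope classical_set_scope.
Context {R : realType} {d : nat}.
Variable q : 'I_d -> nat.

Let c i j : R := (q i)`!%:R * (q j)`!%:R.

(** For each pair, 1 accounts for the covariance gap and the square root for the standard deviation
    of the carre du champ, with [minn (q i) (q j)] bounding the number of orders r. The last sum
    accounts for the fourth moments of the gradients. *)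
Definition comparison_constant : R :=
  \sum_i \sum_j (1 + Num.sqrt (2 ^+ (q i + q j) * ((minn (q i) (q j))%:R * c i j ^+ 2)))
  + d%:R ^+ 3 * \sum_i 16 ^+ q i * c i i ^+ 2.

Lemma comparison_constant_ge0 : 0 <= comparison_constant.
Proof.
apply: addr_ge0; last first.
  apply: mulr_ge0; first exact: exprn_ge0.
  by apply: sumr_ge0 => i _; apply: mulr_ge0; [exact: exprn_ge0|exact: sqr_ge0].
by apply: sumr_ge0 => i _; apply: sumr_ge0 => j _; rewrite addr_ge0 ?sqrtr_ge0.
Qed.

Context {dO : measure_display} {Omega : measurableType dO}
  {dO' : measure_display} {Omega' : measurableType dO'}.
Variables (P : probability Omega R) (X : nat -> {RV P >-> R}).
Variables (f : forall i : 'I_d, (q i).-tuple nat -> R) (F : 'I_d -> {RV P >-> R}).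
Variables (P' : probability Omega' R) (N : 'I_d -> {RV P' >-> R}) (Sigma : 'M[R]_d).
Arguments f : clear implicits.
Hypothesis radX : rademacher_sequence X.
Hypothesis ff : forall i, ell02 (f i).
Hypothesis intF : forall i, is_multiple_integral P X (f i) (F i).
Hypothesis gaussN : centred_gaussian_vector N Sigma.
Hypothesis q2 : forall i, (2 <= q i)%N.

Let gap i j := `|Sigma i j - fine 'E_P[(F i : Omega -> R) * F j]%E|.
Let B := first_bound f gap.

Let mF i : measurable_fun setT (F i : Omega -> R).
Proof. exact: measurable_funPT. Qed.

Let mN i : measurable_fun setT (N i : Omega' -> R).
Proof. exact: measurable_funPT. Qed.

Let scn n i j r := set_contraction_norm2 (q i) (q j) r
  (walsh_coef (f i) : {set 'I_n} -> R) (walsh_coef (f j)).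

Let bcn n i j r : R := box_contraction_norm2 n (q i - r) (q j - r) r
  (fun s => f i (as_tuple (q i) s)) (fun s => f j (as_tuple (q j) s)).

Let scn_le n i j r : (r <= q i)%N -> (r <= q j)%N -> scn n i j r <= c i j ^+ 2 * bcn n i j r.
Proof.
move=> ri rj; have [_ si ni] := ff i; have [_ sj nj] := ff j.
exact: set_contraction_norm2_le.
Qed.

Let bcn_cvg i j r : (r <= q i)%N -> (r <= q j)%N ->
  bcn n i j r @[n --> \oo] --> cnorm f i j r ^+ 2.
Proof.
by move=> ri rj; exact: box_contraction_norm2_cvg.
Qed.

(** The limit of [chaos_vec_bound] as the truncation level tends to infinity, after set contractions
    have been replaced by box contractions, whose norms converge. *)
Lemma tp_mean_distance_le (l : seq (R * 'rV[R]_d * R)) (K : R) : 0 <= K ->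
  (forall s x, (0 < size s <= 4)%N -> `|tp_eval l s x| <= K) ->
  `|\int[P]_w tp_eval l [::] (rv_vec F w) - \int[P']_w tp_eval l [::] (rv_vec N w)|
  <= K * (\sum_i \sum_j (gap i j
        + Num.sqrt (2 ^+ (q i + q j) *
            \sum_(1 <= r < (minn (q i) (q j)).+1 | (q i != q j) || (r != q i))
              c i j ^+ 2 * cnorm f i j r ^+ 2))
     + d%:R ^+ 3 * \sum_i 16 ^+ q i * (c i i ^+ 2 * cnorm f i i (q i).-1 ^+ 2)).
Proof.
move=> K0 hK.
pose m n i j := cube_mean (fun S : {set 'I_n} =>
  walsh_poly (walsh_coef (f i)) S * walsh_poly (walsh_coef (f j)) S).
pose rhs n := K * (\sum_i \sum_j (`|Sigma i j - m n i j|
        + Num.sqrt (2 ^+ (q i + q j) *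
            \sum_(1 <= r < (minn (q i) (q j)).+1 | (q i != q j) || (r != q i))
              c i j ^+ 2 * bcn n i j r))
     + d%:R ^+ 3 * \sum_i 16 ^+ q i * (c i i ^+ 2 * bcn n i i (q i).-1)).
have hK1 i x : `|tp_eval l [:: i] x| <= K by exact: hK.
pose lhs n := `|cube_mean (fun S : {set 'I_n} =>
    tp_eval l [::] (chaos_vec (fun i => walsh_coef (f i)) S))
  - \int[P']_w tp_eval l [::] (rv_vec N w)|.
apply: (@ler_cvg_to _ \oo _ _ lhs rhs).
  apply: cvg_norm; apply: cvgB; last exact: cvg_cst.
  exact: (tp_eval_mean_cvg radX intF hK1).
  apply: cvgMr; apply: cvgD.
    apply: cvg_sum_seq => i _; apply: cvg_sum_seq => j _; apply: cvgD.
      apply: cvg_norm; apply: cvgB; first exact: cvg_cst.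
      exact: (covariance_cvg radX intF).
    apply: continuous_cvg; first exact: sqrt_continuous.
    apply: cvgMr; rewrite -big_filter; under eq_cvg do rewrite -big_filter.
    apply: cvg_sum_seq => r; rewrite mem_filter mem_index_iota ltnS leq_min.
    by move=> /and4P[_ _ ri rj]; apply: cvgMr; exact: bcn_cvg.
  apply: cvgMr; apply: cvg_sum_seq => i _; do 2 apply: cvgMr.
  by apply: bcn_cvg; exact: leq_pred.
apply: nearW => n; rewrite /lhs -(heat_tp0 gaussN).
have q0 i : (0 < q i)%N by exact: ltnW.
apply: le_trans (chaos_vec_bound (n := n) (al := fun i => walsh_coef (f i)) (K := K) q0 _ _ K0) _.
- by move=> i; exact: walsh_coef_homogeneous.
- move=> tau s x tau01 hs; apply: (heat_tp_bound gaussN) => // y.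
  by apply: hK; case: hs => ->.
apply: ler_wpM2l => //; apply: lerD.
  apply: ler_sum => i _; apply: ler_sum => j _; rewrite lerD2l; apply: ler_wsqrtr.
  apply: ler_wpM2l; first exact: exprn_ge0.
  rewrite big_seq_cond [leRHS]big_seq_cond; apply: ler_sum => r.
  rewrite mem_index_iota ltnS leq_min => /andP[/and3P[_ ri rj] _].
  exact: scn_le.
apply: ler_wpM2l; first exact: exprn_ge0.
apply: ler_sum => i _; apply: ler_wpM2l; first exact: exprn_ge0.
by apply: scn_le; exact: leq_pred.
Qed.

Let B_term i j : [/\ gap i j <= B,
  (\big[Num.max/0]_(1 <= r < (minn (q i) (q j)).+1) cnorm f i j r) * (q i != q j)%:R <= B,
  (\big[Num.max/0]_(1 <= r < q i) cnorm f i j r) * (q i == q j)%:R <= B &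
  \big[Num.max/0]_(1 <= r < q i) (cnorm f i i r) ^+ 2 <= B].
Proof.
have h : Num.max (gap i j)
   (Num.max ((\big[Num.max/0]_(1 <= r < (minn (q i) (q j)).+1) cnorm f i j r)
               * (q i != q j)%:R)
   (Num.max ((\big[Num.max/0]_(1 <= r < q i) cnorm f i j r) * (q i == q j)%:R)
            (\big[Num.max/0]_(1 <= r < q i) (cnorm f i i r) ^+ 2))) <= B.
  by apply: le_trans (le_bigmax _ _ i); exact: (le_bigmax _ _ j).
by move: h; rewrite !ge_max => /and4P[].
Qed.

Let B0 : 0 <= B.
Proof. exact: first_bound_ge0. Qed.

Let cnorm_le i j r : (1 <= r < (minn (q i) (q j)).+1)%N ->
  (q i != q j) || (r != q i) -> cnorm f i j r <= B.
Proof.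
move=> rm hr; have [_ h2 h3 _] := B_term i j.
have one : (true : nat)%:R = 1 :> R by [].
have [qij|qij] := eqVneq (q i) (q j).
  move: hr h3; rewrite qij eqxx /= one mulr1 => hr; apply: le_trans.
  rewrite -qij; apply: (Order.TotalTheory.le_bigmax_seq 0 r xpredT (fun r => cnorm f i j r)) => //.
  by move: rm; rewrite mem_index_iota qij minnn ltnS [(r < _)%N]ltn_neqAle hr.
move: h2; rewrite qij one mulr1; apply: le_trans.
by apply: (Order.TotalTheory.le_bigmax_seq 0 r xpredT (fun r => cnorm f i j r)) => //;
  rewrite mem_index_iota.
Qed.

Lemma tp_mean_distance_le_first_bound (l : seq (R * 'rV[R]_d * R)) (K : R) : 0 <= K ->
  (forall s x, (0 < size s <= 4)%N -> `|tp_eval l s x| <= K) ->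
  `|\int[P]_w tp_eval l [::] (rv_vec F w) - \int[P']_w tp_eval l [::] (rv_vec N w)|
  <= K * comparison_constant * B.
Proof.
move=> K0 hK; apply: (le_trans (tp_mean_distance_le K0 hK)); rewrite -mulrA.
apply: ler_wpM2l => //; rewrite /comparison_constant mulrDl; apply: lerD.
  rewrite mulr_suml; apply: ler_sum => i _; rewrite mulr_suml; apply: ler_sum => j _.
  have [h1 _ _ _] := B_term i j; rewrite mulrDl mul1r; apply: lerD => //.
  have eB : B = Num.sqrt (B ^+ 2) by rewrite sqrtr_sqr ger0_norm.
  rewrite [in leRHS]eB -sqrtrM; last first.
    by rewrite !mulr_ge0 ?exprn_ge0 ?sqr_ge0.
  apply: ler_wsqrtr; rewrite -mulrA; apply: ler_wpM2l; first exact: exprn_ge0.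
  have -> : (minn (q i) (q j))%:R * c i j ^+ 2 * B ^+ 2
      = \sum_(1 <= r < (minn (q i) (q j)).+1) c i j ^+ 2 * B ^+ 2.
    by rewrite sumr_const_nat subn1 /= -[RHS]mulr_natl -[LHS]mulrA.
  rewrite big_mkcond; apply: ler_sum_nat => r rm.
  case: ifPn => hr; last by apply: mulr_ge0; exact: sqr_ge0.
  apply: ler_wpM2l; first exact: sqr_ge0.
  by rewrite ler_pXn2r// ?nnegrE ?sqrtr_ge0//; exact: cnorm_le.
rewrite -mulrA mulr_suml; apply: ler_wpM2l; first exact: exprn_ge0.
apply: ler_sum => i _; rewrite -mulrA; apply: ler_wpM2l; first exact: exprn_ge0.
apply: ler_wpM2l; first exact: sqr_ge0.
have [_ _ _ ] := B_term i i; apply: le_trans.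
(* The fourth moments involve the order r = q_i - 1, which lies in the range 1 <= r < q_i of the
   maximum because q_i >= 2. *)
apply: (Order.TotalTheory.le_bigmax_seq 0 (q i).-1 xpredT (fun r => cnorm f i i r ^+ 2)) => //.
by have := q2 i; rewrite mem_index_iota; case: (q i) => [|[|k]] //= _; exact: ltnSn.
Qed.

Lemma d4_le_first_bound :
  (d4 P P' F N <= (`|approx_constant| * comparison_constant * B)%:E)%E.
Proof.
apply: ge_ereal_sup => _ [g tg <-].
have iF := multiple_integral_sqr_integrable radX intF.
have iN := gaussian_sqr_integrable gaussN.
have igF := test_function_integrable mF iF tg.
have igN := test_function_integrable mN iN tg.
rewrite unlock.
rewrite -(fineK (integrable_fin_num measurableT igF)).
rewrite -(fineK (integrable_fin_num measurableT igN)).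
rewrite -EFinB /= lee_fin.
rewrite -[fine _]/(\int[P]_w g (rv_vec F w)) -[X in _ - X]/(\int[P']_w g (rv_vec N w)).
set mg := \int[P]_w g _; set mg' := \int[P']_w g _.
pose A : R := \int[P]_w (2 * d%:R + \sum_i rv_vec F w 0 i ^+ 2)
   + \int[P']_w (2 * d%:R + \sum_i rv_vec N w 0 i ^+ 2).
set C := _ * B.
(* [C] does not depend on the quality of the approximation of [g], and [A] collects second moments
   of F and N, so that the last term vanishes in the limit. *)
have h n : `|mg - mg'| <= C + A * n.+1%:R^-1.
  have [l [hl1 hl2]] := test_function_approx tg (ltn0Sn n).
  have e1 := test_function_mean_approx mF iF tg (ltn0Sn n) hl2.
  have e2 := test_function_mean_approx mN iN tg (ltn0Sn n) hl2.
  have e3 : `|\int[P]_w tp_eval l [::] (rv_vec F w)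
     - \int[P']_w tp_eval l [::] (rv_vec N w)| <= C.
    apply: tp_mean_distance_le_first_bound => // s x hs.
    by apply: le_trans (hl1 s x hs) _; exact: ler_norm.
  rewrite /A mulrDl addrA; move: e1 e2 e3; rewrite -/mg -/mg'.
  set a := \int[P]_w tp_eval _ _ _; set b := \int[P']_w tp_eval _ _ _ => e1 e2 e3.
  have -> : mg - mg' = (a - b) - (a - mg) + (b - mg') by ring.
  apply: (le_trans (ler_normD _ _)); apply: lerD => //.
  by apply: (le_trans (ler_normB _ _)); exact: lerD.
have cA : C + A * n.+1%:R^-1 @[n --> \oo] --> C.
  rewrite -[X in _ --> X]addr0 -[X in _ + X](mulr0 A).
  by apply: cvgD; [exact: cvg_cst|apply: cvgMr; exact: cvg_harmonic].
by apply: (ler_cvg_to (cvg_cst _) cA); exact: nearW.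
Qed.

End normal_approximation.

Local Open Scope classical_set_scope.

(* A maximum over 1 <= r <= q_i - 1 presupposes q_i >= 2.  With an empty maximum
   read as 0, the bound on d4 fails whenever some q_i = 1 (take F_i = X_0,
   the other F_j = 0, Sigma_ii = 1 and the other entries of Sigma 0), so that
   bound is guarded; the comparison of the two right-hand sides is not. *)
Theorem corollary5p1 (R : realType) (d : nat) (q : 'I_d -> nat) :
  (2 <= d)%N -> (forall i, 1 <= q i)%N ->
  exists C1 C2 : R, [/\ 0 < C1, 0 < C2 &
    forall (dO : measure_display) (Omega : measurableType dO)
           (P : probability Omega R) (X : nat -> {RV P >-> R})
           (f : forall i : 'I_d, (q i).-tuple nat -> R)
           (F : 'I_d -> {RV P >-> R})
           (dO' : measure_display) (Omega' : measurableType dO')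
           (P' : probability Omega' R) (Sigma : 'M[R]_d)
           (N : 'I_d -> {RV P' >-> R}),
      rademacher_sequence X ->
      (forall i, ell02 (f i)) ->
      (forall i, is_multiple_integral P X (f i) (F i)) ->
      centred_gaussian_vector N Sigma ->
      (forall i j, q i != q j -> Sigma i j = 0) ->
      let gap i j := `|Sigma i j - fine 'E_P[(F i : Omega -> R) * F j]| in
      ((forall i, 2 <= q i)%N ->
        (d4 P P' F N <= (C1 * first_bound f gap)%:E)%E) /\
      C1 * first_bound f gap <= C2 * second_bound f gap].
Proof.
move=> _ _.
(* The summand 1 makes the constant positive. The same constant serves twice because
   [first_le_second] compares the maxima with constant 1. *)
pose C : R := `|approx_constant| * comparison_constant q + 1.
have K0 : 0 <= `|approx_constant| * comparison_constant q :> R.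
  by rewrite mulr_ge0 ?comparison_constant_ge0.
have C0 : 0 < C by rewrite ltr_pwDr.
exists C, C; split=> //.
move=> dO Omega P X f F dO' Omega' P' Sigma N radX ff intF gaussN _ gap.
split=> [q2|]; last by apply: ler_wpM2l; [exact: ltW|exact: first_le_second].
apply: le_trans (d4_le_first_bound radX ff intF gaussN q2) _.
rewrite lee_fin; apply: ler_wpM2r; [exact: first_bound_ge0|by rewrite lerDl].
Qed.
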